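(* Let $T>0$ and let $\lambda$ be real analytic on $[0,T]$ (real-valued). Then the Loewner curve $\gamma$ generated by $\lambda$, parametrized by halfplane capacity, is real analytic on $(0,T]$.
   Context: Chordal Loewner equation: for a continuous real function $\lambda$ on $[0,T]$ and $z\in\mathbb{H}$, $g_t(z)$ solves $\partial_t g_t(z)=\frac{2}{g_t(z)-\lambda(t)}$, $g_0(z)=z$, up to $T_z=\inf\{t: g_t(z)=\lambda(t)\}$; $K_t=\{z\in\mathbb{H}:T_z\le t\}$; $g_t:\mathbb{H}\setminus K_t\to\mathbb{H}$ is conformal with $g_t(z)=z+\frac{2t}{z}+O(z^{-2})$ at $\infty$. $\lambda$ generates $\gamma:[0,T]\to\overline{\mathbb{H}}$ if for each $t$, $\mathbb{H}\setminus K_t$ is the unbounded component of $\mathbb{H}\setminus\gamma(0,t]$; then $\lambda(t)=g_t(\gamma(t))$ and $\gamma$ is parametrized by halfplane capacity. *)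

(* Defs.v *)
From Stdlib Require Import Reals.
Open Scope R_scope.

Definition Cpx := (R * R)%type.
Definition Cre (z : Cpx) : R := fst z.
Definition Cim (z : Cpx) : R := snd z.
Definition Cnorm (z : Cpx) : R := sqrt (Cre z ^ 2 + Cim z ^ 2).
Definition Cdist (z w : Cpx) : R := Cnorm (Cre z - Cre w, Cim z - Cim w).

Definition inH (z : Cpx) : Prop := 0 < Cim z.

(* right-hand side of the chordal Loewner equation: 2 / (w - lam), as a pair *)
Definition loewner_rhs (w : Cpx) (l : R) : Cpx :=
  let a := Cre w - l in let b := Cim w in
  (2 * a / (a ^ 2 + b ^ 2), - (2 * b) / (a ^ 2 + b ^ 2)).

Definition Ccont_on (a b : R) (h : R -> Cpx) : Prop :=
  forall s, a <= s <= b -> forall eps, 0 < eps -> exists delta, 0 < delta /\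
    forall u, a <= u <= b -> Rabs (u - s) < delta -> Cdist (h u) (h s) < eps.

(* h solves the Loewner ODE from z on [0,t] without hitting lam, i.e. t < T_z *)
Definition loewner_solution (lam : R -> R) (t : R) (z : Cpx) (h : R -> Cpx) : Prop :=
  h 0 = z /\
  Ccont_on 0 t h /\
  (forall s, 0 <= s <= t -> h s <> (lam s, 0)) /\
  (forall s, 0 < s < t ->
     derivable_pt_lim (fun u => Cre (h u)) s (Cre (loewner_rhs (h s) (lam s))) /\
     derivable_pt_lim (fun u => Cim (h u)) s (Cim (loewner_rhs (h s) (lam s)))).

(* the hull K_t = { z in H : T_z <= t } *)
Definition in_hull (lam : R -> R) (t : R) (z : Cpx) : Prop :=
  inH z /\ ~ (exists h, loewner_solution lam t z h).

Definition path_connected_in (U : Cpx -> Prop) (z w : Cpx) : Prop :=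
  exists p : R -> Cpx, Ccont_on 0 1 p /\ p 0 = z /\ p 1 = w /\
    forall u, 0 <= u <= 1 -> U (p u).

Definition in_unbounded_component (U : Cpx -> Prop) (z : Cpx) : Prop :=
  U z /\ forall M : R, exists w, M < Cnorm w /\ path_connected_in U z w.

Definition loewner_generates (T : R) (lam : R -> R) (gam : R -> Cpx) : Prop :=
  Ccont_on 0 T gam /\
  (forall t, 0 <= t <= T -> 0 <= Cim (gam t)) /\
  (forall t, 0 <= t <= T -> forall z,
     (inH z /\ ~ in_hull lam t z) <->
     in_unbounded_component
       (fun w => inH w /\ ~ (exists s, 0 < s <= t /\ gam s = w)) z).

Definition real_analytic_on (D : R -> Prop) (f : R -> R) : Prop :=
  forall t0, D t0 -> exists r : R, 0 < r /\ exists a : nat -> R,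
    forall t, D t -> Rabs (t - t0) < r ->
      Un_cv (fun N => sum_f_R0 (fun n => a n * (t - t0) ^ n) N) (f t).

(* Main.v *)
(** Reversing time, a point lies outside the hull K_t exactly when it is the value at time t of a
    solution of h' = -2 / (h - lam (t - s)) started in the upper half-plane.  The point gamma(t) is
    the value at time t of the singular solution started at h(0) = lam(t).  Near the singularity
    X = h - lam (t - s) satisfies (-X^2)' = 4 + 2 X lam', hence X stays in a narrow cone around the
    imaginary axis; there the difference of two solutions is nonincreasing, because its logarithmic
    derivative 2 / (X1 X2) has negative real part.  This gives existence of the singular solution (as
    the limit of the solutions started at lam(t) + i y), its uniqueness, and, since a forward
    trajectory that ceases to exist must collide with lam, the identity K_t = gamma(0,t].

    For analyticity at t0, the parameter t = t0 + x is made complex: the flow from time t to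
    t0 - e, rescaled to a fixed time interval, is the same equation with a factor zeta = 1 + x / e
    close to 1, and the cone argument is stable under such a factor.  Euler's scheme shows that the
    solutions started at height y > 0 are uniform limits of polynomials in x on a complex disc;
    letting y -> 0, and then flowing from t0 - e down to time 0, the same holds for gamma(t0 + x).
    By Cauchy's estimate for polynomials, such a uniform limit is a power series. *)

Require Import Defs.
From Stdlib Require Import Arith Reals Lra Lia Psatz Classical ClassicalEpsilon List.
From Coquelicot Require Import Coquelicot.
Open Scope R_scope.

(** * Calculus of complex-valued functions of a real variable *)

(** At the tip the field -2 / X is undefined, and at height c its Lipschitz constant is of order 1 /
    c^2, so the standard theory yields neither existence nor uniqueness nor dependence on a
    parameter there. The contraction in the cone yields all three, with bounds independent of the
    starting height. A complex time t0 + x cannot be the end of a time interval; the rescaling moves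
    x into the equation instead. The driving point becomes t0 + x - zeta s, which is t0 + x at s = 0
    and the real time t0 - e at s = e, whatever x is. This matters because the complex extension of
    [lam] exists only near t0: beyond t0 - e the parameter survives in the initial value alone, and
    the driving function is the given real one. Holomorphy is replaced by uniform approximability by
    polynomials on a closed disc. That class is closed under sums, products, uniform limits and
    inversion of functions with values in a half-plane Im >= c > 0, which is what an Euler step
    uses. *)

Lemma fun_choice {A B : Type} (P : A -> B -> Prop) :
  (forall x, exists y, P x y) -> exists f, forall x, P x (f x).
Proof.
  intros H.
  exists (fun x => proj1_sig (constructive_indefinite_description _ (H x))).
  intros x. exact (proj2_sig (constructive_indefinite_description _ (H x))).
Qed.

Lemma derive_add (f g : R -> R) x a b :
  is_derive f x a -> is_derive g x b -> is_derive (fun t => f t + g t) x (a + b).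
Proof. intros; now apply (is_derive_plus f g). Qed.

Lemma derive_sub (f g : R -> R) x a b :
  is_derive f x a -> is_derive g x b -> is_derive (fun t => f t - g t) x (a - b).
Proof. intros; now apply (is_derive_minus f g). Qed.

Lemma derive_neg (f : R -> R) x a :
  is_derive f x a -> is_derive (fun t => - f t) x (- a).
Proof. intros; now apply (is_derive_opp f). Qed.

Lemma derive_mul (f g : R -> R) x a b :
  is_derive f x a -> is_derive g x b ->
  is_derive (fun t => f t * g t) x (a * g x + f x * b).
Proof. intros; apply (is_derive_mult f g); auto. intros; apply Rmult_comm. Qed.

Lemma derive_const (c x : R) : is_derive (fun _ : R => c) x 0.
Proof. apply (@is_derive_const R_AbsRing R_NormedModule). Qed.

Lemma derive_id (x : R) : is_derive (fun t : R => t) x 1.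
Proof. apply (@is_derive_id R_AbsRing). Qed.

Lemma derive_exp (f : R -> R) x a :
  is_derive f x a -> is_derive (fun t => exp (f t)) x (a * exp (f x)).
Proof.
  intros H. apply (is_derive_comp exp f x (exp (f x)) a); auto.
  apply is_derive_exp.
Qed.

Lemma derive_eq (f : R -> R) x a b : is_derive f x a -> @eq R a b -> is_derive f x b.
Proof. now intros H <-. Qed.

Lemma cont_add (f g : R -> R) x :
  continuous f x -> continuous g x -> continuous (fun t => f t + g t) x.
Proof. intros; now apply (continuous_plus f g). Qed.

Lemma cont_sub (f g : R -> R) x :
  continuous f x -> continuous g x -> continuous (fun t => f t - g t) x.
Proof. intros; now apply (continuous_minus f g). Qed.

Lemma cont_neg (f : R -> R) x : continuous f x -> continuous (fun t => - f t) x.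
Proof. intros; now apply (continuous_opp f). Qed.

Lemma cont_mul (f g : R -> R) x :
  continuous f x -> continuous g x -> continuous (fun t => f t * g t) x.
Proof. intros; now apply (continuous_mult f g). Qed.

Lemma cont_const (c x : R) : continuous (fun _ : R => c) x.
Proof. apply continuous_const. Qed.

Lemma cont_id (x : R) : continuous (fun t : R => t) x.
Proof. apply continuous_id. Qed.

Lemma cont_exp (f : R -> R) x : continuous f x -> continuous (fun t => exp (f t)) x.
Proof. intros H. apply (continuous_comp f exp); auto. apply continuous_exp. Qed.

Lemma cont_comp (f g : R -> R) x :
  continuous f x -> continuous g (f x) -> continuous (fun t => g (f t)) x.
Proof. intros; now apply (continuous_comp f g). Qed.

Lemma cont_iff_eps (f : R -> R) s :
  continuous f s <->
  forall eps, 0 < eps -> exists delta, 0 < delta /\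
    forall u, Rabs (u - s) < delta -> Rabs (f u - f s) < eps.
Proof.
  unfold continuous. rewrite filterlim_locally. split.
  - intros H eps he. destruct (H (mkposreal eps he)) as [d hd].
    exists d; split; [apply cond_pos|]. intros u hu. apply hd. exact hu.
  - intros H eps. destruct (H eps (cond_pos eps)) as [d [hd0 hd]].
    exists (mkposreal d hd0). intros u hu. apply hd. exact hu.
Qed.

Lemma cont_max (c : R) (f : R -> R) x :
  continuous f x -> continuous (fun t => Rmax c (f t)) x.
Proof.
  rewrite !cont_iff_eps. intros H eps he. destruct (H eps he) as [d [hd hd']].
  exists d; split; auto. intros u hu. specialize (hd' u hu).
  revert hd'. unfold Rmax, Rabs. repeat destruct Rle_dec; repeat destruct Rcase_abs; lra.
Qed.

Ltac prove_cont := cbv beta; lazymatch goal with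
  | |- continuous (fun _ => ?c) ?x => apply (cont_const c x)
  | |- continuous (fun t => t) ?x => apply (cont_id x)
  | |- continuous (fun t => (@?f t + @?g t)%R) ?x => apply (cont_add f g x); prove_cont
  | |- continuous (fun t => (@?f t - @?g t)%R) ?x => apply (cont_sub f g x); prove_cont
  | |- continuous (fun t => (@?f t * @?g t)%R) ?x => apply (cont_mul f g x); prove_cont
  | |- continuous (fun t => (- @?f t)%R) ?x => apply (cont_neg f x); prove_cont
  | |- continuous (fun t => exp (@?f t)) ?x => apply (cont_exp f x); prove_cont
  | |- continuous (fun t => Rmax ?c (@?f t)) ?x => apply (cont_max c f x); prove_cont
  | _ => solve [auto]
  end.

(** All differential inequalities below reduce to this one. Derivatives are asked for only inside
    the interval, since trajectories may be singular at its ends; continuity on the whole line is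
    obtained by clamping. *)
Lemma derive_nonneg_le (f : R -> R) a b :
  a <= b -> (forall s, continuous f s) ->
  (forall s, a < s < b -> exists d, is_derive f s d /\ 0 <= d) -> f a <= f b.
Proof.
  intros [hab|<-] hc hd; [|lra].
  assert (pr : forall c, a < c < b -> derivable_pt f c).
  { intros c hcab. apply ex_derive_Reals_0.
    destruct (hd c hcab) as [d [hd1 _]]. now exists d. }
  destruct (MVT f id a b pr (fun c _ => derivable_pt_id c) hab) as [c [P H]].
  - intros c _. apply continuity_pt_filterlim, hc.
  - intros c _. apply derivable_continuous_pt, derivable_pt_id.
  - rewrite derive_pt_id in H. unfold id in H.
    destruct (hd c P) as [d [hd1 hd0]].
    assert (derive_pt f c (pr c P) = d).
    { apply derive_pt_eq_0. now apply is_derive_Reals. }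
    rewrite H0 in H. nra.
Qed.

(** * Complex-valued functions and differential inequalities *)

Definition ccont (f : R -> C) : Prop :=
  (forall s, continuous (fun u => Re (f u)) s) /\
  (forall s, continuous (fun u => Im (f u)) s).

Definition cderive (f : R -> C) (s : R) (d : C) : Prop :=
  is_derive (fun u => Re (f u)) s (Re d) /\ is_derive (fun u => Im (f u)) s (Im d).

Lemma im_le_Cmod (z : C) : Rabs (Im z) <= Cmod z.
Proof.
  eapply Rle_trans; [|apply Rmax_Cmod]. apply Rmax_r.
Qed.

Lemma Cmod_le_abs (z : C) : Cmod z <= Rabs (Re z) + Rabs (Im z).
Proof.
  replace z with ((Re z, 0) + (0, Im z))%C at 1.
  2:{ destruct z; unfold Cplus; simpl; f_equal; ring. }
  eapply Rle_trans; [apply Cmod_triangle|].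
  apply Rplus_le_compat; unfold Cmod; simpl.
  - replace (_ + _) with (Rsqr (Re z)) by (unfold Rsqr; simpl; ring).
    rewrite sqrt_Rsqr_abs. simpl; lra.
  - replace (_ + _) with (Rsqr (Im z)) by (unfold Rsqr; simpl; ring).
    rewrite sqrt_Rsqr_abs. simpl; lra.
Qed.

Lemma Cmod_sq (z : C) : Cmod z * Cmod z = Re z * Re z + Im z * Im z.
Proof. pose proof (Cmod2_alt z). simpl in H. lra. Qed.

Lemma Cmod_minus_sym (z w : C) : Cmod (z - w)%C = Cmod (w - z)%C.
Proof. rewrite <- Cmod_opp. f_equal. ring. Qed.

Lemma Cmod_tri3 (a b c : C) : Cmod (a - c)%C <= Cmod (a - b)%C + Cmod (b - c)%C.
Proof. replace (a - c)%C with ((a - b) + (b - c))%C by ring. apply Cmod_triangle. Qed.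

Lemma Cmod_small_eq (z w : C) :
  (forall eps, 0 < eps -> Cmod (z - w)%C <= eps) -> z = w.
Proof.
  intros H. assert (Cmod (z - w)%C = 0).
  { pose proof (Cmod_ge_0 (z - w)%C). destruct (Rle_lt_or_eq_dec _ _ H0); [|auto].
    specialize (H (Cmod (z - w)%C / 2)). lra. }
  apply Cmod_eq_0 in H0. replace z with ((z - w) + w)%C by ring. rewrite H0. ring.
Qed.

Lemma ccont_iff_eps (f : R -> C) :
  ccont f <-> forall s eps, 0 < eps -> exists delta, 0 < delta /\
    forall u, Rabs (u - s) < delta -> Cmod (f u - f s)%C < eps.
Proof.
  split.
  - intros [H1 H2] s eps he.
    destruct (proj1 (cont_iff_eps _ s) (H1 s) (eps / 2)) as [d1 [p1 q1]]; [lra|].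
    destruct (proj1 (cont_iff_eps _ s) (H2 s) (eps / 2)) as [d2 [p2 q2]]; [lra|].
    exists (Rmin d1 d2); split; [apply Rmin_pos; auto|]. intros u hu.
    eapply Rle_lt_trans; [apply Cmod_le_abs|].
    assert (Rabs (u - s) < d1) by (eapply Rlt_le_trans; [exact hu | apply Rmin_l]).
    assert (Rabs (u - s) < d2) by (eapply Rlt_le_trans; [exact hu | apply Rmin_r]).
    specialize (q1 u H). specialize (q2 u H0).
    change (Re (f u - f s)%C) with (Re (f u) - Re (f s)).
    change (Im (f u - f s)%C) with (Im (f u) - Im (f s)). lra.
  - intros H. split; intros s; apply cont_iff_eps; intros eps he;
      destruct (H s eps he) as [d [hd hd']]; exists d; split; auto; intros u hu;
      (eapply Rle_lt_trans; [|apply (hd' u hu)]).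
    + apply (re_le_Cmod (f u - f s)%C).
    + apply (im_le_Cmod (f u - f s)%C).
Qed.

Lemma cderive_ccont (f : R -> C) : (forall s, exists d, cderive f s d) -> ccont f.
Proof.
  intros H. split; intros s; destruct (H s) as [d [h1 h2]];
    (apply (@ex_derive_continuous R_AbsRing R_NormedModule); eexists; eauto).
Qed.

Lemma cderive_sub f g s d e :
  cderive f s d -> cderive g s e -> cderive (fun u => f u - g u)%C s (d - e)%C.
Proof.
  intros [h1 h2] [k1 k2]; split; simpl.
  - apply (derive_sub (fun u => Re (f u)) (fun u => Re (g u))); auto.
  - apply (derive_sub (fun u => Im (f u)) (fun u => Im (g u))); auto.
Qed.

Lemma ccont_sub f g : ccont f -> ccont g -> ccont (fun u => f u - g u)%C.
Proof.
  intros [h1 h2] [k1 k2]; split; intros s; simpl.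
  - apply (cont_sub (fun u => Re (f u)) (fun u => Re (g u))); auto.
  - apply (cont_sub (fun u => Im (f u)) (fun u => Im (g u))); auto.
Qed.

Lemma ccont_const c : ccont (fun _ => c).
Proof. split; intros s; apply cont_const. Qed.

Lemma cauchy_schwarz (z w : C) : Re z * Re w + Im z * Im w <= Cmod z * Cmod w.
Proof.
  replace (Re z * Re w + Im z * Im w) with (Re (Cconj z * w)%C).
  2:{ unfold Re, Im; simpl; ring. }
  rewrite <- (Cmod_conj z), <- Cmod_mult.
  eapply Rle_trans; [apply Rle_abs | apply re_le_Cmod].
Qed.

(** Project on the increment w = f b - f a: by Cauchy-Schwarz the real function |w| g - <w, f> is
    nondecreasing, which gives |w|^2 <= |w| (g b - g a). If w = 0, monotonicity of [g] is what
    remains to be shown. *)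
Lemma mean_value_ineq (f : R -> C) (g : R -> R) a b :
  a <= b -> ccont f -> (forall s, continuous g s) ->
  (forall s, a < s < b -> exists d e, cderive f s d /\ is_derive g s e /\ Cmod d <= e) ->
  Cmod (f b - f a)%C <= g b - g a.
Proof.
  intros hab [hf1 hf2] hg hd.
  set (w := (f b - f a)%C).
  assert (H : Cmod w * g a - (Re w * Re (f a) + Im w * Im (f a)) <=
              Cmod w * g b - (Re w * Re (f b) + Im w * Im (f b))).
  { apply (derive_nonneg_le (fun s => Cmod w * g s - (Re w * Re (f s) + Im w * Im (f s)))); auto.
    - intros s. specialize (hf1 s); specialize (hf2 s); specialize (hg s). prove_cont.
    - intros s hs. destruct (hd s hs) as [d [e [[h1 h2] [h3 h4]]]].
      eexists; split.
      + apply derive_sub; [apply derive_mul; [apply derive_const|exact h3]|].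
        apply derive_add; (apply derive_mul; [apply derive_const|]); [exact h1|exact h2].
      + pose proof (cauchy_schwarz w d). pose proof (Cmod_ge_0 w). nra. }
  assert (K : Cmod w * Cmod w <= Cmod w * (g b - g a)).
  { rewrite Cmod_sq. unfold w at 1 2 3 4. simpl Re. simpl Im.
    unfold w in H at 2 3 5 6; simpl in H. unfold Re, Im in *. lra. }
  pose proof (Cmod_ge_0 w) as [hw|hw]; [nra|].
  rewrite <- hw. assert (g a <= g b); [|lra].
  apply derive_nonneg_le; auto. intros s hs. destruct (hd s hs) as [d [e [_ [h3 h4]]]].
  exists e; split; auto. pose proof (Cmod_ge_0 d); lra.
Qed.

Lemma normsq_der (D : R -> C) s d :
  cderive D s d ->
  is_derive (fun u => Re (D u) * Re (D u) + Im (D u) * Im (D u)) s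
    (2 * (Re (D s) * Re d + Im (D s) * Im d)).
Proof.
  intros [h1 h2]. eapply derive_eq.
  - apply derive_add; apply derive_mul; eassumption.
  - cbv beta. ring.
Qed.

Lemma normsq_cont (D : R -> C) s :
  ccont D -> continuous (fun u => Re (D u) * Re (D u) + Im (D u) * Im (D u)) s.
Proof. intros [h1 h2]; specialize (h1 s); specialize (h2 s). prove_cont. Qed.

Lemma Cmod_le_sq (z w : C) (k : R) : 0 <= k ->
  Re z * Re z + Im z * Im z <= k * k * (Re w * Re w + Im w * Im w) ->
  Cmod z <= k * Cmod w.
Proof.
  intros hk H. rewrite <- !Cmod_sq in H.
  pose proof (Cmod_ge_0 z). pose proof (Cmod_ge_0 w).
  apply Rsqr_incr_0_var; [unfold Rsqr; nra | nra].
Qed.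

(** The squared modulus is differentiable even where D vanishes, and |D|^2 exp (-2 K s) is
    nonincreasing. *)
Lemma gronwall (D : R -> C) K a b :
  a <= b -> ccont D ->
  (forall s, a < s < b -> exists d, cderive D s d /\ Cmod d <= K * Cmod (D s)) ->
  Cmod (D b) <= exp (K * (b - a)) * Cmod (D a).
Proof.
  intros hab hc hd.
  set (N := fun u => Re (D u) * Re (D u) + Im (D u) * Im (D u)).
  assert (H : - (N a * exp (- (2 * K) * a)) <= - (N b * exp (- (2 * K) * b))).
  { apply (derive_nonneg_le (fun s => - (N s * exp (- (2 * K) * s)))); auto.
    - intros s. apply cont_neg, cont_mul; [now apply normsq_cont|]. prove_cont.
    - intros s hs. destruct (hd s hs) as [d [h1 h2]].
      eexists; split.
      + apply derive_neg, derive_mul; [apply normsq_der; exact h1|].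
        apply derive_exp, derive_mul; [apply derive_const|apply derive_id].
      + fold (N s). pose proof (cauchy_schwarz (D s) d).
        assert (N s = Cmod (D s) * Cmod (D s)) by (unfold N; now rewrite Cmod_sq).
        pose proof (exp_pos (- (2 * K) * s)). pose proof (Cmod_ge_0 (D s)).
        set (c := Re (D s) * Re d + Im (D s) * Im d) in *.
        assert (c <= K * N s) by nra.
        assert (0 <= (K * N s - c) * exp (- (2 * K) * s)) by nra.
        lra. }
  apply Cmod_le_sq; [apply Rlt_le, exp_pos|].
  fold (N a) (N b).
  rewrite <- exp_plus.
  assert (N b = N b * exp (- (2 * K) * b) * exp (2 * K * b)).
  { rewrite Rmult_assoc, <- exp_plus. replace (_ + _) with 0 by ring. rewrite exp_0; ring. }
  rewrite H0.
  replace (exp (K * (b - a) + K * (b - a)) * N a)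
    with (N a * exp (- (2 * K) * a) * exp (2 * K * b)).
  2:{ rewrite Rmult_assoc, <- exp_plus. rewrite Rmult_comm. f_equal. f_equal. ring. }
  apply Rmult_le_compat_r; [apply Rlt_le, exp_pos|lra].
Qed.

Lemma mul_lt_of_lt_div K x e : 0 < K -> x < e / K -> K * x < e.
Proof.
  intros hK h. apply Rmult_lt_compat_l with (r := K) in h; auto.
  now replace (K * (e / K)) with e in h by (field; lra).
Qed.

Lemma mul_le_of_le_div K x e : 0 < K -> x <= e / K -> K * x <= e.
Proof.
  intros hK h. apply Rmult_le_compat_l with (r := K) in h; [|lra].
  now replace (K * (e / K)) with e in h by (field; lra).
Qed.

Lemma mul_le_one K x : 0 < K -> x <= / K -> K * x <= 1.
Proof. intros hK h. apply mul_le_of_le_div; auto. unfold Rdiv. lra. Qed.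

Lemma exp_le_compat x y : x <= y -> exp x <= exp y.
Proof. intros [h|<-]; [now apply Rlt_le, exp_increasing|lra]. Qed.

Lemma exp_le_3_of_le_1 x : x <= 1 -> exp x <= 3.
Proof. intros h. eapply Rle_trans; [apply exp_le_compat, h|apply exp_le_3]. Qed.

Ltac pose_Rmin a b := pose proof (Rmin_l a b); pose proof (Rmin_r a b).

(** The exit time is the supremum of the times up to which f stays at or above c. It is the
    continuity argument behind every bootstrap on a truncated flow. *)
Lemma first_exit (f : R -> R) a b c :
  a <= b -> (forall s, continuous f s) -> c <= f a -> f b < c ->
  exists s, a <= s < b /\ f s = c /\ forall u, a <= u <= s -> c <= f u.
Proof.
  intros hab hf hfa hfb.
  set (E := fun s => a <= s <= b /\ forall u, a <= u <= s -> c <= f u).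
  destruct (completeness E) as [m [hm1 hm2]].
  - exists b. intros x [hx _]; lra.
  - exists a. split; [lra|]. intros u hu. replace u with a by lra. auto.
  - assert (ham : a <= m).
    { apply hm1. split; [lra|]. intros u hu. replace u with a by lra. auto. }
    assert (hmb : m <= b) by (apply hm2; intros x [hx _]; lra).
    assert (hbelow : forall u, a <= u < m -> c <= f u).
    { intros u hu. destruct (classic (exists x, E x /\ u < x)) as [[x [[_ hx] hux]]|hn].
      - apply hx; lra.
      - exfalso. assert (m <= u); [|lra]. apply hm2. intros x hx.
        destruct (Rle_or_lt x u); auto. exfalso; apply hn; eauto. }
    assert (hge : c <= f m).
    { destruct ham as [ham|<-]; [|auto].
      destruct (Rle_or_lt c (f m)); auto. exfalso.
      destruct (proj1 (cont_iff_eps f m) (hf m) (c - f m)) as [d [hd hd']]; [lra|].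
      assert (h : Rmax a (m - d / 2) < m) by (apply Rmax_lub_lt; lra).
      pose proof (Rmax_l a (m - d / 2)). pose proof (Rmax_r a (m - d / 2)).
      specialize (hbelow (Rmax a (m - d / 2)) ltac:(lra)).
      specialize (hd' (Rmax a (m - d / 2))).
      rewrite Rabs_left in hd' by lra. specialize (hd' ltac:(lra)).
      apply Rabs_def2 in hd'. lra. }
    assert (hmE : forall u, a <= u <= m -> c <= f u).
    { intros u hu. destruct (Rle_lt_or_eq_dec u m ltac:(lra)) as [h| ->]; auto.
      apply hbelow; lra. }
    assert (hmb' : m < b) by (destruct hmb as [h|h]; [auto|subst; lra]).
    exists m; repeat split; auto; [].
    apply Rle_antisym; auto.
    destruct (Rle_or_lt (f m) c) as [h|h]; auto. exfalso.
    destruct (proj1 (cont_iff_eps f m) (hf m) (f m - c)) as [d [hd hd']]; [lra|].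
    assert (E (Rmin b (m + d / 2))).
    { split; [split; [apply Rmin_glb; lra | apply Rmin_l]|].
      intros u hu. pose proof (Rmin_r b (m + d / 2)).
      destruct (Rle_or_lt u m); [apply hmE; lra|].
      specialize (hd' u). rewrite Rabs_right in hd' by lra.
      specialize (hd' ltac:(lra)). apply Rabs_def2 in hd'. lra. }
    apply hm1 in H. assert (m < Rmin b (m + d / 2)) by (apply Rmin_glb_lt; lra). lra.
Qed.

Lemma Cminus_diag (z : C) : (z - z)%C = 0%C.
Proof. ring. Qed.

(** The limit inherits the rate [e]; since the rate does not depend on time or parameter in the
    applications, the limits are uniform. *)
Lemma C_complete (c : nat -> C) (e : nat -> R) :
  (forall k m, (k <= m)%nat -> Cmod (c m - c k)%C <= e k) ->
  (forall eps, 0 < eps -> exists k, e k < eps) ->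
  exists l, forall k, Cmod (c k - l)%C <= e k.
Proof.
  intros H He.
  assert (hc : forall p : C -> R, (forall z w, Rabs (p z - p w) <= Cmod (z - w)%C) ->
    exists l, Un_cv (fun n => p (c n)) l).
  { intros p hp. destruct (Rcomplete.R_complete (fun n => p (c n))) as [l hl]; [|eauto].
    intros eps he. destruct (He (eps / 2)) as [k hk]; [lra|].
    exists k. intros n m hn hm. unfold Rdist.
    eapply Rle_lt_trans; [apply hp|].
    eapply Rle_lt_trans; [apply (Cmod_tri3 _ (c k))|].
    rewrite (Cmod_minus_sym (c k)).
    pose proof (H k n ltac:(lia)). pose proof (H k m ltac:(lia)). lra. }
  destruct (hc Re) as [lr hr]; [intros z w; apply (re_le_Cmod (z - w)%C)|].
  destruct (hc Im) as [li hi]; [intros z w; apply (im_le_Cmod (z - w)%C)|].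
  exists (lr, li). intros k.
  apply le_epsilon. intros eps he.
  destruct (hr (eps / 2)) as [n1 h1]; [lra|]. destruct (hi (eps / 2)) as [n2 h2]; [lra|].
  set (n := (k + n1 + n2)%nat).
  specialize (h1 n ltac:(lia)). specialize (h2 n ltac:(lia)).
  eapply Rle_trans; [apply (Cmod_tri3 _ (c n))|].
  rewrite (Cmod_minus_sym (c k)).
  apply Rplus_le_compat; [apply H; lia|].
  eapply Rle_trans; [apply Cmod_le_abs|].
  unfold Rdist in *. simpl. unfold Re, Im in *. unfold Rminus in *. lra.
Qed.

Lemma pow_half_lt (B eps : R) : 0 < eps -> exists k : nat, B * (/ 2) ^ k < eps.
Proof.
  intros he.
  destruct (pow_lt_1_zero (/ 2)) with (y := eps / (Rabs B + 1)) as [n hn].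
  - rewrite Rabs_right; lra.
  - apply Rdiv_lt_0_compat; [auto|]. pose proof (Rabs_pos B); lra.
  - exists n. specialize (hn n ltac:(lia)).
    assert (0 < (/ 2) ^ n) by (apply pow_lt; lra).
    rewrite Rabs_right in hn by lra.
    pose proof (Rabs_pos B).
    apply Rmult_lt_compat_r with (r := Rabs B + 1) in hn; [|lra].
    unfold Rdiv in hn. rewrite Rmult_assoc, Rinv_l, Rmult_1_r in hn by lra.
    pose proof (Rle_abs B). nra.
Qed.

Lemma C_geom_complete (c : nat -> C) (B : R) :
  (forall k, Cmod (c (S k) - c k)%C <= B * (/ 2) ^ k) ->
  exists l, forall k, Cmod (c k - l)%C <= 2 * B * (/ 2) ^ k.
Proof.
  intros H. apply C_complete.
  - intros k m hkm.
    enough (Cmod (c m - c k)%C <= 2 * B * ((/ 2) ^ k - (/ 2) ^ m)).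
    { assert (0 <= B).
      { specialize (H 0%nat). simpl in H. pose proof (Cmod_ge_0 (c 1%nat - c 0%nat)%C). lra. }
      assert (0 < (/ 2) ^ m) by (apply pow_lt; lra). nra. }
    induction hkm.
    + replace (c k - c k)%C with (RtoC 0) by (unfold Cminus; now rewrite Cplus_opp_r).
      rewrite Cmod_0. lra.
    + eapply Rle_trans; [apply (Cmod_tri3 _ (c m))|].
      specialize (H m). simpl pow. lra.
  - intros eps he. apply pow_half_lt; auto.
Qed.

(** Composition with this 1-Lipschitz retraction extends a function on [a, b] continuously to the
    line, which is how functions given on an interval meet [ccont]. *)
Definition clamp (a b s : R) : R := Rmax a (Rmin b s).

Lemma clamp_in a b s : a <= b -> a <= clamp a b s <= b.
Proof.
  intros. unfold clamp, Rmax, Rmin. repeat destruct Rle_dec; lra.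
Qed.

Lemma clamp_id a b s : a <= s <= b -> clamp a b s = s.
Proof. intros. unfold clamp, Rmax, Rmin. repeat destruct Rle_dec; lra. Qed.

Lemma clamp_lip a b s u : Rabs (clamp a b u - clamp a b s) <= Rabs (u - s).
Proof.
  unfold clamp, Rmax, Rmin, Rabs.
  repeat destruct Rle_dec; repeat destruct Rcase_abs; lra.
Qed.

Lemma antideriv (G : R -> C) a z0 :
  ccont G -> exists psi, psi a = z0 /\ forall s, cderive psi s (G s).
Proof.
  intros [h1 h2].
  assert (D : forall g : R -> R, (forall s, continuous g s) ->
     forall s, is_derive (fun t => RInt g a t) s (g s)).
  { intros g hg s. apply (is_derive_RInt g (fun t => RInt g a t) a s); [|apply hg].
    apply filter_forall. intros t. apply (@RInt_correct R_CompleteNormedModule).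
    apply (@ex_RInt_continuous R_CompleteNormedModule). auto. }
  exists (fun t => (Re z0 + RInt (fun s => Re (G s)) a t,
                    Im z0 + RInt (fun s => Im (G s)) a t)).
  split.
  - rewrite !RInt_point. destruct z0; unfold zero; simpl. f_equal; ring.
  - intros s. split; simpl.
    + eapply derive_eq; [apply derive_add; [apply derive_const|apply (D (fun s => Re (G s))); auto]|cbv beta; ring].
    + eapply derive_eq; [apply derive_add; [apply derive_const|apply (D (fun s => Im (G s))); auto]|cbv beta; ring].
Qed.

Lemma ccont_bounded (f : R -> C) a b :
  ccont f -> a <= b -> exists A, 0 <= A /\ forall s, a <= s <= b -> Cmod (f s) <= A.
Proof.
  intros [h1 h2] hab.
  destruct (continuity_ab_maj
     (fun s => Re (f s) * Re (f s) + Im (f s) * Im (f s)) a b hab) as [m [hm _]].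
  { intros c _. apply continuity_pt_filterlim.
    apply (normsq_cont f c). now split. }
  exists (Cmod (f m)). split; [apply Cmod_ge_0|]. intros s hs. specialize (hm s hs). simpl in hm.
  rewrite <- (Rmult_1_l (Cmod (f m))). apply Cmod_le_sq; lra.
Qed.

(** In the norm weighted by exp (2 K (t - a)) the integral operator contracts by 1/2, so the
    iteration converges on all of [a, b] at once, without subdividing the interval. *)
Lemma picard (F : R -> C -> C) (K a b : R) (z0 : C) :
  a <= b -> 0 <= K ->
  (forall s z w, Cmod (F s z - F s w)%C <= K * Cmod (z - w)%C) ->
  (forall phi, ccont phi -> ccont (fun s => F s (phi s))) ->
  exists h, ccont h /\ h a = z0 /\ forall s, a < s < b -> cderive h s (F s (h s)).
Proof.
  intros hab hK HL HF.
  (* The iterates carry their continuity with them, because the next one is a primitive and needs a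
     continuous integrand. *)
  assert (step : forall phi : {f : R -> C | ccont f}, exists psi : {f : R -> C | ccont f},
     proj1_sig psi a = z0 /\ forall s, cderive (proj1_sig psi) s (F s (proj1_sig phi s))).
  { intros [phi hphi]. destruct (antideriv (fun s => F s (phi s)) a z0 (HF _ hphi)) as [psi [p q]].
    assert (hpsi : ccont psi) by (apply cderive_ccont; eauto).
    exists (exist _ psi hpsi). simpl. auto. }
  destruct (fun_choice _ step) as [nx hnx].
  set (ph := fix ph n := match n with
    | O => exist _ (fun _ : R => z0) (ccont_const z0)
    | S n => nx (ph n) end : {f : R -> C | ccont f}).
  set (phi := fun n => proj1_sig (ph n)).
  assert (pc : forall n, ccont (phi n)) by (intros n; apply (proj2_sig (ph n))).
  assert (pa : forall n, phi n a = z0).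
  { intros [|n]; [reflexivity|]. apply (hnx (ph n)). }
  assert (pd : forall n s, cderive (phi (S n)) s (F s (phi n s))).
  { intros n s. apply (hnx (ph n)). }
  destruct (ccont_bounded (fun s => F s z0) a b (HF _ (ccont_const z0)) hab) as [A [hA0 hA]].
  set (B := A * (b - a)).
  assert (hB : 0 <= B) by (unfold B; nra).
  assert (est : forall n t, a <= t <= b ->
     Cmod (phi (S n) t - phi n t)%C <= B * (/ 2) ^ n * exp (2 * K * (t - a))).
  { induction n; intros t ht.
    - assert (Cmod (phi 1%nat t - phi 1%nat a)%C <= A * t - A * a).
      { apply (mean_value_ineq (phi 1%nat) (fun t => A * t)); [lra|apply pc| |].
        - intros s; prove_cont.
        - intros s hs. exists (F s z0), A. split; [apply (pd 0%nat s)|split].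
          + eapply derive_eq; [apply derive_mul; [apply derive_const|apply derive_id]|cbv beta; ring].
          + apply hA; lra. }
      rewrite pa in H. change (phi 0%nat t) with z0. simpl pow.
      assert (1 <= exp (2 * K * (t - a))).
      { pose proof (exp_ineq1_le (2 * K * (t - a))). nra. }
      assert (A * t - A * a <= B) by (unfold B; nra). nra.
    - set (E := fun t => B * (/ 2) ^ (S n) * exp (2 * K * (t - a))).
      assert (Cmod ((phi (S (S n)) t - phi (S n) t) - (phi (S (S n)) a - phi (S n) a))%C
         <= E t - E a).
      { apply (mean_value_ineq (fun t => (phi (S (S n)) t - phi (S n) t)%C) E); [lra| | |].
        - apply ccont_sub; apply pc.
        - intros s. unfold E. prove_cont.
        - intros s hs. eexists; eexists. split; [|split].
          + apply cderive_sub; apply pd.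
          + unfold E. apply derive_mul; [apply derive_const|].
            apply derive_exp. apply derive_mul; [apply derive_const|]. apply derive_sub; [apply derive_id|apply derive_const].
          + eapply Rle_trans; [apply HL|]. specialize (IHn s ltac:(lra)).
            apply Rmult_le_compat_l with (r := K) in IHn; [|auto].
            eapply Rle_trans; [exact IHn|]. simpl pow. apply Req_le. field. }
      rewrite !pa in H.
      replace (phi (S (S n)) t - phi (S n) t - (z0 - z0))%C
        with (phi (S (S n)) t - phi (S n) t)%C in H by ring.
      assert (0 <= E a).
      { unfold E. apply Rmult_le_pos; [|apply Rlt_le, exp_pos].
        apply Rmult_le_pos; [auto|apply pow_le; lra]. }
      unfold E in H. unfold E in H0. lra. }
  set (B' := B * exp (2 * K * (b - a))).
  assert (est' : forall n t, a <= t <= b -> Cmod (phi (S n) t - phi n t)%C <= B' * (/ 2) ^ n).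
  { intros n t ht. eapply Rle_trans; [apply est; auto|]. unfold B'.
    assert (exp (2 * K * (t - a)) <= exp (2 * K * (b - a))) by (apply exp_le_compat; nra).
    assert (0 <= B * (/ 2) ^ n) by (apply Rmult_le_pos; [auto|apply pow_le; lra]). nra. }
  assert (lim : forall t, exists l, forall n,
     Cmod (phi n (clamp a b t) - l)%C <= 2 * B' * (/ 2) ^ n).
  { intros t. apply C_geom_complete. intros k. apply est'. now apply clamp_in. }
  destruct (fun_choice _ lim) as [h hh].
  assert (hc : ccont h).
  { apply ccont_iff_eps. intros s eps he.
    destruct (pow_half_lt (2 * B') (eps / 3)) as [n hn]; [lra|].
    destruct (proj1 (ccont_iff_eps _) (pc n) (clamp a b s) (eps / 3)) as [d [hd hd']]; [lra|].
    exists d; split; auto. intros u hu.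
    specialize (hd' (clamp a b u)).
    pose proof (clamp_lip a b s u). specialize (hd' ltac:(lra)).
    pose proof (hh u n). pose proof (hh s n).
    eapply Rle_lt_trans; [apply (Cmod_tri3 _ (phi n (clamp a b u)))|].
    rewrite (Cmod_minus_sym (h u)).
    pose proof (Cmod_tri3 (phi n (clamp a b u)) (phi n (clamp a b s)) (h s)). lra. }
  (* The solution is this primitive of the limit field; it is differentiable by construction and
     agrees with the limit [h] on [a, b]. *)
  destruct (antideriv (fun s => F s (h s)) a z0 (HF _ hc)) as [psi [p q]].
  assert (hpsi : ccont psi) by (apply cderive_ccont; eauto).
  assert (eq : forall t, a <= t <= b -> psi t = h t).
  { intros t ht. apply Cmod_small_eq. intros eps he.
    destruct (pow_half_lt (2 * B' * (K * (b - a) + 1)) eps he) as [n hn].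
    assert (Cmod ((psi t - phi (S n) t) - (psi a - phi (S n) a))%C <=
       K * (2 * B' * (/ 2) ^ n) * t - K * (2 * B' * (/ 2) ^ n) * a).
    { apply (mean_value_ineq (fun t => (psi t - phi (S n) t)%C)
         (fun t => K * (2 * B' * (/ 2) ^ n) * t)); [lra| | |].
      - apply ccont_sub; auto.
      - intros s; prove_cont.
      - intros s hs. eexists; eexists. split; [|split].
        + apply cderive_sub; [apply q|apply pd].
        + apply derive_mul; [apply derive_const|apply derive_id].
        + eapply Rle_trans; [apply HL|]. rewrite Cmod_minus_sym.
          pose proof (hh s n). rewrite clamp_id in H by lra.
          apply Rmult_le_compat_l with (r := K) in H; auto. lra. }
    rewrite p, pa in H.
    replace (psi t - phi (S n) t - (z0 - z0))%C with (psi t - phi (S n) t)%C in H by ring.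
    pose proof (hh t (S n)). rewrite clamp_id in H0 by lra. simpl in H0.
    eapply Rle_trans; [apply (Cmod_tri3 _ (phi (S n) t))|].
    assert (0 <= 2 * B' * (/ 2) ^ n).
    { eapply Rle_trans; [apply Cmod_ge_0|apply (hh t n)]. }
    assert (K * (2 * B' * (/ 2) ^ n) * t - K * (2 * B' * (/ 2) ^ n) * a <=
      K * (2 * B' * (/ 2) ^ n) * (b - a)).
    { assert (0 <= K * (2 * B' * (/ 2) ^ n)) by (apply Rmult_le_pos; auto). nra. }
    lra. }
  exists psi. split; [exact hpsi|split; [exact p|]]. intros s hs.
  rewrite eq by lra. apply q.
Qed.

(** * Flows of the Loewner equation and their behaviour at the singularity *)

Lemma Re_minus z w : Re (z - w)%C = Re z - Re w.
Proof. reflexivity. Qed.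
Lemma Im_minus z w : Im (z - w)%C = Im z - Im w.
Proof. reflexivity. Qed.
Lemma Re_mult z w : Re (z * w)%C = Re z * Re w - Im z * Im w.
Proof. reflexivity. Qed.
Lemma Im_mult z w : Im (z * w)%C = Re z * Im w + Im z * Re w.
Proof. reflexivity. Qed.

Lemma im_pos_neq0 (z : C) : 0 < Im z -> z <> 0%C.
Proof. intros H E. rewrite E in H. simpl in H. lra. Qed.

Lemma im_le_mod (z : C) : Im z <= Cmod z.
Proof. eapply Rle_trans; [apply Rle_abs|apply im_le_Cmod]. Qed.

Lemma inv_lip (c : R) (z w : C) : 0 < c -> c <= Im z -> c <= Im w ->
  Cmod (/ z - / w)%C <= / (c * c) * Cmod (z - w)%C.
Proof.
  intros hc hz hw.
  assert (z <> 0%C) by (apply im_pos_neq0; lra).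
  assert (w <> 0%C) by (apply im_pos_neq0; lra).
  replace (/ z - / w)%C with ((w - z) * / (z * w))%C by (field; auto).
  rewrite Cmod_mult, Cmod_minus_sym, Rmult_comm.
  apply Rmult_le_compat_r; [apply Cmod_ge_0|].
  rewrite Cmod_inv by (apply Cmult_neq_0; auto).
  apply Rinv_le_contravar; [nra|]. rewrite Cmod_mult.
  pose proof (im_le_mod z). pose proof (im_le_mod w). nra.
Qed.

(* The field kappa / trunc c X is globally Lipschitz and agrees with kappa / X on Im X >= c. *)
Definition trunc (c : R) (z : C) : C := (Re z, Rmax c (Im z)).

Lemma trunc_id c z : c <= Im z -> trunc c z = z.
Proof. intros. unfold trunc. rewrite Rmax_right by auto. now destruct z. Qed.

Lemma trunc_im c z : c <= Im (trunc c z).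
Proof. apply Rmax_l. Qed.

Lemma trunc_lip c z w : Cmod (trunc c z - trunc c w)%C <= Cmod (z - w)%C.
Proof.
  rewrite <- (Rmult_1_l (Cmod (z - w)%C)). apply Cmod_le_sq; [lra|].
  rewrite !Re_minus, !Im_minus.
  change (Re (trunc c z)) with (Re z). change (Re (trunc c w)) with (Re w).
  change (Im (trunc c z)) with (Rmax c (Im z)). change (Im (trunc c w)) with (Rmax c (Im w)).
  assert (H : Rsqr (Rmax c (Im z) - Rmax c (Im w)) <= Rsqr (Im z - Im w)).
  { apply Rsqr_le_abs_1. unfold Rmax, Rabs.
    repeat destruct Rle_dec; repeat destruct Rcase_abs; lra. }
  unfold Rsqr in H. lra.
Qed.

Lemma ccont_lip (G : C -> C) K f :
  0 <= K -> (forall z w, Cmod (G z - G w)%C <= K * Cmod (z - w)%C) ->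
  ccont f -> ccont (fun s => G (f s)).
Proof.
  rewrite !ccont_iff_eps. intros hK HG H s eps he.
  destruct (H s (eps / (K + 1))) as [d [hd hd']]; [apply Rdiv_lt_0_compat; lra|].
  exists d; split; auto. intros u hu. specialize (hd' u hu).
  eapply Rle_lt_trans; [apply HG|].
  apply Rmult_lt_compat_l with (r := K + 1) in hd'; [|lra].
  replace ((K + 1) * (eps / (K + 1))) with eps in hd' by (field; lra).
  pose proof (Cmod_ge_0 (f u - f s)%C). nra.
Qed.

Lemma trunc_flow (kappa : C) (l : R -> C) (c a b : R) (z0 : C) :
  a <= b -> 0 < c -> ccont l ->
  exists h, ccont h /\ h a = z0 /\
    forall s, a < s < b -> cderive h s (kappa / trunc c (h s - l s))%C.
Proof.
  intros hab hc hl.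
  assert (HL : forall z w, Cmod (kappa / trunc c z - kappa / trunc c w)%C <=
                (Cmod kappa * / (c * c)) * Cmod (z - w)%C).
  { intros z w. replace (kappa / trunc c z - kappa / trunc c w)%C
      with (kappa * (/ trunc c z - / trunc c w))%C by (unfold Cdiv; ring).
    rewrite Cmod_mult, Rmult_assoc. apply Rmult_le_compat_l; [apply Cmod_ge_0|].
    eapply Rle_trans; [apply (inv_lip c); auto; apply trunc_im|].
    apply Rmult_le_compat_l; [|apply trunc_lip].
    apply Rlt_le, Rinv_0_lt_compat; nra. }
  assert (hK : 0 <= Cmod kappa * / (c * c)).
  { apply Rmult_le_pos; [apply Cmod_ge_0|]. apply Rlt_le, Rinv_0_lt_compat; nra. }
  apply (picard (fun s z => kappa / trunc c (z - l s))%C (Cmod kappa * / (c * c))); auto.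
  - intros s z w. eapply Rle_trans; [apply HL|].
    apply Req_le. f_equal. f_equal. ring.
  - intros phi hphi.
    apply (ccont_lip (fun z => kappa / trunc c z)%C _ _ hK HL). now apply ccont_sub.
Qed.

(** The factor kappa is 2 for the forward flow, -2 for the reversed flow and -2 zeta for the
    reversed flow in complex rescaled time. *)
Definition sol (kappa : C) (l : R -> C) (a b : R) (h : R -> C) : Prop :=
  ccont h /\ forall s, a < s < b -> cderive h s (kappa / (h s - l s))%C.

Lemma sol_sub kappa l a b a' b' h :
  a <= a' -> b' <= b -> sol kappa l a b h -> sol kappa l a' b' h.
Proof. intros ha hb [h1 h2]; split; auto. intros s hs; apply h2; lra. Qed.

(** The constant explodes as c tends to 0, so this serves only at a positive distance from the tip;
    near the tip [tip_contract] takes over. *)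
Lemma compare (kappa : C) l c a b h1 h2 :
  a <= b -> 0 < c -> sol kappa l a b h1 -> sol kappa l a b h2 ->
  (forall s, a < s < b -> c <= Im (h1 s - l s)%C) ->
  (forall s, a < s < b -> c <= Im (h2 s - l s)%C) ->
  Cmod (h1 b - h2 b)%C <= exp (Cmod kappa * / (c * c) * (b - a)) * Cmod (h1 a - h2 a)%C.
Proof.
  intros hab hc [s1 d1] [s2 d2] p1 p2.
  apply (gronwall (fun s => (h1 s - h2 s)%C)); auto; [now apply ccont_sub|].
  intros s hs. eexists; split; [apply cderive_sub; [apply d1|apply d2]; auto|].
  replace (kappa / (h1 s - l s) - kappa / (h2 s - l s))%C
    with (kappa * (/ (h1 s - l s) - / (h2 s - l s)))%C by (unfold Cdiv; ring).
  rewrite Cmod_mult, Rmult_assoc. apply Rmult_le_compat_l; [apply Cmod_ge_0|].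
  eapply Rle_trans; [apply (inv_lip c); auto|].
  apply Req_le. f_equal. f_equal. ring.
Qed.

Lemma Im_real_div (k : R) (z : C) :
  Im (RtoC k / z)%C = - (k * (Im z / (Re z * Re z + Im z * Im z))).
Proof.
  unfold Cdiv. rewrite Im_mult. unfold Re, Im; simpl.
  unfold Rdiv. rewrite !Rmult_1_r. ring.
Qed.

Lemma im_frac_pos (z : C) : 0 < Im z -> 0 < Im z / (Re z * Re z + Im z * Im z).
Proof. intros. apply Rdiv_lt_0_compat; nra. Qed.

(** For real l one has Im X = Im h, and Im (-k / X) = k Im X / |X|^2 is nonnegative. *)
Lemma im_mono (k : R) l a b h :
  a <= b -> 0 <= k -> (forall s, Im (l s) = 0) -> sol (RtoC (- k)) l a b h ->
  (forall s, a < s < b -> 0 < Im (h s)) -> Im (h a) <= Im (h b).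
Proof.
  intros hab hk hl [[_ hc] hd] hp.
  apply (derive_nonneg_le (fun s => Im (h s))); auto.
  intros s hs. destruct (hd s hs) as [_ h2]. eexists; split; [exact h2|].
  rewrite Im_real_div. specialize (hp s hs).
  assert (H : 0 < Im (h s - l s)%C) by (rewrite Im_minus, hl; lra).
  apply im_frac_pos in H. nra.
Qed.

Lemma im_anti (k : R) l a b h :
  a <= b -> 0 <= k -> (forall s, Im (l s) = 0) -> sol (RtoC k) l a b h ->
  (forall s, a < s < b -> 0 < Im (h s)) -> Im (h b) <= Im (h a).
Proof.
  intros hab hk hl [[_ hc] hd] hp. apply Ropp_le_cancel.
  apply (derive_nonneg_le (fun s => - Im (h s))); auto.
  - intros s; apply cont_neg, hc.
  - intros s hs. destruct (hd s hs) as [_ h2]. eexists; split; [apply derive_neg; exact h2|].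
  rewrite Im_real_div. specialize (hp s hs).
  assert (H : 0 < Im (h s - l s)%C) by (rewrite Im_minus, hl; lra).
  apply im_frac_pos in H. nra.
Qed.

(** The reversed flow moves upwards, so the truncation at the starting height is never felt and the
    solution lasts for the whole interval. *)
Lemma reverse_flow (l : R -> C) (a b : R) (w : C) :
  a <= b -> ccont l -> (forall s, Im (l s) = 0) -> 0 < Im w ->
  exists h, sol (RtoC (-2)) l a b h /\ h a = w /\ forall s, a <= s <= b -> Im w <= Im (h s).
Proof.
  intros hab hl hr hw.
  destruct (trunc_flow (RtoC (-2)) l (Im w) a b w hab hw hl) as [h [hc [ha hd]]].
  assert (him : forall s, a <= s <= b -> Im w <= Im (h s)).
  { intros s hs. rewrite <- ha.
    apply (derive_nonneg_le (fun s => Im (h s))); [lra|apply hc|].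
    intros u hu. destruct (hd u) as [_ h2]; [lra|]. eexists; split; [exact h2|].
    rewrite Im_real_div.
    pose proof (im_frac_pos (trunc (Im w) (h u - l u))).
    pose proof (trunc_im (Im w) (h u - l u)). lra. }
  exists h. split; [|split; auto]. split; auto.
  intros s hs. rewrite <- (trunc_id (Im w) (h s - l s)); [apply hd; auto|].
  rewrite Im_minus, hr. specialize (him s ltac:(lra)). lra.
Qed.

(** The equation and positivity are imposed only for s > 0, with mere continuity at 0, so that the
    singular solution with h 0 = l 0 is included. Both zeta and l may be complex. *)
Definition tipsol (zeta : C) (l : R -> C) (M S : R) (h : R -> C) : Prop :=
  ccont h /\ ccont l /\
  forall s, 0 < s < S ->
    cderive h s (- (RtoC 2 * zeta) / (h s - l s))%C /\
    (exists m, cderive l s m /\ Cmod m <= M) /\ 0 < Im (h s - l s)%C.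

Lemma tipsol_sub zeta l M S S' h : S' <= S -> tipsol zeta l M S h -> tipsol zeta l M S' h.
Proof. intros H [h1 [h2 h3]]. split; [|split]; auto. intros s hs; apply h3; lra. Qed.

Lemma tip_der (zeta : C) (l h : R -> C) s :
  0 < Im (h s - l s)%C ->
  ((- (RtoC 2 * zeta) / (h s - l s)) * (h s - l s))%C = (- (RtoC 2 * zeta))%C.
Proof. intros. field. now apply im_pos_neq0. Qed.

Lemma mult_sys (d X e : C) : (d * X)%C = e ->
  Re d * Re X - Im d * Im X = Re e /\ Re d * Im X + Im d * Re X = Im e.
Proof. intros <-. now rewrite Re_mult, Im_mult. Qed.

(** Since |X| |2 zeta / X| = 2 |zeta| <= 3, the derivative of |X|^2 is at most 6 + 2 M |X|, and 2 M
    |X| <= 1 + M^2 |X|^2. The singular term thus contributes a bounded amount, whatever the size of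
    X. *)
Lemma tip_size (zeta : C) l M S h : 0 <= M -> 0 <= S -> Cmod zeta <= 3 / 2 ->
  tipsol zeta l M S h ->
  Cmod (h S - l S)%C * Cmod (h S - l S)%C <=
   (Cmod (h 0 - l 0)%C * Cmod (h 0 - l 0)%C + 8 * S) * exp (M * M * S).
Proof.
  intros hM hS hz [hc [lc hd]]. rewrite !Cmod_sq.
  set (X := fun s => (h s - l s)%C). fold (X S) (X 0).
  assert (Xc : ccont X) by now apply ccont_sub.
  set (N := fun u => Re (X u) * Re (X u) + Im (X u) * Im (X u)). fold (N S) (N 0).
  assert (H : 8 * 0 - N 0 * exp (- (M * M) * 0) <= 8 * S - N S * exp (- (M * M) * S)).
  { apply (derive_nonneg_le (fun s => 8 * s - N s * exp (- (M * M) * s))); auto.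
    - assert (Nc : forall s, continuous N s) by (intros s; now apply normsq_cont).
      intros s. prove_cont.
    - intros s hs. destruct (hd s hs) as [h1 [[m [h2 h3]] h4]].
      eexists; split.
      + apply derive_sub; [apply derive_mul; [apply derive_const|apply derive_id]|].
        apply derive_mul; [apply normsq_der; apply cderive_sub; [exact h1|exact h2]|].
        apply derive_exp, derive_mul; [apply derive_const|apply derive_id].
      + fold (X s). fold (X s) in h1, h4.
        set (d := (- (RtoC 2 * zeta) / X s)%C) in *. fold (N s).
        assert (E : Cmod (X s) * Cmod d <= 3).
        { rewrite <- Cmod_mult. unfold d.
          replace (X s * (- (RtoC 2 * zeta) / X s))%C with (- (RtoC 2 * zeta))%C
            by (field; now apply im_pos_neq0).
          rewrite Cmod_opp, Cmod_mult, Cmod_R, Rabs_right by lra. lra. }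
        pose proof (cauchy_schwarz (X s) (d - m)%C) as E2.
        assert (E3 : Cmod (X s) * Cmod (d - m)%C <= 3 + M * Cmod (X s)).
        { pose proof (Cmod_triangle d (- m)). rewrite Cmod_opp in H.
          apply Rle_trans with (Cmod (X s) * (Cmod d + M)); [|lra].
          apply Rmult_le_compat_l; [apply Cmod_ge_0|]. unfold Cminus. lra. }
        assert (E4 : N s = Cmod (X s) * Cmod (X s)) by (unfold N; now rewrite Cmod_sq).
        set (c := Re (X s) * Re (d - m)%C + Im (X s) * Im (d - m)%C) in *.
        assert (E5 : 2 * c <= 8 + M * M * N s).
        { assert (0 <= (M * Cmod (X s) - 1) ^ 2) by apply pow2_ge_0.
          rewrite E4. nra. }
        assert (E6 : exp (- (M * M) * s) <= 1).
        { rewrite <- exp_0. apply exp_le_compat. assert (0 <= M * M) by nra. nra. }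
        pose proof (exp_pos (- (M * M) * s)).
        assert (0 <= (8 + M * M * N s - 2 * c) * exp (- (M * M) * s)) by nra.
        lra. }
  rewrite Rmult_0_r, Rmult_0_r, exp_0, Rmult_1_r in H.
  assert (N S = N S * exp (- (M * M) * S) * exp (M * M * S)).
  { rewrite Rmult_assoc, <- exp_plus. replace (_ + _) with 0 by ring. rewrite exp_0; ring. }
  rewrite H0. apply Rmult_le_compat_r; [apply Rlt_le, exp_pos|lra].
Qed.

(** A box around 1 in which the cone argument has room to spare; it contains 1 + x / e whenever |x|
    <= e / 8. *)
Definition zeta_ok (zeta : C) : Prop :=
  3 / 4 <= Re zeta <= 5 / 4 /\ Rabs (Im zeta) <= 1 / 4.

Lemma zeta_ok_mod zeta : zeta_ok zeta -> Cmod zeta <= 3 / 2.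
Proof.
  intros [h1 h2]. eapply Rle_trans; [apply Cmod_le_abs|].
  rewrite (Rabs_right (Re zeta)) by lra. lra.
Qed.

(* With X = h - l, the function -X^2 has derivative 4 zeta + 2 X l', which stays in the cone
   |Im| <= (2/3) Re as long as X l' is small. *)
Lemma tip_cone (zeta : C) l M S h (y0 : R) : 0 <= M -> 0 <= S -> zeta_ok zeta -> 0 <= y0 ->
  192 * (M * M) * (y0 * y0 + 8 * S) <= 1 ->
  tipsol zeta l M S h -> (h 0 - l 0)%C = (0, y0) ->
  let X := (h S - l S)%C in
  y0 * y0 + 5 / 2 * S <= Im X * Im X - Re X * Re X /\
  3 * Rabs (Re X * Im X) <= Im X * Im X - Re X * Re X.
Proof.
  intros hM hS hz hy hsm ht h0 X0.
  (* By [tip_size], |X|^2 <= 3 (y0^2 + 8 s), the exponential being at most 3. The target is M^2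
     |X|^2 <= 1/64, hence the constant 192 = 3 * 64. *)
  assert (small : forall s, 0 <= s <= S -> M * Cmod (h s - l s)%C <= 1 / 8).
  { intros s hs. pose proof (tip_size zeta l M s h hM ltac:(lra) (zeta_ok_mod _ hz)
      (tipsol_sub _ _ _ _ _ _ (proj2 hs) ht)) as H.
    rewrite h0 in H. rewrite (Cmod_sq (0, y0)) in H. unfold Re at 1 2, Im at 1 2 in H. simpl in H.
    assert (exp (M * M * s) <= 3).
    { apply exp_le_3_of_le_1.
      assert (0 <= M * M) by nra. assert (0 <= M * M * (y0 * y0)) by nra.
      assert (M * M * s <= M * M * S) by nra. nra. }
    pose proof (Cmod_ge_0 (h s - l s)%C).
    apply Rsqr_incr_0_var; [|lra]. unfold Rsqr.
    set (n := Cmod (h s - l s)%C) in *.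
    assert (n * n <= (y0 * y0 + 8 * s) * 3) by nra.
    assert (0 <= M * M) by nra.
    assert (M * M * (n * n) <= M * M * ((y0 * y0 + 8 * S) * 3)) by nra. nra. }
  destruct ht as [hc [lc hd]].
  set (X := fun s => (h s - l s)%C) in *.
  assert (Xc : ccont X) by now apply ccont_sub.
  set (q := fun s => Im (X s) * Im (X s) - Re (X s) * Re (X s)).
  set (p := fun s => 2 * (Re (X s) * Im (X s))).
  destruct Xc as [Xc1 Xc2].
  assert (qc : forall s, continuous q s) by (intros s; unfold q; prove_cont).
  assert (pc : forall s, continuous p s) by (intros s; unfold p; prove_cont).
  (* Here -X^2 = q - i p. The bound on M |X| makes the term 2 X l' at most 1/2 in each coordinate,
     so q' >= 3 - 1/2 and |p'| <= 1 + 1/2. As 3/2 <= (2/3)(5/2), the cone |p| <= (2/3) q is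
     preserved. *)
  assert (der : forall s, 0 < s < S -> exists q' p', is_derive q s q' /\ is_derive p s p' /\
     5 / 2 <= q' /\ Rabs p' <= 3 / 2).
  { intros s hs. destruct (hd s hs) as [h1 [[m [h2 h3]] h4]].
    pose proof (cderive_sub _ _ _ _ _ h1 h2) as [k1 k2].
    exists (4 * Re zeta - 2 * (Im (X s) * Im m - Re (X s) * Re m)).
    exists (- (4 * Im zeta) - 2 * (Re (X s) * Im m + Im (X s) * Re m)).
    destruct (mult_sys _ _ _ (tip_der zeta l h s h4)) as [e1 e2].
    fold (X s) in e1, e2, k1, k2, h4.
    set (d := (- (RtoC 2 * zeta) / X s)%C) in *.
    replace (Re (- (RtoC 2 * zeta))%C) with (- (2 * Re zeta)) in e1
      by (unfold Re; simpl; ring).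
    replace (Im (- (RtoC 2 * zeta))%C) with (- (2 * Im zeta)) in e2
      by (unfold Im; simpl; ring).
    rewrite Re_minus in k1. rewrite Im_minus in k2.
    change (fun u : R_AbsRing => Re (h u - l u)%C) with (fun u => Re (X u)) in k1.
    change (fun u : R_AbsRing => Im (h u - l u)%C) with (fun u => Im (X u)) in k2.
    assert (sm : M * Cmod (X s) <= 1 / 8) by (apply small; lra).
    assert (bd : forall x y, Rabs x <= Cmod (X s) -> Rabs y <= Cmod m -> Rabs (x * y) <= 1 / 8).
    { intros x y hx hy'. rewrite Rabs_mult. pose proof (Rabs_pos x). pose proof (Rabs_pos y).
      pose proof (Cmod_ge_0 (X s)). nra. }
    pose proof (bd _ _ (re_le_Cmod (X s)) (re_le_Cmod m)) as b1.
    pose proof (bd _ _ (re_le_Cmod (X s)) (im_le_Cmod m)) as b2.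
    pose proof (bd _ _ (im_le_Cmod (X s)) (re_le_Cmod m)) as b3.
    pose proof (bd _ _ (im_le_Cmod (X s)) (im_le_Cmod m)) as b4.
    apply Rabs_le_between in b1, b2, b3, b4.
    destruct hz as [z1 z2]. apply Rabs_le_between in z2.
    split; [|split; [|split]].
    - eapply derive_eq; [apply derive_sub; apply derive_mul; eassumption|]. cbv beta. nra.
    - eapply derive_eq; [apply derive_mul; [apply derive_const|apply derive_mul; eassumption]|]. cbv beta. nra.
    - lra.
    - apply Rabs_le_between. lra. }
  assert (q0 : q 0 = y0 * y0) by (unfold q, X; rewrite h0; unfold Re, Im; simpl; ring).
  assert (p0 : p 0 = 0) by (unfold p, X; rewrite h0; unfold Re, Im; simpl; ring).
  assert (H1 : q 0 - 5 / 2 * 0 <= q S - 5 / 2 * S).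
  { apply (derive_nonneg_le (fun s => q s - 5 / 2 * s)); auto; [intros s; prove_cont|].
    intros s hs. destruct (der s hs) as [q' [p' [k1 [k2 [k3 k4]]]]].
    eexists; split; [apply derive_sub; [exact k1|apply derive_mul; [apply derive_const|apply derive_id]]|].
    lra. }
  assert (H2 : 2 / 3 * q 0 - p 0 <= 2 / 3 * q S - p S).
  { apply (derive_nonneg_le (fun s => 2 / 3 * q s - p s)); auto; [intros s; prove_cont|].
    intros s hs. destruct (der s hs) as [q' [p' [k1 [k2 [k3 k4]]]]].
    eexists; split; [apply derive_sub; [apply derive_mul; [apply derive_const|exact k1]|exact k2]|].
    apply Rabs_le_between in k4. lra. }
  assert (H3 : 2 / 3 * q 0 + p 0 <= 2 / 3 * q S + p S).
  { apply (derive_nonneg_le (fun s => 2 / 3 * q s + p s)); auto; [intros s; prove_cont|].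
    intros s hs. destruct (der s hs) as [q' [p' [k1 [k2 [k3 k4]]]]].
    eexists; split; [apply derive_add; [apply derive_mul; [apply derive_const|exact k1]|exact k2]|].
    apply Rabs_le_between in k4. lra. }
  unfold X0. fold (X S). unfold q, p in *. rewrite q0, p0 in *.
  assert (0 <= y0 * y0) by nra.
  split; [lra|]. unfold Rabs. destruct Rcase_abs; lra.
Qed.

(** From 3 |Re X Im X| <= (Im X)^2 - (Re X)^2 <= (Im X)^2, divide by Im X > 0. *)
Lemma tip_in_cone (zeta : C) l M S h (y0 : R) : 0 <= M -> 0 <= S -> zeta_ok zeta -> 0 <= y0 ->
  192 * (M * M) * (y0 * y0 + 8 * S) <= 1 ->
  tipsol zeta l M S h -> (h 0 - l 0)%C = (0, y0) ->
  forall s, 0 < s < S -> 3 * Rabs (Re (h s - l s)%C) <= Im (h s - l s)%C.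
Proof.
  intros hM hS hz hy hsm ht h0 s hs.
  destruct (tip_cone zeta l M s h y0) as [h1 h2]; auto; [lra| |now apply (tipsol_sub _ _ _ S); [lra|]|].
  { assert (0 <= M * M) by nra. nra. }
  destruct ht as [_ [_ ht]]. destruct (ht s hs) as [_ [_ h3]].
  rewrite Rabs_mult, (Rabs_right (Im _)) in h2 by lra.
  set (x := Re (h s - l s)%C) in *. set (y := Im (h s - l s)%C) in *.
  pose proof (Rabs_pos x). nra.
Qed.

(** Real coordinates of a complex identity: if e w = 2 zeta D, with zeta = a + i b, then Re (conj D
    e) |w|^2 = 2 |D|^2 Re (zeta conj w). *)
Lemma quotient_dot (D1 D2 e1 e2 w1 w2 a b : R) :
  e1 * w1 - e2 * w2 = 2 * (a * D1 - b * D2) ->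
  e1 * w2 + e2 * w1 = 2 * (a * D2 + b * D1) ->
  (D1 * e1 + D2 * e2) * (w1 * w1 + w2 * w2) =
  2 * (D1 * D1 + D2 * D2) * (a * w1 + b * w2).
Proof.
  intros E1 E2.
  transitivity (D1 * (w1 * (e1 * w1 - e2 * w2) + w2 * (e1 * w2 + e2 * w1))
    + D2 * (- w2 * (e1 * w1 - e2 * w2) + w1 * (e1 * w2 + e2 * w1))); [ring|].
  rewrite E1, E2. ring.
Qed.

(* On the cone 3 |Re X| <= Im X, the difference D of two solutions satisfies
   D' = (2 zeta / (X1 X2)) D, and zeta / (X1 X2) has nonpositive real part. *)
Lemma tip_contract (zeta : C) l M S h1 h2 (y1 y2 : R) :
  0 <= M -> 0 <= S -> zeta_ok zeta -> 0 <= y1 -> 0 <= y2 ->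
  192 * (M * M) * (y1 * y1 + 8 * S) <= 1 -> 192 * (M * M) * (y2 * y2 + 8 * S) <= 1 ->
  tipsol zeta l M S h1 -> (h1 0 - l 0)%C = (0, y1) ->
  tipsol zeta l M S h2 -> (h2 0 - l 0)%C = (0, y2) ->
  Cmod (h1 S - h2 S)%C <= Rabs (y1 - y2).
Proof.
  intros hM hS hz hy1 hy2 sm1 sm2 t1 i1 t2 i2.
  pose proof (tip_in_cone _ _ _ _ _ _ hM hS hz hy1 sm1 t1 i1) as cone1.
  pose proof (tip_in_cone _ _ _ _ _ _ hM hS hz hy2 sm2 t2 i2) as cone2.
  destruct t1 as [c1 [lc d1]]. destruct t2 as [c2 [_ d2]].
  replace (Rabs (y1 - y2)) with (1 * Cmod (h1 0 - h2 0)%C).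
  2:{ rewrite Rmult_1_l. replace (h1 0 - h2 0)%C with ((h1 0 - l 0) - (h2 0 - l 0))%C by ring.
      rewrite i1, i2. unfold Cmod; simpl.
      replace (_ + _) with (Rsqr (y1 - y2)) by (unfold Rsqr; ring). apply sqrt_Rsqr_abs. }
  apply Cmod_le_sq; [lra|].
  set (D := fun s => (h1 s - h2 s)%C). fold (D S) (D 0).
  assert (Dc : ccont D) by now apply ccont_sub.
  rewrite !Rmult_1_l. apply Ropp_le_cancel.
  apply (derive_nonneg_le (fun s => - (Re (D s) * Re (D s) + Im (D s) * Im (D s)))); auto.
  - intros s; apply cont_neg; now apply normsq_cont.
  - intros s hs. destruct (d1 s hs) as [k1 [_ p1]]. destruct (d2 s hs) as [k2 [_ p2]].
    eexists; split; [apply derive_neg, normsq_der, cderive_sub; [exact k1|exact k2]|].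
    specialize (cone1 s hs). specialize (cone2 s hs).
    set (X1 := (h1 s - l s)%C) in *. set (X2 := (h2 s - l s)%C) in *.
    set (e := (- (RtoC 2 * zeta) / X1 - - (RtoC 2 * zeta) / X2)%C).
    assert (E : (e * (X1 * X2))%C = (RtoC 2 * zeta * D s)%C).
    { replace (D s) with (X1 - X2)%C by (unfold D, X1, X2; ring).
      unfold e. field. split; now apply im_pos_neq0. }
    apply mult_sys in E. destruct E as [E1 E2].
    rewrite !Re_mult, !Im_mult in E1, E2.
    change (Re (RtoC 2)) with 2 in *. change (Im (RtoC 2)) with 0 in *.
    set (w1 := Re X1 * Re X2 - Im X1 * Im X2) in *.
    set (w2 := Re X1 * Im X2 + Im X1 * Re X2) in *.
    assert (hw : 0 < w1 * w1 + w2 * w2).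
    { replace (w1 * w1 + w2 * w2) with
       ((Re X1 * Re X1 + Im X1 * Im X1) * (Re X2 * Re X2 + Im X2 * Im X2))
        by (unfold w1, w2; ring).
      apply Rmult_lt_0_compat; nra. }
    set (P := Re (D s) * Re e + Im (D s) * Im e).
    assert (EP : P * (w1 * w1 + w2 * w2) =
       2 * (Re (D s) * Re (D s) + Im (D s) * Im (D s)) * (Re zeta * w1 + Im zeta * w2)).
    { apply quotient_dot.
      - rewrite E1. unfold Re, Im; simpl; ring.
      - rewrite E2. unfold Re, Im; simpl; ring. }
    (* In the cone X1 X2 lies around the negative real axis: with Y = Im X1 Im X2 its real part is
       at most -(8/9) Y and its imaginary part at most (2/3) Y in modulus. The sign follows from
       (3/4)(8/9) > (1/4)(2/3). *)
    assert (hn : Re zeta * w1 + Im zeta * w2 <= 0).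
    { destruct hz as [z1 z2]. apply Rabs_le_between in z2.
      assert (yy : 0 < Im X1 * Im X2) by nra.
      assert (a1 : Rabs (Re X1 * Re X2) <= 1 / 9 * (Im X1 * Im X2)).
      { rewrite Rabs_mult. pose proof (Rabs_pos (Re X1)). pose proof (Rabs_pos (Re X2)). nra. }
      assert (a2 : Rabs (Re X1 * Im X2) <= 1 / 3 * (Im X1 * Im X2)).
      { rewrite Rabs_mult, (Rabs_right (Im X2)) by lra. nra. }
      assert (a3 : Rabs (Im X1 * Re X2) <= 1 / 3 * (Im X1 * Im X2)).
      { rewrite Rabs_mult, (Rabs_right (Im X1)) by lra. nra. }
      apply Rabs_le_between in a1, a2, a3.
      assert (b1 : w1 <= - (8 / 9) * (Im X1 * Im X2)) by (unfold w1; lra).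
      assert (b2 : - (2 / 3) * (Im X1 * Im X2) <= w2 <= 2 / 3 * (Im X1 * Im X2))
        by (unfold w2; lra).
      set (Y := Im X1 * Im X2) in *. nra. }
    assert (P <= 0); [|lra].
    set (n := Re (D s) * Re (D s) + Im (D s) * Im (D s)) in *.
    assert (0 <= n) by (unfold n; nra).
    assert (n * (Re zeta * w1 + Im zeta * w2) <= 0) by nra. nra.
Qed.

(** * Uniform limits of complex polynomials on a disc *)

Fixpoint peval (p : list C) (z : C) : C :=
  match p with nil => 0%C | c :: q => (c + z * peval q z)%C end.

Fixpoint padd (p q : list C) : list C :=
  match p, q with
  | nil, _ => q
  | _, nil => p
  | a :: p', b :: q' => (a + b)%C :: padd p' q'
  end.

Definition pscale (c : C) (p : list C) : list C := map (Cmult c) p.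

Fixpoint pmul (p q : list C) : list C :=
  match p with nil => nil | a :: p' => padd (pscale a q) (RtoC 0 :: pmul p' q) end.

Lemma peval_padd p q z : peval (padd p q) z = (peval p z + peval q z)%C.
Proof.
  revert q. induction p as [|a p IH]; intros [|b q]; simpl; try ring.
  rewrite IH. ring.
Qed.

Lemma peval_pscale c p z : peval (pscale c p) z = (c * peval p z)%C.
Proof. induction p as [|a p IH]; simpl; [ring|]. rewrite IH. ring. Qed.

Lemma peval_pmul p q z : peval (pmul p q) z = (peval p z * peval q z)%C.
Proof.
  induction p as [|a p IH]; simpl; [ring|].
  rewrite peval_padd, peval_pscale. simpl. rewrite IH. ring.
Qed.

Lemma nth_padd (p q : list C) n : nth n (padd p q) 0%C = (nth n p 0 + nth n q 0)%C.
Proof.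
  revert q n. induction p as [|a p IH]; intros [|b q] [|n]; simpl; try ring; try apply IH.
Qed.

Lemma nth_pscale c (p : list C) n : nth n (pscale c p) 0%C = (c * nth n p 0)%C.
Proof. revert n. induction p as [|a p IH]; intros [|n]; simpl; try ring. apply IH. Qed.

Fixpoint psum (c : nat -> C) (n : nat) : C :=
  match n with O => 0%C | S m => (psum c m + c m)%C end.

Lemma psum_ext c d n : (forall k, (k < n)%nat -> c k = d k) -> psum c n = psum d n.
Proof. induction n; intros H; simpl; [auto|]. rewrite IHn, H; auto. Qed.

Lemma psum_plus c d n : psum (fun k => c k + d k)%C n = (psum c n + psum d n)%C.
Proof. induction n; simpl; [ring|]. rewrite IHn. ring. Qed.

Lemma psum_scale a c n : psum (fun k => a * c k)%C n = (a * psum c n)%C.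
Proof. induction n; simpl; [ring|]. rewrite IHn. ring. Qed.

Lemma psum_shift c n : psum c (S n) = (c O + psum (fun k => c (S k)) n)%C.
Proof.
  induction n; [simpl; ring|]. change (psum c (S (S n))) with (psum c (S n) + c (S n))%C.
  rewrite IHn. simpl. ring.
Qed.

Lemma psum_mod_le c B n :
  (forall k, (k < n)%nat -> Cmod (c k) <= B) -> Cmod (psum c n) <= INR n * B.
Proof.
  induction n; intros H; [simpl; rewrite Cmod_0; lra|].
  rewrite S_INR. simpl psum. eapply Rle_trans; [apply Cmod_triangle|].
  specialize (IHn ltac:(auto)). specialize (H n ltac:(lia)). lra.
Qed.

Lemma geom_sum (w : C) n : ((w - 1) * psum (fun k => w ^ k) n = w ^ n - 1)%C.
Proof.
  induction n; simpl; [ring|].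
  rewrite Cmult_plus_distr_l, IHn. ring.
Qed.

(** * Roots of unity and Cauchy's estimate for polynomials *)

Definition rootu (N : nat) : C := (cos (2 * PI / INR N), sin (2 * PI / INR N)).

Lemma Cpow_cis x n : ((cos x, sin x) ^ n)%C = (cos (INR n * x), sin (INR n * x)).
Proof.
  induction n.
  - simpl. rewrite Rmult_0_l, cos_0, sin_0. reflexivity.
  - change ((cos x, sin x) ^ S n)%C with ((cos x, sin x) * (cos x, sin x) ^ n)%C.
    rewrite IHn, S_INR.
    replace ((INR n + 1) * x) with (x + INR n * x) by ring.
    rewrite cos_plus, sin_plus. unfold Cmult; simpl. f_equal; ring.
Qed.

Lemma rootu_N N : (0 < N)%nat -> (rootu N ^ N)%C = 1%C.
Proof.
  intros h. unfold rootu. rewrite Cpow_cis.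
  replace (INR N * (2 * PI / INR N)) with (2 * PI).
  - now rewrite cos_2PI, sin_2PI.
  - field. apply not_0_INR. lia.
Qed.

(** With y = pi m / N in (0, pi), cos (2 y) = 1 - 2 (sin y)^2 is less than 1. *)
Lemma rootu_neq1 N m : (0 < m < N)%nat -> (rootu N ^ m)%C <> 1%C.
Proof.
  intros h E. unfold rootu in E. rewrite Cpow_cis in E. injection E as E _.
  assert (hN : 0 < INR N) by (apply lt_0_INR; lia).
  assert (hm : 0 < INR m) by (apply lt_0_INR; lia).
  assert (hmN : INR m < INR N) by (apply lt_INR; lia).
  set (y := INR m * (PI / INR N)).
  assert (hy : 0 < sin y).
  { pose proof PI_RGT_0. apply sin_gt_0; unfold y.
    - apply Rmult_lt_0_compat; auto. apply Rdiv_lt_0_compat; auto.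
    - apply Rmult_lt_reg_r with (INR N); auto.
      replace (INR m * (PI / INR N) * INR N) with (INR m * PI) by (field; lra). nra. }
  replace (INR m * (2 * PI / INR N)) with (2 * y) in E by (unfold y; field; lra).
  rewrite cos_2a_sin in E. nra.
Qed.

Lemma rootu_mod N : Cmod (rootu N) = 1.
Proof.
  unfold rootu, Cmod; simpl. set (x := 2 * PI / INR N).
  pose proof (sin2_cos2 x). unfold Rsqr in H.
  replace (_ + _) with 1 by lra. apply sqrt_1.
Qed.

Lemma Cpow_mult_r (w : C) m n : (w ^ (m * n) = (w ^ m) ^ n)%C.
Proof.
  induction n; [now rewrite Nat.mul_0_r|].
  rewrite Nat.mul_succ_r, Nat.add_comm, Cpow_add_r, IHn. reflexivity.
Qed.

(** Here w = [rootu N ^ m] differs from 1 and satisfies w^N = 1, so its geometric sum vanishes.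
    Exponents up to 2 N occur because weights and monomials are multiplied. *)
Lemma rootu_sum N m : (0 < m < 2 * N)%nat -> m <> N ->
  psum (fun j => (rootu N ^ j) ^ m)%C N = 0%C.
Proof.
  intros hm hmN. set (w := (rootu N ^ m)%C).
  rewrite (psum_ext _ (fun j => w ^ j)%C).
  2:{ intros k _. unfold w. rewrite <- !Cpow_mult_r. f_equal. lia. }
  assert (w <> 1)%C.
  { unfold w. destruct (le_lt_dec N m).
    - replace m with (N + (m - N))%nat by lia. rewrite Cpow_add_r, rootu_N by lia.
      rewrite Cmult_1_l. apply rootu_neq1. lia.
    - apply rootu_neq1. lia. }
  pose proof (geom_sum w N) as G.
  assert (w ^ N = 1)%C.
  { unfold w. rewrite <- Cpow_mult_r, Nat.mul_comm, Cpow_mult_r, rootu_N by lia.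
    apply Cpow_1_l. }
  rewrite H0 in G.
  assert ((w - 1) <> 0)%C.
  { intros E. apply H. replace w with ((w - 1) + 1)%C by ring. rewrite E. ring. }
  replace (psum (fun j => w ^ j)%C N) with (/ (w - 1) * ((w - 1) * psum (fun j => w ^ j) N))%C
    by (field; auto).
  rewrite G. ring.
Qed.

(** A discrete Cauchy integral over the circle of radius rho. Coefficient n is read off with the
    positive exponent m = N - n in place of -n. *)
Definition fourier_sum (rho : R) (N m : nat) (p : list C) : C :=
  psum (fun j => peval p (RtoC rho * rootu N ^ j) * (rootu N ^ j) ^ m)%C N.

Lemma fourier_sum_cons rho N m c q : fourier_sum rho N m (c :: q) =
  (c * psum (fun j => (rootu N ^ j) ^ m) N + RtoC rho * fourier_sum rho N (S m) q)%C.
Proof.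
  unfold fourier_sum. rewrite <- !psum_scale, <- psum_plus. apply psum_ext.
  intros k _. simpl peval. change ((rootu N ^ k) ^ S m)%C with ((rootu N ^ k) * (rootu N ^ k) ^ m)%C.
  ring.
Qed.

(** All exponents m, ..., m + length q - 1 that occur lie strictly between N and 2 N, where the sums
    over roots of unity vanish. *)
Lemma fourier_sum_zero rho N q : forall m, (N < m)%nat -> (m + length q <= 2 * N)%nat ->
  fourier_sum rho N m q = 0%C.
Proof.
  induction q as [|c q IH]; intros m h1 h2.
  - unfold fourier_sum. simpl. rewrite (psum_ext _ (fun k => 0 * 0)%C).
    + rewrite psum_scale. ring.
    + intros. ring.
  - simpl in h2. rewrite fourier_sum_cons, IH, rootu_sum by lia. ring.
Qed.

(** Removing the constant coefficient lowers n and raises the exponent N - n by one. At n = 0 the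
    weight is w^N = 1, so the constant term counts N times and the other terms vanish. *)
Lemma fourier_sum_coef rho N p : forall n, (n < N)%nat -> (length p <= N)%nat ->
  fourier_sum rho N (N - n) p = (RtoC (INR N) * (nth n p 0 * RtoC rho ^ n))%C.
Proof.
  induction p as [|c q IH]; intros n h1 h2.
  - unfold fourier_sum. simpl. rewrite (psum_ext _ (fun k => 0 * 0)%C).
    + rewrite psum_scale. destruct n; ring.
    + intros. ring.
  - simpl in h2. rewrite fourier_sum_cons. destruct n as [|n]; simpl nth.
    + rewrite fourier_sum_zero by lia.
      rewrite (psum_ext _ (fun j => 1%C)).
      * replace (psum (fun _ => 1%C) N) with (RtoC (INR N)).
        { simpl. ring. }
        { clear. induction N; [reflexivity|]. rewrite S_INR, RtoC_plus, IHN. reflexivity. }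
      * intros k _. rewrite Nat.sub_0_r, <- Cpow_mult_r, Nat.mul_comm, Cpow_mult_r, rootu_N by lia.
        apply Cpow_1_l.
    + rewrite rootu_sum by lia. replace (S (N - S n)) with (N - n)%nat by lia.
      rewrite IH by lia. change (RtoC rho ^ S n)%C with (RtoC rho * RtoC rho ^ n)%C. ring.
Qed.

Lemma cauchy_estimate rho B p : 0 <= rho ->
  (forall z, Cmod z <= rho -> Cmod (peval p z) <= B) ->
  forall n, Cmod (nth n p 0%C) * rho ^ n <= B.
Proof.
  (* N exceeds both n and the number of coefficients, so no other coefficient is aliased onto the
     n-th one. *)
  intros hr H n. set (N := (S n + length p)%nat).
  pose proof (fourier_sum_coef rho N p n ltac:(lia) ltac:(lia)) as E.
  assert (hN : 0 < INR N) by (apply lt_0_INR; lia).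
  apply (f_equal Cmod) in E.
  rewrite !Cmod_mult, Cmod_pow, !Cmod_R, (Rabs_right (INR N)), (Rabs_right rho) in E by lra.
  assert (Cmod (fourier_sum rho N (N - n) p) <= INR N * B).
  { apply psum_mod_le. intros k _.
    rewrite Cmod_mult, !Cmod_pow, rootu_mod, !pow1, Rmult_1_r. apply H.
    rewrite Cmod_mult, Cmod_pow, rootu_mod, pow1, Cmod_R, Rabs_right; lra. }
  rewrite E in H0. apply Rmult_le_reg_l in H0; auto.
Qed.

(** Stands for analyticity on the disc. It passes to uniform limits at once and constrains f only on
    the closed disc, so f may be produced pointwise by choice. *)
Definition approx (rho : R) (f : C -> C) : Prop :=
  forall eps, 0 < eps -> exists p, forall z, Cmod z <= rho -> Cmod (f z - peval p z)%C <= eps.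

Lemma peval_bounded rho p :
  exists B, 0 <= B /\ forall z, Cmod z <= rho -> Cmod (peval p z) <= B.
Proof.
  induction p as [|c q [B [hB IH]]].
  - exists 0. split; [lra|]. intros. simpl. rewrite Cmod_0. lra.
  - exists (Cmod c + Rabs rho * B). split.
    { pose proof (Cmod_ge_0 c). pose proof (Rabs_pos rho). nra. }
    intros z hz. simpl. eapply Rle_trans; [apply Cmod_triangle|].
    rewrite Cmod_mult. specialize (IH z hz). pose proof (Cmod_ge_0 z).
    pose proof (Cmod_ge_0 (peval q z)). pose proof (Rle_abs rho). nra.
Qed.

Lemma approx_bounded rho f : approx rho f ->
  exists B, 0 <= B /\ forall z, Cmod z <= rho -> Cmod (f z) <= B.
Proof.
  intros H. destruct (H 1 Rlt_0_1) as [p hp]. destruct (peval_bounded rho p) as [B [hB HB]].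
  exists (1 + B). split; [lra|]. intros z hz.
  replace (f z) with ((f z - peval p z) + peval p z)%C by ring.
  eapply Rle_trans; [apply Cmod_triangle|]. specialize (hp z hz). specialize (HB z hz). lra.
Qed.

Lemma approx_ext rho f g : (forall z, Cmod z <= rho -> f z = g z) -> approx rho f -> approx rho g.
Proof.
  intros E H eps he. destruct (H eps he) as [p hp]. exists p.
  intros z hz. rewrite <- E; auto.
Qed.

Lemma approx_const rho c : approx rho (fun _ => c).
Proof.
  intros eps he. exists (c :: nil). intros z _. simpl.
  replace (c - (c + z * 0))%C with (RtoC 0) by ring. rewrite Cmod_0. lra.
Qed.

Lemma approx_id rho : approx rho (fun z => z).
Proof.
  intros eps he. exists (RtoC 0 :: RtoC 1 :: nil). intros z _. simpl.
  replace (z - (0 + z * (1 + z * 0)))%C with (RtoC 0) by ring. rewrite Cmod_0. lra.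
Qed.

Lemma approx_plus rho f g : approx rho f -> approx rho g -> approx rho (fun z => f z + g z)%C.
Proof.
  intros hf hg eps he.
  destruct (hf (eps / 2)) as [p hp]; [lra|]. destruct (hg (eps / 2)) as [q hq]; [lra|].
  exists (padd p q). intros z hz. rewrite peval_padd.
  replace (f z + g z - (peval p z + peval q z))%C
    with ((f z - peval p z) + (g z - peval q z))%C by ring.
  eapply Rle_trans; [apply Cmod_triangle|]. specialize (hp z hz). specialize (hq z hz). lra.
Qed.

Lemma approx_mult rho f g : approx rho f -> approx rho g -> approx rho (fun z => f z * g z)%C.
Proof.
  intros hf hg eps he.
  destruct (approx_bounded _ _ hg) as [Bg [hBg HBg]].
  (* The tolerance for the second factor depends on a bound for p, so p is fixed first. *)
  destruct (hf (eps / (2 * (Bg + 1)))) as [p hp].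
  { apply Rdiv_lt_0_compat; lra. }
  destruct (peval_bounded rho p) as [Bp [hBp HBp]].
  destruct (hg (eps / (2 * (Bp + 1)))) as [q hq].
  { apply Rdiv_lt_0_compat; lra. }
  exists (pmul p q). intros z hz. rewrite peval_pmul.
  replace (f z * g z - peval p z * peval q z)%C
    with ((f z - peval p z) * g z + peval p z * (g z - peval q z))%C by ring.
  eapply Rle_trans; [apply Cmod_triangle|]. rewrite !Cmod_mult.
  specialize (hp z hz). specialize (hq z hz). specialize (HBg z hz). specialize (HBp z hz).
  assert (Cmod (f z - peval p z)%C * Cmod (g z) <= eps / 2).
  { apply Rle_trans with (eps / (2 * (Bg + 1)) * (Bg + 1)).
    - apply Rmult_le_compat; auto using Cmod_ge_0. lra.
    - right; field; lra. }
  assert (Cmod (peval p z) * Cmod (g z - peval q z)%C <= eps / 2).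
  { apply Rle_trans with ((Bp + 1) * (eps / (2 * (Bp + 1)))).
    - apply Rmult_le_compat; auto using Cmod_ge_0. lra.
    - right; field; lra. }
  lra.
Qed.

Lemma approx_minus rho f g : approx rho f -> approx rho g -> approx rho (fun z => f z - g z)%C.
Proof.
  intros hf hg. apply (approx_ext _ (fun z => f z + (RtoC (-1) * g z))%C).
  - intros; ring.
  - apply approx_plus; auto. apply approx_mult; auto. apply approx_const.
Qed.

Lemma approx_lim rho f :
  (forall eps, 0 < eps -> exists g, approx rho g /\
     forall z, Cmod z <= rho -> Cmod (f z - g z)%C <= eps) -> approx rho f.
Proof.
  intros H eps he. destruct (H (eps / 2)) as [g [hg hfg]]; [lra|].
  destruct (hg (eps / 2)) as [p hp]; [lra|]. exists p. intros z hz.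
  specialize (hfg z hz). specialize (hp z hz).
  pose proof (Cmod_tri3 (f z) (g z) (peval p z)). lra.
Qed.

Lemma approx_peval rho p f : approx rho f -> approx rho (fun z => peval p (f z)).
Proof.
  intros hf. induction p as [|c q IH]; simpl.
  - apply approx_const.
  - apply approx_plus; [apply approx_const|]. apply approx_mult; auto.
Qed.

Lemma approx_geom rho u n : approx rho u -> approx rho (fun z => psum (fun k => u z ^ k)%C n).
Proof.
  intros hu. induction n; simpl; [apply approx_const|].
  apply approx_plus; auto. clear IHn.
  induction n; simpl; [apply approx_const|]. now apply approx_mult.
Qed.

(* A bounded set in the half-plane Im >= c is mapped into a disc |u| <= q < 1 by u = 1 + i d f,
   so that 1 / f is a geometric series in u. *)
Lemma approx_inv rho c f : 0 < c -> approx rho f ->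
  (forall z, Cmod z <= rho -> c <= Im (f z)) -> approx rho (fun z => / f z)%C.
Proof.
  intros hc hf him.
  destruct (approx_bounded _ _ hf) as [B0 [hB0 HB0]].
  set (B := B0 + c). assert (HB : forall z, Cmod z <= rho -> Cmod (f z) <= B).
  { intros z hz; specialize (HB0 z hz); unfold B; lra. }
  assert (hcB : c <= B) by (unfold B; lra).
  (* One has |u|^2 = 1 - 2 d Im f + d^2 |f|^2 <= 1 - 2 d c + d^2 B^2; this d minimizes the
     right-hand side, with value 1 - d c. *)
  set (d := c / (B * B)). assert (hd : 0 < d) by (apply Rdiv_lt_0_compat; nra).
  set (u := fun z => (1 + Ci * RtoC d * f z)%C).
  assert (hu : approx rho u).
  { apply approx_plus; [apply approx_const|]. apply approx_mult; auto. apply approx_const. }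
  set (q := sqrt (1 - d * c)).
  assert (hdc : 0 < d * c <= 1).
  { split; [apply Rmult_lt_0_compat; auto|]. unfold d.
    apply Rmult_le_reg_r with (B * B); [nra|].
    replace (c / (B * B) * c * (B * B)) with (c * c) by (field; lra). nra. }
  assert (hq : 0 <= q < 1).
  { split; [apply sqrt_pos|]. rewrite <- sqrt_1. apply sqrt_lt_1; lra. }
  assert (hmod : forall z, Cmod z <= rho -> Cmod (u z) <= q).
  { intros z hz. apply sqrt_le_1_alt. unfold u.
    specialize (him z hz). specialize (HB z hz).
    pose proof (Cmod_sq (f z)) as Q. pose proof (Cmod_ge_0 (f z)).
    assert (Cmod (f z) * Cmod (f z) <= B * B) by nra.
    unfold Re, Im in *. simpl.
    replace (_ + _) with (1 - 2 * d * snd (f z) +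
       d * d * (fst (f z) * fst (f z) + snd (f z) * snd (f z))) by ring.
    rewrite <- Q.
    assert (d * d * (Cmod (f z) * Cmod (f z)) <= d * d * (B * B)) by nra.
    replace (d * d * (B * B)) with (d * c) in H1 by (unfold d; field; lra). nra. }
  apply approx_lim. intros eps he.
  destruct (pow_lt_1_zero q) with (y := eps * c) as [n hn].
  { rewrite Rabs_right; lra. } { nra. }
  exists (fun z => - Ci * RtoC d * psum (fun k => u z ^ k) n)%C. split.
  { apply approx_mult; [apply approx_const|]. now apply approx_geom. }
  intros z hz. specialize (hn n ltac:(lia)). specialize (hmod z hz). specialize (him z hz).
  assert (hf0 : f z <> 0%C) by (apply im_pos_neq0; lra).
  assert (E : (/ f z - - Ci * RtoC d * psum (fun k => u z ^ k) n)%C = (u z ^ n * / f z)%C).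
  { assert (G := geom_sum (u z) n).
    replace (u z - 1)%C with (Ci * RtoC d * f z)%C in G by (unfold u; ring).
    replace (u z ^ n)%C with (Ci * RtoC d * f z * psum (fun k => u z ^ k) n + 1)%C
      by (rewrite G; ring).
    field; auto. }
  rewrite E, Cmod_mult, Cmod_inv, Cmod_pow by auto.
  assert (c <= Cmod (f z)) by (eapply Rle_trans; [exact him|apply im_le_mod]).
  assert (Cmod (u z) ^ n <= eps * c).
  { apply Rle_trans with (q ^ n); [apply pow_incr; split; [apply Cmod_ge_0|auto]|].
    rewrite Rabs_right in hn; [lra|]. apply Rle_ge, pow_le; lra. }
  apply Rmult_le_reg_r with (Cmod (f z)); [lra|].
  rewrite Rmult_assoc, Rinv_l by lra. nra.
Qed.

(** * From uniform approximation to a power series *)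

Lemma peval_psum (p : list C) z n : (length p <= n)%nat -> psum (fun k => nth k p 0 * z ^ k)%C n = peval p z.
Proof.
  revert n. induction p as [|c q IH]; intros n hn; simpl.
  - rewrite (psum_ext _ (fun k => 0 * 0)%C); [rewrite psum_scale; ring|].
    intros [|k] _; ring.
  - simpl in hn. destruct n as [|n]; [lia|]. rewrite psum_shift, <- (IH n) by lia.
    rewrite <- psum_scale. simpl. f_equal; [ring|]. apply psum_ext. intros; ring.
Qed.

Lemma psum_geom_le c K th n : 0 <= K -> 0 <= th < 1 ->
  (forall k, Cmod (c k) <= K * th ^ k) -> Cmod (psum c n) <= K / (1 - th).
Proof.
  intros hK hth H.
  assert (Cmod (psum c n) <= K * ((1 - th ^ n) / (1 - th))).
  { induction n; simpl.
    - rewrite Cmod_0. right. field. lra.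
    - eapply Rle_trans; [apply Cmod_triangle|]. specialize (H n).
      replace (K * ((1 - th * th ^ n) / (1 - th)))
        with (K * ((1 - th ^ n) / (1 - th)) + K * th ^ n) by (field; lra). lra. }
  eapply Rle_trans; [exact H0|]. unfold Rdiv.
  apply Rmult_le_compat_l; auto.
  assert (0 <= th ^ n) by (apply pow_le; lra).
  assert (0 < / (1 - th)) by (apply Rinv_0_lt_compat; lra). nra.
Qed.

(** Cauchy's estimate for the difference of two approximating polynomials shows that the n-th
    coefficients form a Cauchy sequence with error of order rho^-n. The limits are the coefficients,
    and the errors sum to a geometric series when |z| < rho. *)
Lemma approx_power_series rho f : 0 < rho -> approx rho f ->
  exists a : nat -> C, forall z, Cmod z < rho -> forall eps, 0 < eps -> exists N0,
    forall N, (N0 <= N)%nat -> Cmod (psum (fun n => a n * z ^ n)%C N - f z)%C < eps.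
Proof.
  intros hr hf.
  assert (hk : forall k : nat, exists p, forall z, Cmod z <= rho ->
     Cmod (f z - peval p z)%C <= (/ 2) ^ k).
  { intros k. apply hf. apply pow_lt; lra. }
  destruct (fun_choice _ hk) as [p hp]. clear hk.
  assert (hcoef : forall n, exists a, forall k,
     Cmod (nth n (p k) 0 - a)%C <= 2 * (/ 2) ^ k / rho ^ n).
  { intros n. assert (hrn : 0 < rho ^ n) by (apply pow_lt; auto).
    apply C_complete.
    - intros k m hkm.
      pose proof (cauchy_estimate rho (2 * (/ 2) ^ k)
        (padd (p m) (pscale (RtoC (-1)) (p k))) ltac:(lra)) as E.
      apply Rmult_le_reg_r with (rho ^ n); auto.
      replace (2 * (/ 2) ^ k / rho ^ n * rho ^ n) with (2 * (/ 2) ^ k) by (field; lra).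
      replace (nth n (p m) 0 - nth n (p k) 0)%C
        with (nth n (padd (p m) (pscale (RtoC (-1)) (p k))) 0)%C.
      2:{ rewrite nth_padd, nth_pscale. ring. }
      apply E. intros z hz. rewrite peval_padd, peval_pscale.
      replace (peval (p m) z + -1 * peval (p k) z)%C
        with (peval (p m) z - peval (p k) z)%C by ring.
      eapply Rle_trans; [apply (Cmod_tri3 _ (f z))|].
      rewrite (Cmod_minus_sym (peval (p m) z)).
      pose proof (hp m z hz). pose proof (hp k z hz).
      assert ((/ 2) ^ m <= (/ 2) ^ k).
      { replace m with (k + (m - k))%nat by lia. rewrite pow_add.
        assert (0 < (/ 2) ^ k) by (apply pow_lt; lra).
        assert ((/ 2) ^ (m - k) <= 1).
        { rewrite <- (pow1 (m - k)). apply pow_incr; lra. }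
        nra. }
      lra.
    - intros eps he. destruct (pow_half_lt 2 (eps * rho ^ n)) as [k hk]; [nra|].
      exists k. apply Rmult_lt_reg_r with (rho ^ n); auto.
      unfold Rdiv. rewrite Rmult_assoc, Rinv_l by lra. lra. }
  destruct (fun_choice _ hcoef) as [a ha]. exists a.
  intros z hz eps he.
  set (th := Cmod z / rho).
  assert (hth : 0 <= th < 1).
  { unfold th. split.
    - apply Rmult_le_pos; [apply Cmod_ge_0|]. apply Rlt_le, Rinv_0_lt_compat; auto.
    - apply Rmult_lt_reg_r with rho; auto. unfold Rdiv. rewrite Rmult_assoc, Rinv_l; lra. }
  destruct (pow_half_lt (2 / (1 - th) + 1) eps he) as [k hk].
  (* From this index on, the partial sum of [p k] is all of [p k], so only the differences of
     coefficients separate the two sums. *)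
  exists (length (p k)). intros N hN.
  pose proof (hp k z ltac:(lra)) as hfp. rewrite <- (peval_psum (p k) z N) in hfp by auto.
  set (A := psum (fun n => a n * z ^ n)%C N) in *.
  set (P := psum (fun n => nth n (p k) 0 * z ^ n)%C N) in *.
  assert (hAP : Cmod (P - A)%C <= 2 * (/ 2) ^ k / (1 - th)).
  { replace (P - A)%C with (psum (fun n => (nth n (p k) 0 - a n) * z ^ n)%C N).
    2:{ replace (P - A)%C with (P + RtoC (-1) * A)%C by ring.
        unfold P, A. rewrite <- psum_scale, <- psum_plus. apply psum_ext; intros; ring. }
    apply psum_geom_le; auto.
    - assert (0 < (/ 2) ^ k) by (apply pow_lt; lra). lra.
    - intros n. rewrite Cmod_mult, Cmod_pow. specialize (ha n k).
      assert (hrn : 0 < rho ^ n) by (apply pow_lt; auto).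
      unfold th, Rdiv. rewrite Rpow_mult_distr, (pow_inv rho).
      assert (0 <= Cmod z ^ n) by (apply pow_le, Cmod_ge_0).
      apply Rle_trans with (2 * (/ 2) ^ k / rho ^ n * Cmod z ^ n);
        [apply Rmult_le_compat_r; auto|right; unfold Rdiv; ring]. }
  rewrite Cmod_minus_sym in hAP.
  pose proof (Cmod_tri3 A P (f z)) as T. rewrite (Cmod_minus_sym (f z)) in hfp.
  assert (2 * (/ 2) ^ k / (1 - th) + (/ 2) ^ k = (2 / (1 - th) + 1) * (/ 2) ^ k) by (field; lra).
  lra.
Qed.

(** * Complex extension of the driving function *)

(** The lower-order terms make the induction close: twice the left-hand side is at least its value
    at n + 1. *)
Lemma INR_le_pow2 n : INR n * INR n + 2 * INR n + 3 <= 3 * 2 ^ n.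
Proof. induction n; [simpl; lra|]. rewrite S_INR. simpl pow. pose proof (pos_INR n). nra. Qed.

Lemma pow_quarter n : (/ 4) ^ n = (/ 2) ^ n * (/ 2) ^ n.
Proof. rewrite <- Rpow_mult_distr. f_equal. lra. Qed.

Lemma pow_half_cancel n : 2 ^ n * (/ 2) ^ n = 1.
Proof. rewrite <- Rpow_mult_distr. replace (2 * / 2) with 1 by lra. apply pow1. Qed.

(** Half of the decay of the coefficients pays for the factor n^2 that the second-order remainder of
    z^n produces. *)
Lemma quarter_sq n : INR n * INR n * (/ 4) ^ n <= 3 * (/ 2) ^ n.
Proof.
  rewrite pow_quarter. pose proof (INR_le_pow2 n). pose proof (pos_INR n).
  assert (0 < (/ 2) ^ n) by (apply pow_lt; lra). pose proof (pow_half_cancel n).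
  assert (INR n * INR n * (/ 2) ^ n <= 3 * 2 ^ n * (/ 2) ^ n) by nra. nra.
Qed.

Lemma quarter_lin n : INR n * (/ 4) ^ n <= 3 * (/ 2) ^ n.
Proof.
  rewrite pow_quarter. pose proof (INR_le_pow2 n). pose proof (pos_INR n).
  assert (0 < (/ 2) ^ n) by (apply pow_lt; lra). pose proof (pow_half_cancel n).
  assert (INR n * (/ 2) ^ n <= 3 * 2 ^ n * (/ 2) ^ n) by nra. nra.
Qed.

Lemma quarter_cst n : (/ 4) ^ n <= (/ 2) ^ n.
Proof. apply pow_incr; lra. Qed.

Lemma Cmod_pow_le z n r : Cmod z <= r -> Cmod (z ^ n)%C <= r ^ n.
Proof. intros. rewrite Cmod_pow. apply pow_incr. split; [apply Cmod_ge_0|auto]. Qed.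

Lemma Cmod_INR n : Cmod (RtoC (INR n)) = INR n.
Proof. rewrite Cmod_R, Rabs_right; auto. apply Rle_ge, pos_INR. Qed.

Lemma dpow_bound r z n : 0 < r -> Cmod z <= r ->
  r * Cmod (RtoC (INR n) * z ^ pred n)%C <= INR n * r ^ n.
Proof.
  intros hr hz. rewrite Cmod_mult, Cmod_INR. destruct n; [simpl; lra|].
  simpl pred. pose proof (Cmod_pow_le z n r hz).
  pose proof (pos_INR (S n)). set (N := INR (S n)) in *. simpl pow.
  replace (r * (N * Cmod (z ^ n))) with (N * r * Cmod (z ^ n)) by ring.
  rewrite <- Rmult_assoc. apply Rmult_le_compat_l; nra.
Qed.

(** The remainder e_n satisfies e_(n+1) = z e_n + (z - w)^2 n w^(n-1). The factor r^2 on the left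
    avoids the exponent n - 2, which is negative for small n. *)
Lemma pow_taylor r z w n : 0 < r -> Cmod z <= r -> Cmod w <= r ->
  r * r * Cmod (z ^ n - w ^ n - RtoC (INR n) * w ^ pred n * (z - w))%C <=
  INR n * INR n * r ^ n * (Cmod (z - w)%C * Cmod (z - w)%C).
Proof.
  intros hr hz hw. set (d := Cmod (z - w)%C). assert (hd : 0 <= d) by apply Cmod_ge_0.
  induction n.
  - simpl. replace (1 - 1 - 0 * 1 * (z - w))%C with (RtoC 0) by ring. rewrite Cmod_0. lra.
  - set (e := (z ^ n - w ^ n - RtoC (INR n) * w ^ pred n * (z - w))%C) in *.
    replace (z ^ S n - w ^ S n - RtoC (INR (S n)) * w ^ pred (S n) * (z - w))%C
      with (z * e + (z - w) * (z - w) * (RtoC (INR n) * w ^ pred n))%C.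
    2:{ unfold e. rewrite S_INR, RtoC_plus. simpl pred.
        destruct n; [simpl; ring|]. simpl pred. simpl Cpow. ring. }
    assert (Cmod (z * e + (z - w) * (z - w) * (RtoC (INR n) * w ^ pred n))%C <=
      r * Cmod e + d * d * Cmod (RtoC (INR n) * w ^ pred n)%C).
    { eapply Rle_trans; [apply Cmod_triangle|]. rewrite !(Cmod_mult (_ * _)).
      rewrite (Cmod_mult z), (Cmod_mult (z - w)). fold d.
      pose proof (Cmod_ge_0 e). nra. }
    pose proof (dpow_bound r w n hr hw) as D.
    set (E := Cmod (RtoC (INR n) * w ^ pred n)%C) in *.
    rewrite S_INR. pose proof (pos_INR n). simpl pow.
    assert (hp : 0 < r ^ n) by (apply pow_lt; auto).
    assert (0 <= d * d) by nra.
    apply Rle_trans with (r * r * (r * Cmod e + d * d * E)); [apply Rmult_le_compat_l; nra|].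
    assert (r * (r * r * Cmod e) <= r * (INR n * INR n * r ^ n * (d * d)))
      by (apply Rmult_le_compat_l; lra).
    assert (r * (d * d) * (r * E) <= r * (d * d) * (INR n * r ^ n))
      by (apply Rmult_le_compat_l; nra).
    assert (0 <= r * (d * d) * r ^ n * (INR n + 1)).
    { apply Rmult_le_pos; [|lra]. apply Rmult_le_pos; nra. }
    nra.
Qed.

(** The hypothesis is that of a power series with bounded terms at radius 4 r. The first-order
    expansion with quadratic remainder is the form of differentiability that later yields the
    derivative along any complex line. *)
Lemma power_series_C2 (a : nat -> C) (B r : R) :
  0 < r -> 0 <= B -> (forall n, Cmod (a n) * r ^ n <= B * (/ 4) ^ n) ->
  exists (f f' : C -> C) (M : R), 0 <= M /\
    (forall z, Cmod z <= r -> forall k,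
       Cmod (psum (fun n => a n * z ^ n) k - f z)%C <= 2 * B * (/ 2) ^ k) /\
    (forall z, Cmod z <= r -> Cmod (f' z) <= M) /\
    (forall z w, Cmod z <= r -> Cmod w <= r ->
       Cmod (f z - f w - f' w * (z - w))%C <= M * (Cmod (z - w)%C * Cmod (z - w)%C)).
Proof.
  intros hr hB ha.
  assert (h1 : forall z, exists l, Cmod z <= r -> forall k,
     Cmod (psum (fun n => a n * z ^ n) k - l)%C <= 2 * B * (/ 2) ^ k).
  { intros z. destruct (Rle_dec (Cmod z) r) as [hz|]; [|exists 0%C; tauto].
    destruct (C_geom_complete (psum (fun n => a n * z ^ n)%C) B) as [l hl]; [|eauto].
    intros k. simpl. match goal with |- Cmod ?x <= _ => replace x with (a k * z ^ k)%C by ring end.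
    rewrite Cmod_mult. pose proof (Cmod_pow_le z k r hz). pose proof (Cmod_ge_0 (a k)).
    pose proof (quarter_cst k). specialize (ha k). nra. }
  assert (h2 : forall z, exists l, Cmod z <= r -> forall k,
     Cmod (psum (fun n => a n * (RtoC (INR n) * z ^ pred n)) k - l)%C <= 2 * (3 * B / r) * (/ 2) ^ k).
  { intros z. destruct (Rle_dec (Cmod z) r) as [hz|]; [|exists 0%C; tauto].
    destruct (C_geom_complete (psum (fun n => a n * (RtoC (INR n) * z ^ pred n))%C) (3 * B / r))
      as [l hl]; [|eauto].
    intros k. simpl. match goal with |- Cmod ?x <= _ =>
      replace x with (a k * (RtoC (INR k) * z ^ pred k))%C by ring end.
    rewrite Cmod_mult. pose proof (dpow_bound r z k hr hz). pose proof (Cmod_ge_0 (a k)).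
    pose proof (quarter_lin k). specialize (ha k). pose proof (pos_INR k).
    set (E := Cmod (RtoC (INR k) * z ^ pred k)%C) in *.
    apply Rmult_le_reg_l with r; auto.
    replace (r * (3 * B / r * (/ 2) ^ k)) with (B * (3 * (/ 2) ^ k)) by (field; lra).
    apply Rle_trans with (Cmod (a k) * (INR k * r ^ k)); [nra|].
    apply Rle_trans with (INR k * (B * (/ 4) ^ k)); nra. }
  destruct (fun_choice _ h1) as [f hf]. destruct (fun_choice _ h2) as [f' hf'].
  set (M1 := 2 * (3 * B / r)). set (M2 := 6 * B / (r * r)).
  assert (hM1 : 0 <= M1).
  { unfold M1. assert (0 <= B / r) by (apply Rmult_le_pos; [auto|apply Rlt_le, Rinv_0_lt_compat; auto]).
    unfold Rdiv in *. nra. }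
  assert (hM2 : 0 <= M2).
  { unfold M2, Rdiv. apply Rmult_le_pos; [lra|apply Rlt_le, Rinv_0_lt_compat; nra]. }
  exists f, f', (M1 + M2). split; [lra|]. split; [auto|]. split.
  - intros z hz. specialize (hf' z hz 0%nat). simpl in hf'.
    replace (0 - f' z)%C with (- f' z)%C in hf' by ring. rewrite Cmod_opp in hf'.
    fold M1 in hf'. lra.
  - intros z w hz hw. set (d := Cmod (z - w)%C). assert (hd : 0 <= d) by apply Cmod_ge_0.
    apply Rle_trans with (M2 * (d * d)); [|apply Rmult_le_compat_r; nra].
    apply le_epsilon. intros eps he.
    destruct (pow_half_lt (2 * B + 2 * B + M1 * d) eps he) as [k hk].
    set (sz := psum (fun n => a n * z ^ n)%C k).
    set (sw := psum (fun n => a n * w ^ n)%C k).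
    set (s' := psum (fun n => a n * (RtoC (INR n) * w ^ pred n))%C k).
    specialize (hf z hz k) as e1. specialize (hf w hw k) as e2. specialize (hf' w hw k) as e3.
    fold sz in e1. fold sw in e2. fold s' in e3. fold M1 in e3.
    assert (e4 : Cmod (sz - sw - s' * (z - w))%C <= M2 * (d * d)).
    { replace (sz - sw - s' * (z - w))%C with
        (psum (fun n => a n * (z ^ n - w ^ n - RtoC (INR n) * w ^ pred n * (z - w))) k)%C.
      2:{ replace (sz - sw - s' * (z - w))%C with
            (sz + (RtoC (-1) * sw + (- (z - w)) * s'))%C by ring.
          unfold sz, sw, s'. rewrite <- !psum_scale, <- !psum_plus.
          apply psum_ext. intros; ring. }
      replace (M2 * (d * d)) with (3 * B / (r * r) * (d * d) / (1 - / 2))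
        by (unfold M2; field; lra).
      apply psum_geom_le.
      - apply Rmult_le_pos; [|nra]. unfold Rdiv; apply Rmult_le_pos; [lra|].
        apply Rlt_le, Rinv_0_lt_compat; nra.
      - lra.
      - intros n. rewrite Cmod_mult. pose proof (pow_taylor r z w n hr hz hw) as Q.
        fold d in Q. set (E := Cmod (_ - _ - _)%C) in *.
        pose proof (quarter_sq n) as q. specialize (ha n). pose proof (Cmod_ge_0 (a n)).
        pose proof (pos_INR n).
        apply Rmult_le_reg_l with (r * r); [nra|].
        replace (r * r * (3 * B / (r * r) * (d * d) * (/ 2) ^ n))
          with (B * (d * d) * (3 * (/ 2) ^ n)) by (field; lra).
        apply Rle_trans with (Cmod (a n) * (INR n * INR n * r ^ n * (d * d))).
        { replace (r * r * (Cmod (a n) * E)) with (Cmod (a n) * (r * r * E)) by ring.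
          apply Rmult_le_compat_l; auto. }
        apply Rle_trans with (INR n * INR n * (d * d) * (B * (/ 4) ^ n)).
        { replace (Cmod (a n) * (INR n * INR n * r ^ n * (d * d)))
            with (INR n * INR n * (d * d) * (Cmod (a n) * r ^ n)) by ring.
          apply Rmult_le_compat_l; auto. apply Rmult_le_pos; nra. }
        replace (INR n * INR n * (d * d) * (B * (/ 4) ^ n))
          with (B * (d * d) * (INR n * INR n * (/ 4) ^ n)) by ring.
        apply Rmult_le_compat_l; auto. apply Rmult_le_pos; nra. }
    replace (f z - f w - f' w * (z - w))%C with
      ((sz - sw - s' * (z - w)) + ((- (sz - f z) + (sw - f w)) + (s' - f' w) * (z - w)))%C by ring.
    eapply Rle_trans; [apply Cmod_triangle|]. apply Rplus_le_compat; auto.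
    eapply Rle_trans; [apply Cmod_triangle|].
    rewrite Cmod_mult. fold d.
    pose proof (Cmod_triangle (- (sz - f z)) (sw - f w)) as t. rewrite Cmod_opp in t.
    assert (Cmod (s' - f' w)%C * d <= M1 * (/ 2) ^ k * d) by nra. nra.
Qed.

(** The disc may stick out of [0, T] at an endpoint, which allows the tip at time T to be treated
    like any other. *)
Definition local_ext (T : R) (lam : R -> R) (t0 r M : R) (Lam Lam' : C -> C) : Prop :=
  0 < r /\ 0 <= M /\
  (forall t, 0 <= t <= T -> Rabs (t - t0) <= r -> Lam (RtoC t) = RtoC (lam t)) /\
  (forall z w, Cmod (z - RtoC t0)%C <= r -> Cmod (w - RtoC t0)%C <= r ->
     Cmod (Lam z - Lam w - Lam' w * (z - w))%C <= M * (Cmod (z - w)%C * Cmod (z - w)%C)) /\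
  (forall z, Cmod (z - RtoC t0)%C <= r -> Cmod (Lam' z) <= M) /\
  (forall eps, 0 < eps -> exists p, forall z, Cmod (z - RtoC t0)%C <= r ->
     Cmod (Lam z - peval p (z - RtoC t0))%C <= eps).

Lemma peval_of_psum (c : nat -> C) n : exists p, forall z,
  psum (fun k => c k * z ^ k)%C n = peval p z.
Proof.
  revert c. induction n; intros c.
  - exists nil. reflexivity.
  - destruct (IHn (fun k => c (S k))) as [p hp]. exists (c O :: p). intros z.
    rewrite psum_shift. simpl. rewrite <- hp, <- psum_scale.
    replace (c O * 1)%C with (c O) by ring. f_equal. apply psum_ext. intros; simpl; ring.
Qed.

Lemma psum_sum_f_R0 (a : nat -> R) x N :
  RtoC (sum_f_R0 (fun n => a n * x ^ n) N) = psum (fun n => RtoC (a n) * RtoC x ^ n)%C (S N).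
Proof.
  induction N.
  - simpl. rewrite RtoC_mult. ring.
  - simpl sum_f_R0. rewrite RtoC_plus, IHN. simpl psum. f_equal.
    rewrite RtoC_mult. f_equal. simpl. rewrite RtoC_mult. f_equal. apply RtoC_pow.
Qed.

Lemma analytic_local_ext (T : R) (lam : R -> R) : 0 < T ->
  real_analytic_on (fun t => 0 <= t <= T) lam ->
  forall t0, 0 <= t0 <= T -> exists r M Lam Lam', local_ext T lam t0 r M Lam Lam'.
Proof.
  intros hT hl t0 ht0. destruct (hl t0 ht0) as [r0 [hr0 [a ha]]].
  (* Convergence at a single point t1 other than t0 is enough; it is taken to the left of t0 when t0
     = T and to the right otherwise. *)
  assert (ht1 : exists t1, 0 <= t1 <= T /\ t1 <> t0 /\ Rabs (t1 - t0) < r0).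
  { destruct (Rle_or_lt T t0).
    - exists (t0 - Rmin (T / 2) (r0 / 2)).
      assert (0 < Rmin (T / 2) (r0 / 2)) by (apply Rmin_pos; lra).
      pose_Rmin (T / 2) (r0 / 2).
      repeat split; try lra. rewrite Rabs_left; lra.
    - exists (t0 + Rmin ((T - t0) / 2) (r0 / 2)).
      assert (0 < Rmin ((T - t0) / 2) (r0 / 2)) by (apply Rmin_pos; lra).
      pose_Rmin ((T - t0) / 2) (r0 / 2).
      repeat split; try lra. rewrite Rabs_right; lra. }
  destruct ht1 as [t1 [h1 [hne hlt]]].
  set (d := Rabs (t1 - t0)) in *. assert (hd : 0 < d) by (apply Rabs_pos_lt; lra).
  (* Abel's lemma: the terms of a series convergent at t1 are bounded. At radius d / 4 this bound
     becomes B (1/4)^n. *)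
  assert (hB : exists B, 0 <= B /\ forall n, Rabs (a n) * d ^ n <= B).
  { pose proof (ha t1 h1 hlt) as cv.
    assert (hex : ex_series (fun n => a n * (t1 - t0) ^ n)).
    { exists (lam t1). apply is_series_Reals. exact cv. }
    apply ex_series_lim_0 in hex.
    destruct (filterlim_bounded (fun n => a n * (t1 - t0) ^ n)) as [B hB].
    { exists 0. exact hex. }
    exists B. split.
    - eapply Rle_trans; [apply Rabs_pos|apply (hB 0%nat)].
    - intros n. specialize (hB n). unfold norm in hB; simpl in hB. unfold abs in hB; simpl in hB.
      rewrite Rabs_mult, <- RPow_abs in hB. exact hB. }
  destruct hB as [B [hB0 hB]].
  destruct (power_series_C2 (fun n => RtoC (a n)) B (d / 4)) as [f [f' [M [hM [hf [hf1 hf2]]]]]];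
    [lra|auto| |].
  { intros n. rewrite Cmod_R. unfold Rdiv. rewrite Rpow_mult_distr.
    assert (0 < (/ 4) ^ n) by (apply pow_lt; lra). specialize (hB n). nra. }
  exists (d / 4), M, (fun z => f (z - RtoC t0)%C), (fun z => f' (z - RtoC t0)%C).
  split; [lra|]. split; [auto|]. split; [|split; [|split]].
  - intros t ht htr. apply Cmod_small_eq. intros eps he.
    destruct (ha t ht ltac:(lra) (eps / 2) ltac:(lra)) as [N hN].
    destruct (pow_half_lt (2 * B) (eps / 2) ltac:(lra)) as [k hk].
    specialize (hN (N + k)%nat ltac:(lia)). unfold Rdist in hN.
    rewrite <- RtoC_minus. specialize (hf (RtoC (t - t0))).
    rewrite Cmod_R in hf. specialize (hf htr (S (N + k))).
    rewrite <- psum_sum_f_R0 in hf.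
    set (s := sum_f_R0 (fun n => a n * (t - t0) ^ n) (N + k)) in *.
    eapply Rle_trans; [apply (Cmod_tri3 _ (RtoC s))|].
    rewrite (Cmod_minus_sym (f _)), <- RtoC_minus, Cmod_R.
    assert ((/ 2) ^ S (N + k) <= (/ 2) ^ k).
    { replace (S (N + k)) with (S N + k)%nat by lia. rewrite pow_add.
      assert (0 < (/ 2) ^ k) by (apply pow_lt; lra).
      assert ((/ 2) ^ S N <= 1) by (rewrite <- (pow1 (S N)); apply pow_incr; lra). nra. }
    assert (2 * B * (/ 2) ^ S (N + k) <= 2 * B * (/ 2) ^ k) by (apply Rmult_le_compat_l; lra).
    lra.
  - intros z w hz hw. specialize (hf2 _ _ hz hw).
    replace (z - RtoC t0 - (w - RtoC t0))%C with (z - w)%C in hf2 by ring. exact hf2.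
  - intros z hz. now apply hf1.
  - intros eps he. destruct (pow_half_lt (2 * B) eps he) as [k hk].
    destruct (peval_of_psum (fun n => RtoC (a n)) k) as [p hp]. exists p.
    intros z hz. rewrite <- hp, Cmod_minus_sym. specialize (hf _ hz k). lra.
Qed.

(** * Reverse trajectories and tip trajectories *)

Lemma cderive_of_quadratic (F : R -> C) (s : R) (m : C) (K d : R) :
  0 < d -> 0 <= K ->
  (forall u, Rabs (u - s) < d -> Cmod (F u - F s - RtoC (u - s) * m)%C <= K * ((u - s) * (u - s))) ->
  cderive F s m.
Proof.
  intros hd hK H.
  assert (G : forall p : C -> R, (forall z, Rabs (p z) <= Cmod z) ->
    (forall u, p (F u - F s - RtoC (u - s) * m)%C = p (F u) - p (F s) - (u - s) * p m) ->
    is_derive (fun u => p (F u)) s (p m)).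
  { intros p hp hlin. apply is_derive_Reals. intros eps he.
    assert (hd' : 0 < Rmin d (eps / (K + 1))).
    { apply Rmin_pos; auto. apply Rdiv_lt_0_compat; lra. }
    exists (mkposreal _ hd'). intros h hh0 hh. simpl in hh.
    pose_Rmin d (eps / (K + 1)).
    assert (a0 : 0 < Rabs h) by now apply Rabs_pos_lt.
    specialize (H (s + h)). replace (s + h - s) with h in H by ring.
    specialize (H ltac:(lra)).
    pose proof (hp (F (s + h)%R - F s - RtoC h * m)%C) as E.
    replace (RtoC h) with (RtoC (s + h - s)) in E by (f_equal; ring).
    rewrite hlin in E. replace (s + h - s) with h in E by ring.
    replace ((p (F (s + h)) - p (F s)) / h - p m)
      with ((p (F (s + h)) - p (F s) - h * p m) / h) by (field; auto).
    unfold Rdiv. rewrite Rabs_mult, Rabs_inv.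
    apply Rmult_lt_reg_r with (Rabs h); auto.
    rewrite Rmult_assoc, Rinv_l, Rmult_1_r by lra.
    replace (h * h) with (Rabs h * Rabs h) in H by (rewrite <- Rabs_mult; apply Rabs_right; nra).
    assert (K * Rabs h < eps).
    { assert ((K + 1) * Rabs h < eps) by (apply mul_lt_of_lt_div; lra). lra. }
    nra. }
  split; apply G.
  - apply re_le_Cmod.
  - intros. unfold Re; simpl. ring.
  - apply im_le_Cmod.
  - intros. unfold Im; simpl. ring.
Qed.

Lemma cderive_ext_loc (F G : R -> C) s m d : 0 < d ->
  (forall u, Rabs (u - s) < d -> F u = G u) -> cderive F s m -> cderive G s m.
Proof.
  intros hd H [h1 h2].
  split; (eapply is_derive_ext_loc; [|eassumption]); exists (mkposreal d hd);
    intros u hu; simpl; rewrite H; auto.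
Qed.

Lemma cderive_rev (F : R -> C) t s m : cderive F (t - s) m -> cderive (fun u => F (t - u)) s (- m)%C.
Proof.
  assert (G : forall (p : R -> R) (m : R), is_derive p (t - s) m ->
     is_derive (fun u => p (t - u)) s (- m)).
  { intros p q hp. eapply derive_eq.
    - apply (is_derive_comp p (fun u => t - u)); [exact hp|].
      apply derive_sub; [apply derive_const|apply derive_id].
    - unfold scal; simpl; unfold mult; simpl. ring. }
  intros [h1 h2]. split.
  - apply (G (fun u => Re (F u)) (Re m)); auto.
  - apply (G (fun u => Im (F u)) (Im m)); auto.
Qed.

Lemma ccont_comp (F : R -> C) (p : R -> R) :
  ccont F -> (forall s u, Rabs (p u - p s) <= Rabs (u - s)) -> ccont (fun s => F (p s)).
Proof.
  rewrite !ccont_iff_eps. intros H hp s eps he.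
  destruct (H (p s) eps he) as [d [hd hd']]. exists d; split; auto.
  intros u hu. apply hd'. eapply Rle_lt_trans; [apply hp|auto].
Qed.

Lemma rev_lip t s u : Rabs ((t - u) - (t - s)) <= Rabs (u - s).
Proof. replace (t - u - (t - s)) with (- (u - s)) by ring. rewrite Rabs_Ropp. lra. Qed.

Lemma sol_rev kappa l a b t h :
  sol kappa l a b h ->
  sol (- kappa)%C (fun s => l (t - s)) (t - b) (t - a) (fun s => h (t - s)).
Proof.
  intros [hc hd]. split.
  - apply ccont_comp; auto. intros; apply rev_lip.
  - intros s hs. replace (- kappa / (h (t - s)%R - l (t - s)%R))%C
      with (- (kappa / (h (t - s)%R - l (t - s)%R)))%C by (unfold Cdiv; ring).
    apply cderive_rev. apply hd. lra.
Qed.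

Definition extendable (T : R) (lam : R -> R) : Prop :=
  0 < T /\ forall t0, 0 <= t0 <= T -> exists r M Lam Lam', local_ext T lam t0 r M Lam Lam'.

(** Nothing is known of [lam] outside [0, T], so it is frozen at the end values to be continuous on
    the line. *)
Definition driving (T : R) (lam : R -> R) (s : R) : C := RtoC (lam (clamp 0 T s)).
Definition rdriving (T : R) (lam : R -> R) (t s : R) : C := driving T lam (t - s).

Lemma driving_im T lam s : Im (driving T lam s) = 0.
Proof. reflexivity. Qed.

Lemma rdriving_im T lam t s : Im (rdriving T lam t s) = 0.
Proof. reflexivity. Qed.

Lemma driving_eq T lam s : 0 <= s <= T -> driving T lam s = RtoC (lam s).
Proof. intros. unfold driving. now rewrite clamp_id. Qed.

Lemma local_ext_lip T lam t0 r M Lam Lam' z w : local_ext T lam t0 r M Lam Lam' ->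
  Cmod (z - RtoC t0)%C <= r -> Cmod (w - RtoC t0)%C <= r ->
  Cmod (Lam z - Lam w)%C <= M * (1 + 2 * r) * Cmod (z - w)%C.
Proof.
  intros [hr [hM [_ [h2 [h3 _]]]]] hz hw.
  specialize (h2 z w hz hw). specialize (h3 w hw).
  set (d := Cmod (z - w)%C) in *. assert (hd : 0 <= d) by apply Cmod_ge_0.
  assert (hdr : d <= 2 * r).
  { unfold d. pose proof (Cmod_tri3 z (RtoC t0) w). rewrite (Cmod_minus_sym (RtoC t0)) in H. lra. }
  replace (Lam z - Lam w)%C with ((Lam z - Lam w - Lam' w * (z - w)) + Lam' w * (z - w))%C by ring.
  eapply Rle_trans; [apply Cmod_triangle|]. rewrite Cmod_mult. fold d.
  assert (Cmod (Lam' w) * d <= M * d) by nra.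
  assert (M * (d * d) <= M * (2 * r * d)) by (apply Rmult_le_compat_l; nra). lra.
Qed.

Lemma driving_cont T lam : extendable T lam -> ccont (driving T lam).
Proof.
  intros [hT hn]. apply ccont_iff_eps. intros s eps he.
  set (t0 := clamp 0 T s). assert (ht0 : 0 <= t0 <= T) by (apply clamp_in; lra).
  destruct (hn t0 ht0) as [r [M [Lam [Lam' hl]]]].
  assert (hr : 0 < r) by apply hl. assert (hM : 0 <= M) by apply hl.
  set (K := M * (1 + 2 * r)). assert (hK : 0 <= K) by (unfold K; nra).
  exists (Rmin r (eps / (K + 1))). split.
  { apply Rmin_pos; auto. apply Rdiv_lt_0_compat; lra. }
  intros u hu. pose proof (clamp_lip 0 T s u) as hcl.
  pose_Rmin r (eps / (K + 1)).
  assert (hu0 : 0 <= clamp 0 T u <= T) by (apply clamp_in; lra).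
  unfold driving. fold t0. fold t0 in hcl.
  assert (E : Cmod (RtoC (clamp 0 T u) - RtoC t0)%C = Rabs (clamp 0 T u - t0)).
  { now rewrite <- RtoC_minus, Cmod_R. }
  assert (h3 := proj1 (proj2 (proj2 hl))).
  rewrite <- !h3; auto; try lra.
  2:{ rewrite Rminus_diag, Rabs_R0; lra. }
  eapply Rle_lt_trans; [apply (local_ext_lip T lam t0 r M Lam Lam'); auto|].
  - rewrite E; lra.
  - replace (RtoC t0 - RtoC t0)%C with (RtoC 0) by ring. rewrite Cmod_0; lra.
  - fold K. rewrite E.
    apply Rle_lt_trans with (K * Rabs (u - s)); [apply Rmult_le_compat_l; auto|].
    assert ((K + 1) * Rabs (u - s) < eps).
    { apply mul_lt_of_lt_div; lra. }
    pose proof (Rabs_pos (u - s)). lra.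
Qed.

Lemma rdriving_cont T lam t : extendable T lam -> ccont (rdriving T lam t).
Proof. intros H. apply (ccont_comp (driving T lam) (fun s => t - s)); [now apply driving_cont|]. intros; apply rev_lip. Qed.

(** The line A - z s covers reversed real time, with z = 1 and A = t, as well as rescaled complex
    time, with z = zeta and A = t0 + x. *)
Lemma local_ext_cderive T lam t0 r M Lam Lam' (A z : C) s :
  local_ext T lam t0 r M Lam Lam' -> Cmod (A - z * RtoC s - RtoC t0)%C < r ->
  cderive (fun u => Lam (A - z * RtoC u)%C) s (- (z * Lam' (A - z * RtoC s)))%C.
Proof.
  intros [hr [hM [_ [h2 [h3 _]]]]] hs.
  pose proof (Cmod_ge_0 z) as hz.
  set (d := (r - Cmod (A - z * RtoC s - RtoC t0)%C) / (Cmod z + 1)).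
  assert (hd : 0 < d) by (apply Rdiv_lt_0_compat; lra).
  apply (cderive_of_quadratic _ _ _ (M * (Cmod z * Cmod z)) d); auto; [nra|].
  intros u hu.
  assert (E : Cmod ((A - z * RtoC u) - (A - z * RtoC s))%C = Cmod z * Rabs (u - s)).
  { replace ((A - z * RtoC u) - (A - z * RtoC s))%C with (- (z * RtoC (u - s)))%C
      by (rewrite RtoC_minus; ring).
    now rewrite Cmod_opp, Cmod_mult, Cmod_R. }
  replace (Lam (A - z * RtoC u) - Lam (A - z * RtoC s) -
     RtoC (u - s) * - (z * Lam' (A - z * RtoC s)))%C
    with (Lam (A - z * RtoC u) - Lam (A - z * RtoC s) -
      Lam' (A - z * RtoC s) * ((A - z * RtoC u) - (A - z * RtoC s)))%C
    by (rewrite RtoC_minus; ring).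
  eapply Rle_trans; [apply h2|].
  - replace (A - z * RtoC u - RtoC t0)%C
      with ((A - z * RtoC u - (A - z * RtoC s)) + (A - z * RtoC s - RtoC t0))%C by ring.
    eapply Rle_trans; [apply Cmod_triangle|]. rewrite E.
    assert ((Cmod z + 1) * Rabs (u - s) <= r - Cmod (A - z * RtoC s - RtoC t0)%C).
    { apply Rle_trans with ((Cmod z + 1) * d); [apply Rmult_le_compat_l; lra|].
      unfold d. right; field; lra. }
    pose proof (Rabs_pos (u - s)). lra.
  - lra.
  - rewrite E. right. replace ((u - s) * (u - s)) with (Rabs (u - s) * Rabs (u - s)).
    + ring.
    + rewrite <- Rabs_mult. apply Rabs_right. apply Rle_ge, (Rle_0_sqr (u - s)).
Qed.

Lemma rdriving_cderive T lam t0 t r M Lam Lam' s : local_ext T lam t0 r M Lam Lam' ->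
  0 < s < t -> t <= T -> Rabs (t - s - t0) < r ->
  exists m, cderive (rdriving T lam t) s m /\ Cmod m <= M.
Proof.
  intros hl hs ht hr.
  exists (- (RtoC 1 * Lam' (RtoC t - RtoC 1 * RtoC s)))%C.
  assert (E : forall u, (RtoC t - RtoC 1 * RtoC u)%C = RtoC (t - u)).
  { intros u. rewrite RtoC_minus. ring. }
  assert (E' : forall u, Cmod (RtoC t - RtoC 1 * RtoC u - RtoC t0)%C = Rabs (t - u - t0)).
  { intros u. now rewrite E, <- RtoC_minus, Cmod_R. }
  split.
  - set (q := r - Rabs (t - s - t0)). set (d := Rmin s (Rmin (t - s) q)).
    assert (hd : 0 < d) by (repeat apply Rmin_pos; unfold q; lra).
    apply (cderive_ext_loc (fun u => Lam (RtoC t - RtoC 1 * RtoC u)%C) _ s _ d); auto.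
    + intros u hu. rewrite E. unfold rdriving.
      pose_Rmin s (Rmin (t - s) q).
      pose_Rmin (t - s) q. fold d in H, H0.
      assert (Rabs (t - u - t0) <= r).
      { replace (t - u - t0) with (- (u - s) + (t - s - t0)) by ring.
        eapply Rle_trans; [apply Rabs_triang|]. rewrite Rabs_Ropp. unfold q in *. lra. }
      apply Rabs_lt_between in hu. rewrite driving_eq by lra.
      apply (proj1 (proj2 (proj2 hl))); lra.
    + apply (local_ext_cderive T lam t0 r M); auto. now rewrite E'.
  - rewrite Cmod_opp, Cmod_mult, Cmod_1, Rmult_1_l.
    apply hl. rewrite E'; lra.
Qed.

(** Positivity starts only after s = 0, so trajectories that leave the driving point itself are
    covered too. *)
Definition rev_traj (T : R) (lam : R -> R) (t : R) (h : R -> C) : Prop :=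
  sol (RtoC (-2)) (rdriving T lam t) 0 t h /\ forall s, 0 < s <= t -> 0 < Im (h s).

Definition tip_traj (T : R) (lam : R -> R) (t : R) (h : R -> C) : Prop :=
  rev_traj T lam t h /\ h 0 = RtoC (lam t).

Lemma rev_exists T lam t w : extendable T lam -> 0 <= t -> 0 < Im w ->
  exists h, rev_traj T lam t h /\ h 0 = w /\ forall s, 0 <= s <= t -> Im w <= Im (h s).
Proof.
  intros hn ht hw.
  destruct (reverse_flow (rdriving T lam t) 0 t w ht (rdriving_cont T lam t hn) (fun s => eq_refl) hw)
    as [h [h1 [h2 h3]]].
  exists h. split; [|auto]. split; auto. intros s hs. specialize (h3 s ltac:(lra)). lra.
Qed.

Lemma rev_mono T lam t h a b : rev_traj T lam t h -> 0 <= a -> a <= b -> b <= t -> Im (h a) <= Im (h b).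
Proof.
  intros [h1 h2] ha hab hb.
  apply (im_mono 2 (rdriving T lam t)); auto; [lra| |].
  - apply (sol_sub _ _ 0 t); auto.
  - intros s hs. apply h2; lra.
Qed.

Lemma rev_compare T lam t c a b h1 h2 : 0 <= a -> a <= b -> b <= t -> 0 < c ->
  rev_traj T lam t h1 -> rev_traj T lam t h2 -> c <= Im (h1 a) -> c <= Im (h2 a) ->
  Cmod (h1 b - h2 b)%C <= exp (2 * / (c * c) * (b - a)) * Cmod (h1 a - h2 a)%C.
Proof.
  intros ha hab hb hc r1 r2 c1 c2.
  replace 2 with (Cmod (RtoC (-2))) at 1 by (rewrite Cmod_R, Rabs_left; lra).
  apply (compare (RtoC (-2)) (rdriving T lam t)); auto.
  - apply (sol_sub _ _ 0 t); auto. apply r1.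
  - apply (sol_sub _ _ 0 t); auto. apply r2.
  - intros s hs. rewrite Im_minus, rdriving_im.
    pose proof (rev_mono T lam t h1 a s r1 ltac:(lra) ltac:(lra) ltac:(lra)). lra.
  - intros s hs. rewrite Im_minus, rdriving_im.
    pose proof (rev_mono T lam t h2 a s r2 ltac:(lra) ltac:(lra) ltac:(lra)). lra.
Qed.

Lemma sol_tipsol T lam t M S h : extendable T lam ->
  (forall s, 0 < s < S -> exists m, cderive (rdriving T lam t) s m /\ Cmod m <= M) -> S <= t ->
  rev_traj T lam t h -> tipsol (RtoC 1) (rdriving T lam t) M S h.
Proof.
  intros hn hM hSt [[hc hd] hp]. split; [auto|split; [now apply rdriving_cont|]].
  intros s hs. split; [|split].
  - replace (- (RtoC 2 * RtoC 1))%C with (RtoC (-2)); [apply hd; lra|].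
    rewrite <- RtoC_mult, <- RtoC_opp. f_equal. ring.
  - auto.
  - rewrite Im_minus, rdriving_im. specialize (hp s ltac:(lra)). lra.
Qed.

Lemma zeta_ok_1 : zeta_ok (RtoC 1).
Proof. unfold zeta_ok. unfold Re, Im; simpl. rewrite Rabs_R0. lra. Qed.

(** One scale S serves all reverse trajectories of time t: the smallness condition of the cone
    argument then holds for every starting height y with y^2 <= S. *)
Lemma tip_scale T lam t : extendable T lam -> 0 < t <= T ->
  exists S M, 0 < S <= t /\ 0 <= M /\ 192 * (M * M) * (S + 8 * S) <= 1 /\
  forall h, rev_traj T lam t h -> tipsol (RtoC 1) (rdriving T lam t) M S h.
Proof.
  intros hn ht. destruct (proj2 hn t ltac:(lra)) as [r [M [Lam [Lam' hl]]]].
  assert (hr : 0 < r) by apply hl. assert (hM : 0 <= M) by apply hl.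
  (* Starting heights satisfy y^2 <= S, so the condition involves S + 8 S, and 1728 = 9 * 192. *)
  set (S := Rmin t (Rmin r (/ (1728 * (M * M + 1))))).
  assert (hq : 0 < 1728 * (M * M + 1)) by nra.
  assert (hS : 0 < S).
  { repeat apply Rmin_pos; try lra. apply Rinv_0_lt_compat; auto. }
  assert (S <= t) by apply Rmin_l.
  assert (S <= Rmin r (/ (1728 * (M * M + 1)))) by apply Rmin_r.
  pose_Rmin r (/ (1728 * (M * M + 1))).
  exists S, M. split; [lra|]. split; [auto|]. split.
  - assert (1728 * (M * M + 1) * S <= 1).
    { apply mul_le_one; lra. }
    nra.
  - intros h hh. apply sol_tipsol; auto. intros s hs.
    apply (rdriving_cderive T lam t t r M Lam Lam'); auto; try lra.
    rewrite Rabs_left; lra.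
Qed.

(** Up to the scale S, contraction applies with both starting heights equal to 0 and leaves no
    difference. After S both trajectories are at positive height, where the equation is
    Lipschitz. *)
Lemma tip_unique T lam t h1 h2 : extendable T lam -> 0 < t <= T ->
  tip_traj T lam t h1 -> tip_traj T lam t h2 -> forall s, 0 <= s <= t -> h1 s = h2 s.
Proof.
  intros hn ht [r1 i1] [r2 i2].
  destruct (tip_scale T lam t hn ht) as [S [M [hS [hM [hsm hts]]]]].
  assert (D0 : rdriving T lam t 0 = RtoC (lam t)).
  { unfold rdriving. rewrite Rminus_0_r. apply driving_eq; lra. }
  assert (small : forall s, 0 <= s <= S -> h1 s = h2 s).
  { intros s hs. apply Cmod_small_eq. intros eps he.
    assert (Cmod (h1 s - h2 s)%C <= Rabs (0 - 0)); [|rewrite Rminus_0_r, Rabs_R0 in H; lra].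
    assert (192 * (M * M) * (0 * 0 + 8 * s) <= 1) by (assert (0 <= M * M) by nra; nra).
    apply (tip_contract (RtoC 1) (rdriving T lam t) M s); try lra; try apply zeta_ok_1.
    - apply (tipsol_sub _ _ _ S); [lra|auto].
    - rewrite i1, D0. rewrite Cminus_diag. reflexivity.
    - apply (tipsol_sub _ _ _ S); [lra|auto].
    - rewrite i2, D0. rewrite Cminus_diag. reflexivity. }
  intros s hs. destruct (Rle_or_lt s S) as [h|h]; [apply small; lra|].
  pose proof (proj2 r1 S ltac:(lra)) as p1. pose proof (proj2 r2 S ltac:(lra)) as p2.
  apply Cmod_small_eq. intros eps he.
  pose proof (rev_compare T lam t (Rmin (Im (h1 S)) (Im (h2 S))) S s h1 h2 ltac:(lra) ltac:(lra)
    ltac:(lra) ltac:(apply Rmin_pos; auto) r1 r2 ltac:(apply Rmin_l) ltac:(apply Rmin_r)) as H.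
  rewrite (small S) in H by lra. rewrite Cminus_diag, Cmod_0 in H. lra.
Qed.

Lemma sqrt_le_of_sq c y : 0 <= y -> c <= y * y -> sqrt c <= y.
Proof. intros. rewrite <- (sqrt_square y) by auto. now apply sqrt_le_1_alt. Qed.

(* The tip trajectory is the uniform limit of the reverse trajectories started at lam t + i y, y -> 0. *)
Lemma tip_exists T lam t : extendable T lam -> 0 < t <= T ->
  exists h, tip_traj T lam t h /\ forall eps, 0 < eps -> exists k,
    rev_traj T lam t k /\ 0 < Im (k 0) /\ Cmod (k t - h t)%C < eps.
Proof.
  intros hn ht.
  destruct (tip_scale T lam t hn ht) as [S [M [hS [hM [hsm hts]]]]].
  assert (D0 : rdriving T lam t 0 = RtoC (lam t)).
  { unfold rdriving. rewrite Rminus_0_r. apply driving_eq; lra. }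
  (* Heights below min (1, S) satisfy y^2 <= y <= S, as the scale requires. *)
  set (Y := Rmin 1 S). assert (hY : 0 < Y) by (apply Rmin_pos; lra).
  assert (hYS : Y <= S) by apply Rmin_r. assert (hY1 : Y <= 1) by apply Rmin_l.
  set (y := fun n : nat => Y * (/ 2) ^ n).
  assert (hp2 : forall n : nat, 0 < (/ 2) ^ n <= 1).
  { intros n. split; [apply pow_lt; lra|]. rewrite <- (pow1 n). apply pow_incr; lra. }
  assert (hy : forall n, 0 < y n <= Y) by (intros n; unfold y; specialize (hp2 n); nra).
  assert (ex : forall n, exists h, rev_traj T lam t h /\ h 0 = (lam t, y n)).
  { intros n. destruct (rev_exists T lam t (lam t, y n) hn ltac:(lra)) as [h [h1 [h2 _]]].
    - apply hy.
    - eauto. }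
  destruct (fun_choice _ ex) as [hh Hh]. clear ex.
  assert (hX0 : forall n, (hh n 0%R - rdriving T lam t 0)%C = (0, y n)).
  { intros n. rewrite (proj2 (Hh n)), D0. unfold Cminus, Cplus, Copp; simpl. f_equal; ring. }
  assert (hsm' : forall n s, 0 <= s <= S -> 192 * (M * M) * (y n * y n + 8 * s) <= 1).
  { intros n s hs. specialize (hy n). assert (0 <= M * M) by nra.
    assert (y n * y n <= S) by nra. nra. }
  (* A bound independent of n, from (Im X)^2 >= y^2 + (5/2) s; it keeps the limit off the real line
     for s > 0. *)
  assert (im_low : forall n s, 0 < s <= S -> sqrt s <= Im (hh n s)).
  { intros n s hs. pose proof (proj2 (proj1 (Hh n)) s ltac:(lra)) as hpos.
    destruct (tip_cone (RtoC 1) (rdriving T lam t) M s (hh n) (y n)) as [h1 h2]; try lra; auto.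
    - apply zeta_ok_1.
    - specialize (hy n); lra.
    - apply hsm'; lra.
    - apply (tipsol_sub _ _ _ S); [lra|apply hts, Hh].
    - rewrite Im_minus, rdriving_im, Rminus_0_r in h1.
      apply sqrt_le_of_sq; [lra|].
      set (x := Re (hh n s - rdriving T lam t s)%C) in *. specialize (hy n). nra. }
  set (E := exp (2 * / (sqrt S * sqrt S) * t)).
  assert (hsS : 0 < sqrt S) by (apply sqrt_lt_R0; lra).
  assert (hE : 1 <= E).
  { unfold E. rewrite <- exp_0. assert (0 < 2 * / (sqrt S * sqrt S) * t).
    { apply Rmult_lt_0_compat; [|lra]. assert (0 < / (sqrt S * sqrt S)).
      { apply Rinv_0_lt_compat; nra. } lra. }
    apply exp_le_compat; lra. }
  assert (cau : forall n m s, (n <= m)%nat -> 0 <= s <= t ->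
     Cmod (hh m s - hh n s)%C <= E * y n).
  { intros n m s hnm.
    assert (hyy : Rabs (y m - y n) <= y n).
    { assert (y m <= y n).
      { unfold y. replace m with (n + (m - n))%nat by lia. rewrite pow_add.
        pose proof (hp2 (m - n)%nat). pose proof (hp2 n). apply Rmult_le_compat_l; nra. }
      pose proof (hy m). rewrite Rabs_left1; lra. }
    assert (sm : forall s, 0 <= s <= S -> Cmod (hh m s - hh n s)%C <= y n).
    { intros u hu. eapply Rle_trans; [|exact hyy].
      apply (tip_contract (RtoC 1) (rdriving T lam t) M u); auto; try lra;
        try (apply zeta_ok_1); try (apply Rlt_le, hy);
        try (apply (tipsol_sub _ _ _ S); [lra|apply hts, Hh]). }
    intros hs. destruct (Rle_or_lt s S).
    - specialize (sm s ltac:(lra)). specialize (hy n). nra.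
    - pose proof (rev_compare T lam t (sqrt S) S s (hh m) (hh n) ltac:(lra) ltac:(lra) ltac:(lra)
        hsS (proj1 (Hh m)) (proj1 (Hh n)) (im_low m S ltac:(lra)) (im_low n S ltac:(lra))) as C1.
      specialize (sm S ltac:(lra)).
      eapply Rle_trans; [exact C1|].
      apply Rmult_le_compat; auto using Cmod_ge_0; [apply Rlt_le, exp_pos|].
      unfold E. assert (0 < / (sqrt S * sqrt S)) by (apply Rinv_0_lt_compat; nra).
      apply exp_le_compat. nra. }
  assert (lim : forall s, exists l, forall n, Cmod (hh n (clamp 0 t s) - l)%C <= E * y n).
  { intros s. apply C_complete.
    - intros k m hkm. apply cau; auto. apply clamp_in; lra.
    - intros eps he. destruct (pow_half_lt (E * Y) eps he) as [k hk]. exists k.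
      unfold y. lra. }
  destruct (fun_choice _ lim) as [h hlim]. clear lim.
  assert (hlim' : forall n s, 0 <= s <= t -> Cmod (hh n s - h s)%C <= E * y n).
  { intros n s hs. pose proof (hlim s n) as H. rewrite clamp_id in H; auto. }
  assert (small : forall eps, 0 < eps -> exists n, E * y n < eps).
  { intros eps he. destruct (pow_half_lt (E * Y) eps he) as [k hk]. exists k. unfold y. lra. }
  assert (hc : ccont h).
  { apply ccont_iff_eps. intros s eps he. destruct (small (eps / 3)) as [n hn']; [lra|].
    destruct (proj1 (ccont_iff_eps _) (proj1 (proj1 (proj1 (Hh n)))) (clamp 0 t s) (eps / 3))
      as [d [hd hd']]; [lra|].
    exists d; split; auto. intros u hu.
    specialize (hd' (clamp 0 t u)). pose proof (clamp_lip 0 t s u). specialize (hd' ltac:(lra)).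
    pose proof (hlim u n). pose proof (hlim s n).
    eapply Rle_lt_trans; [apply (Cmod_tri3 _ (hh n (clamp 0 t u)))|].
    rewrite (Cmod_minus_sym (h u)).
    pose proof (Cmod_tri3 (hh n (clamp 0 t u)) (hh n (clamp 0 t s)) (h s)). lra. }
  assert (im_lim : forall s c, 0 <= s <= t -> (forall n, c <= Im (hh n s)) -> c <= Im (h s)).
  { intros s c hs H. apply le_epsilon. intros eps he. destruct (small eps he) as [n hn'].
    specialize (H n). specialize (hlim' n s hs).
    pose proof (im_le_mod (hh n s - h s)%C) as I. rewrite Im_minus in I. lra. }
  assert (hpos : forall s, 0 < s <= t -> exists c, 0 < c /\ c <= Im (h s) /\ forall n, c <= Im (hh n s)).
  { intros s hs. exists (sqrt (Rmin s S)).
    assert (hm : 0 < Rmin s S) by (apply Rmin_pos; lra).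
    assert (B1 : forall n, sqrt (Rmin s S) <= Im (hh n s)).
    { intros n. eapply Rle_trans; [apply (im_low n)|].
      - split; auto. apply Rmin_r.
      - pose proof (Rmin_l s S). apply (rev_mono T lam t (hh n)); try lra. apply Hh. }
    split; [now apply sqrt_lt_R0|]. split; auto. apply im_lim; auto. lra. }
  exists h. split.
  - split; [split; [split; auto|]|].
    (* To obtain the equation at s, the regular flow is restarted at time s / 2 from the limit
       point. The approximating trajectories converge to this flow as well, so it coincides with [h]
       near s. *)
    + intros s hs. set (a := s / 2).
      destruct (hpos a) as [c [c0 [c1 c2]]]; [unfold a; lra|].
      destruct (reverse_flow (rdriving T lam t) a t (h a)) as [k [k1 [k2 k3]]];
        [unfold a; lra|now apply rdriving_cont|reflexivity|lra|].
      assert (keq : forall u, a <= u <= t -> k u = h u).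
      { intros u hu. apply Cmod_small_eq. intros eps he.
        set (E' := exp (Cmod (RtoC (-2)) * / (c * c) * (u - a))).
        assert (hE' : 0 < E') by apply exp_pos.
        destruct (small (eps / (E' + 1))) as [n hn']; [apply Rdiv_lt_0_compat; lra|].
        assert (C1 : Cmod (k u - hh n u)%C <= E' * Cmod (k a - hh n a)%C).
        { apply (compare (RtoC (-2)) (rdriving T lam t)); auto; try lra.
          - apply (sol_sub _ _ a t); auto; lra.
          - apply (sol_sub _ _ 0 t); try (unfold a; lra). apply Hh.
          - intros v hv. rewrite Im_minus, rdriving_im. specialize (k3 v ltac:(lra)). lra.
          - intros v hv. rewrite Im_minus, rdriving_im. specialize (c2 n).
            pose proof (rev_mono T lam t (hh n) a v (proj1 (Hh n)) ltac:(unfold a; lra)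
              ltac:(lra) ltac:(lra)). lra. }
        rewrite k2, (Cmod_minus_sym (h a)) in C1.
        pose proof (hlim' n a ltac:(unfold a; lra)). pose proof (hlim' n u ltac:(unfold a in *; lra)).
        pose proof (Cmod_tri3 (k u) (hh n u) (h u)).
        assert ((E' + 1) * (E * y n) <= eps).
        { apply mul_le_of_le_div; lra. }
        nra. }
      rewrite <- keq by (unfold a; lra).
      apply (cderive_ext_loc k h s _ (Rmin a (t - s))).
      * apply Rmin_pos; unfold a; lra.
      * intros u hu. apply keq. pose_Rmin a (t - s).
        apply Rabs_lt_between in hu. unfold a in *; lra.
      * apply k1. unfold a; lra.
    + intros s hs. destruct (hpos s hs) as [c [c0 [c1 _]]]. lra.
    + symmetry. apply Cmod_small_eq. intros eps he. destruct (small (eps / 2)) as [n hn']; [lra|].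
      specialize (hlim' n 0 ltac:(lra)). rewrite (proj2 (Hh n)) in hlim'.
      eapply Rle_trans; [apply (Cmod_tri3 _ (lam t, y n))|].
      assert (Cmod (RtoC (lam t) - (lam t, y n))%C <= E * y n).
      { eapply Rle_trans; [apply Cmod_le_abs|].
        unfold Re, Im; simpl. replace (lam t + - lam t) with 0 by ring.
        replace (0 + - y n) with (- y n) by ring.
        specialize (hy n). rewrite Rabs_R0, Rabs_Ropp, Rabs_right by lra. nra. }
      lra.
  - intros eps he. destruct (small eps he) as [n hn']. exists (hh n).
    split; [apply Hh|]. split.
    + rewrite (proj2 (Hh n)). apply hy.
    + specialize (hlim' n t ltac:(lra)). lra.
Qed.

(** * Forward trajectories and the hull *)

Lemma sol_ext kappa l l' a b h h' : (forall s, l s = l' s) -> (forall s, h s = h' s) ->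
  sol kappa l a b h -> sol kappa l' a b h'.
Proof.
  intros El Eh [[hc1 hc2] hd]. split; [split|].
  - intros s. apply (continuous_ext (fun u => Re (h u))); auto. intros; now rewrite Eh.
  - intros s. apply (continuous_ext (fun u => Im (h u))); auto. intros; now rewrite Eh.
  - intros s hs. rewrite <- El, <- Eh.
    apply (cderive_ext_loc h h' s _ 1); auto. lra.
Qed.

Definition fwd_traj (T : R) (lam : R -> R) (r : R) (g : R -> C) : Prop :=
  sol (RtoC 2) (driving T lam) 0 r g /\ forall s, 0 <= s < r -> 0 < Im (g s).

Lemma rev_fwd T lam t h : 0 <= t -> rev_traj T lam t h -> fwd_traj T lam t (fun s => h (t - s)).
Proof.
  intros ht [h1 h2]. split.
  - apply (sol_rev _ _ _ _ t) in h1. rewrite Rminus_diag, Rminus_0_r in h1.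
    replace (- RtoC (-2))%C with (RtoC 2) in h1 by (rewrite <- RtoC_opp; f_equal; ring).
    apply (sol_ext _ _ (driving T lam) _ _ _ _) with (3 := h1); auto.
    intros s. unfold rdriving. f_equal. ring.
  - intros s hs. apply h2; lra.
Qed.

Lemma fwd_rev T lam t g : fwd_traj T lam t g -> rev_traj T lam t (fun s => g (t - s)).
Proof.
  intros [h1 h2]. split.
  - apply (sol_rev _ _ _ _ t) in h1. rewrite Rminus_diag, Rminus_0_r in h1.
    replace (- RtoC 2)%C with (RtoC (-2)) in h1 by (rewrite <- RtoC_opp; f_equal; ring).
    exact h1.
  - intros s hs. apply h2; lra.
Qed.

Lemma fwd_sub T lam r r' g : r' <= r -> fwd_traj T lam r g -> fwd_traj T lam r' g.
Proof.
  intros h [h1 h2]. split; [|intros s hs; apply h2; lra].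
  apply (sol_sub _ _ 0 r); auto; lra.
Qed.

Lemma fwd_anti T lam r g a b : fwd_traj T lam r g -> 0 <= a -> a <= b -> b <= r -> Im (g b) <= Im (g a).
Proof.
  intros [h1 h2] ha hab hb. apply (im_anti 2 (driving T lam)); auto; [lra| |].
  - apply (sol_sub _ _ 0 r); auto.
  - intros s hs. apply h2; lra.
Qed.

Lemma ccont_vanish (D : R -> C) r : 0 < r -> ccont D -> (forall s, 0 <= s < r -> D s = 0%C) -> D r = 0%C.
Proof.
  intros hr hc H. apply Cmod_small_eq. intros eps he.
  destruct (proj1 (ccont_iff_eps _) hc r eps he) as [d [hd hd']].
  set (s := Rmax 0 (r - d / 2)).
  assert (hs : 0 <= s < r) by (split; [apply Rmax_l|apply Rmax_lub_lt; lra]).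
  pose proof (Rmax_r 0 (r - d / 2)). fold s in H0.
  specialize (hd' s). rewrite H in hd' by auto.
  rewrite Cmod_minus_sym in hd'. apply Rlt_le, hd'. rewrite Rabs_left; lra.
Qed.

(** Heights decrease, so before time r both trajectories are bounded below by their heights at s.
    Time r itself, where the real line may be reached, is added by continuity. *)
Lemma fwd_unique T lam r g1 g2 : fwd_traj T lam r g1 -> fwd_traj T lam r g2 -> g1 0 = g2 0 ->
  forall s, 0 <= s <= r -> g1 s = g2 s.
Proof.
  intros f1 f2 h0.
  assert (K : forall s, 0 <= s < r -> g1 s = g2 s).
  { intros s hs. apply Cmod_small_eq. intros eps he.
    set (c := Rmin (Im (g1 s)) (Im (g2 s))).
    assert (hc : 0 < c) by (apply Rmin_pos; [apply f1|apply f2]; lra).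
    pose_Rmin (Im (g1 s)) (Im (g2 s)).
    fold c in H, H0.
    pose proof (compare (RtoC 2) (driving T lam) c 0 s g1 g2 ltac:(lra) hc) as C1.
    rewrite h0 in C1. rewrite Cminus_diag, Cmod_0, Rmult_0_r in C1.
    enough (Cmod (g1 s - g2 s)%C <= 0) by lra. apply C1.
    - apply (sol_sub _ _ 0 r); try lra. apply f1.
    - apply (sol_sub _ _ 0 r); try lra. apply f2.
    - intros u hu. rewrite Im_minus, driving_im.
      pose proof (fwd_anti T lam r g1 u s f1 ltac:(lra) ltac:(lra) ltac:(lra)). lra.
    - intros u hu. rewrite Im_minus, driving_im.
      pose proof (fwd_anti T lam r g2 u s f2 ltac:(lra) ltac:(lra) ltac:(lra)). lra. }
  intros s hs. destruct (Rle_lt_or_eq_dec s r) as [h| ->]; [lra|apply K; lra|].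
  destruct (Rle_lt_or_eq_dec 0 r) as [h|h]; [lra| |rewrite <- h; auto].
  assert (E : (g1 r - g2 r)%C = 0%C).
  { apply (ccont_vanish (fun s => g1 s - g2 s)%C); auto.
    - apply ccont_sub; [apply f1|apply f2].
    - intros u hu. rewrite K by auto. ring. }
  replace (g1 r) with ((g1 r - g2 r) + g2 r)%C by ring. rewrite E. ring.
Qed.

(** Reverse trajectories for different times with the same end follow the same forward trajectory
    from that end. *)
Lemma rev_unique T lam t1 t2 h1 h2 : 0 <= t1 <= t2 -> rev_traj T lam t1 h1 -> rev_traj T lam t2 h2 ->
  h1 t1 = h2 t2 -> forall r, 0 <= r <= t1 -> h1 (t1 - r) = h2 (t2 - r).
Proof.
  intros ht r1 r2 E r hr.
  apply (fwd_unique T lam t1 (fun s => h1 (t1 - s)) (fun s => h2 (t2 - s))); auto.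
  - apply rev_fwd; auto; lra.
  - apply (fwd_sub _ _ t2); [lra|]. apply rev_fwd; auto; lra.
  - now rewrite !Rminus_0_r.
Qed.

(** The equation for Im h is linear, with coefficient -k / |X|^2. While |X| is bounded below, Im h
    can therefore change only by a bounded factor. *)
Lemma im_growth (k eta : R) l a b h : a <= b -> 0 < eta -> (forall s, Im (l s) = 0) ->
  sol (RtoC k) l a b h ->
  (forall s, a < s < b -> eta <= Cmod (h s - l s)%C * Cmod (h s - l s)%C) ->
  Rabs (Im (h b)) <= exp (Rabs k / eta * (b - a)) * Rabs (Im (h a)).
Proof.
  intros hab he hl [[hc1 hc2] hd] hX.
  rewrite <- !Cmod_R.
  apply (gronwall (fun s => RtoC (Im (h s)))); auto.
  - split; intros s; [exact (hc2 s)|apply cont_const].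
  - intros s hs. destruct (hd s hs) as [_ h2]. rewrite Im_real_div in h2.
    specialize (hX s hs). rewrite Cmod_sq in hX.
    set (n := Re (h s - l s)%C * Re (h s - l s)%C + Im (h s - l s)%C * Im (h s - l s)%C) in *.
    rewrite Im_minus, hl, Rminus_0_r in h2.
    exists (RtoC (- (k * (Im (h s) / n)))). split.
    + split; [exact h2|exact (derive_const 0 s)].
    + rewrite !Cmod_R. rewrite Rabs_Ropp, Rabs_mult. unfold Rdiv at 1.
      rewrite Rabs_mult, Rabs_inv, (Rabs_right n) by lra.
      assert (/ n <= / eta) by (apply Rinv_le_contravar; auto).
      pose proof (Rabs_pos k). pose proof (Rabs_pos (Im (h s))).
      unfold Rdiv. rewrite Rmult_assoc, (Rmult_comm (/ eta)), <- !Rmult_assoc.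
      apply Rmult_le_compat_l; [nra|auto].
Qed.

Lemma ccont_clamp (h : R -> C) a b : a <= b -> Ccont_on a b h -> ccont (fun s => h (clamp a b s)).
Proof.
  intros hab H. apply ccont_iff_eps. intros s eps he.
  destruct (H (clamp a b s) (clamp_in a b s hab) eps he) as [d [hd hd']].
  exists d. split; auto. intros u hu.
  apply (hd' (clamp a b u)); [now apply clamp_in|].
  eapply Rle_lt_trans; [apply clamp_lip|auto].
Qed.

Lemma ccont_Ccont_on (h : R -> C) a b : ccont h -> Ccont_on a b h.
Proof.
  intros H s hs eps he. destruct (proj1 (ccont_iff_eps _) H s eps he) as [d [hd hd']].
  exists d. split; auto. intros u hu hus. now apply (hd' u).
Qed.

Lemma loewner_rhs_eq (w : C) (l : R) : w <> (l, 0) ->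
  loewner_rhs w l = (RtoC 2 / (w - RtoC l))%C.
Proof.
  intros hw. destruct w as [x y]. unfold loewner_rhs, Cre, Cim, Cdiv, Cinv, Cminus, Cplus, Copp, Cmult, RtoC; simpl.
  replace (y + - 0) with y by ring. fold (x - l).
  assert ((x - l) * ((x - l) * 1) + y * (y * 1) <> 0).
  { intros E. apply hw. assert (x - l = 0) by nra. assert (y = 0) by nra. f_equal; lra. }
  f_equal; field; lra.
Qed.

(** A solution is only assumed to avoid [lam], so staying in the half-plane has to be derived: by
    compactness |X|^2 >= eta, and a zero of the imaginary part would propagate back to time 0 by
    [im_growth]. *)
Lemma solution_rev T lam t z : extendable T lam -> 0 <= t <= T -> inH z ->
  (exists h, loewner_solution lam t z h) ->
  exists k, rev_traj T lam t k /\ 0 < Im (k 0) /\ k t = z.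
Proof.
  intros hn ht hz [h [h0 [hc [hne hd]]]].
  set (g := fun s => h (clamp 0 t s)).
  assert (gc : ccont g) by (apply ccont_clamp; auto; lra).
  assert (geq : forall s, 0 <= s <= t -> g s = h s) by (intros s hs; unfold g; now rewrite clamp_id).
  assert (gs : sol (RtoC 2) (driving T lam) 0 t g).
  { split; auto. intros s hs. rewrite geq, driving_eq by lra.
    destruct (hd s hs) as [d1 d2]. rewrite loewner_rhs_eq in d1, d2 by (apply hne; lra).
    apply (cderive_ext_loc h g s _ (Rmin s (t - s))).
    - apply Rmin_pos; lra.
    - intros u hu. symmetry. apply geq. pose_Rmin s (t - s).
      apply Rabs_lt_between in hu. lra.
    - split; apply is_derive_Reals; auto. }
  assert (heta : exists eta, 0 < eta /\ forall s, 0 <= s <= t ->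
      eta <= Cmod (g s - driving T lam s)%C * Cmod (g s - driving T lam s)%C).
  { pose proof (ccont_sub _ _ gc (driving_cont T lam hn)) as Xc.
    destruct (continuity_ab_min (fun s => Re (g s - driving T lam s)%C * Re (g s - driving T lam s)%C +
      Im (g s - driving T lam s)%C * Im (g s - driving T lam s)%C) 0 t ltac:(lra)) as [m [hm1 hm2]].
    { intros c _. apply continuity_pt_filterlim. apply (normsq_cont _ c Xc). }
    exists (Cmod (g m - driving T lam m)%C * Cmod (g m - driving T lam m)%C). split.
    - assert (0 < Cmod (g m - driving T lam m)%C); [|nra]. apply Cmod_gt_0. intros E.
      apply (hne m hm2). rewrite <- geq by auto. rewrite driving_eq in E by lra.
      replace (g m) with ((g m - RtoC (lam m)) + RtoC (lam m))%C by ring. rewrite E, Cplus_0_l.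
      reflexivity.
    - intros s hs. rewrite !Cmod_sq. now apply hm1. }
  destruct heta as [eta [he heta]].
  assert (g0 : g 0 = z) by (rewrite geq by lra; auto).
  assert (hpos : forall s, 0 <= s <= t -> 0 < Im (g s)).
  { assert (nz : forall s, 0 <= s <= t -> Im (g s) <> 0).
    { intros s hs E.
      pose proof (sol_sub _ _ 0 t 0 s g ltac:(lra) ltac:(lra) gs) as gs'.
      apply (sol_rev _ _ _ _ s) in gs'. rewrite Rminus_diag, Rminus_0_r in gs'.
      replace (- RtoC 2)%C with (RtoC (-2)) in gs' by (rewrite <- RtoC_opp; f_equal; ring).
      pose proof (im_growth (-2) eta (fun u => driving T lam (s - u)) 0 s _ ltac:(lra) he
        (fun _ => eq_refl) gs') as G.
      cbv beta in G. rewrite Rminus_diag, Rminus_0_r, g0, E, Rabs_R0, Rmult_0_r in G.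
      unfold inH, Cim in hz.
      assert (Rabs (Im z) <= 0); [apply G|].
      - intros u hu. apply heta. lra.
      - pose proof (Rle_abs (Im z)). unfold Im in *. lra. }
    intros s hs. destruct (Rlt_or_le 0 (Im (g s))) as [|hle]; auto. exfalso.
    assert (h' : Im (g s) < 0) by (specialize (nz s hs); lra).
    destruct (first_exit (fun u => Im (g u)) 0 s 0 ltac:(lra) (proj2 gc)) as [u [hu [E _]]]; auto.
    - rewrite g0. apply Rlt_le, hz.
    - apply (nz u); auto. lra. }
  exists (fun s => g (t - s)). split; [apply fwd_rev; split; auto; intros; apply hpos; lra|].
  rewrite Rminus_0_r, Rminus_diag. split; auto. apply hpos; lra.
Qed.

Lemma rev_solution T lam t z k : 0 <= t <= T -> rev_traj T lam t k -> 0 < Im (k 0) -> k t = z ->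
  exists h, loewner_solution lam t z h.
Proof.
  intros ht hr h0 hz. exists (fun s => k (t - s)).
  pose proof (rev_fwd T lam t k ltac:(lra) hr) as [[gc gd] gp].
  split; [now rewrite Rminus_0_r|]. split; [now apply ccont_Ccont_on|].
  assert (hp : forall s, 0 <= s <= t -> 0 < Im (k (t - s))).
  { intros s hs. destruct (Rle_lt_or_eq_dec s t) as [h| ->]; [lra|apply gp; lra|].
    now rewrite Rminus_diag. }
  assert (hne : forall s, 0 <= s <= t -> k (t - s) <> (lam s, 0)).
  { intros s hs E. specialize (hp s hs). rewrite E in hp. simpl in hp. lra. }
  split; auto. intros s hs. rewrite loewner_rhs_eq by (apply hne; lra).
  rewrite <- (driving_eq T) by lra. specialize (gd s hs). destruct gd as [d1 d2].
  split; apply is_derive_Reals; auto.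
Qed.

(** If the forward trajectory of z does not survive to time t, its height tends to 0 at its lifetime
    R0. Since Im can vanish in finite time only if |X| does not stay bounded below, the trajectory
    collides with [lam] at R0; read backwards it is the tip trajectory of R0. *)
Lemma rev_or_tip T lam t z : extendable T lam -> 0 < t <= T -> inH z ->
  (exists k, rev_traj T lam t k /\ 0 < Im (k 0) /\ k t = z) \/
  (exists s k, 0 < s <= t /\ tip_traj T lam s k /\ k s = z).
Proof.
  intros hn ht hz. change (0 < Im z) in hz.
  destruct (classic (exists k, rev_traj T lam t k /\ 0 < Im (k 0) /\ k t = z)) as [|hno]; [now left|right].
  set (P := fun r g => 0 <= r <= t /\ fwd_traj T lam r g /\ g 0 = z /\ forall s, 0 <= s <= r -> 0 < Im (g s)).
  (* The flow truncated at height c is global. If it were still at height c or above at time t, it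
     would be a genuine trajectory surviving to t, which [hno] excludes. *)
  assert (exits : forall c, 0 < c <= Im z -> exists r g, P r g /\ Im (g r) = c).
  { intros c hc.
    destruct (trunc_flow (RtoC 2) (driving T lam) c 0 t z ltac:(lra) (proj1 hc) (driving_cont T lam hn))
      as [g [gc [g0 gd]]].
    assert (sub : forall r, 0 <= r <= t -> (forall s, 0 <= s <= r -> c <= Im (g s)) -> P r g).
    { intros r hr hge. split; auto. split; [|split; auto].
      - split; [split; auto|].
        + intros s hs. rewrite <- (trunc_id c (g s - driving T lam s)%C); [apply gd; lra|].
          rewrite Im_minus, driving_im. specialize (hge s ltac:(lra)). lra.
        + intros s hs. specialize (hge s ltac:(lra)). lra.
      - intros s hs. specialize (hge s hs). lra. }
    destruct (Rlt_or_le (Im (g t)) c) as [hlt|hge].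
    - destruct (first_exit (fun s => Im (g s)) 0 t c ltac:(lra) (proj2 gc)) as [r [hr [E hge]]]; auto.
      + rewrite g0; lra.
      + exists r, g. split; auto. apply sub; auto; lra.
    - exfalso. apply hno.
      assert (Pt : P t g).
      { apply sub; [lra|]. intros s hs. apply Rle_trans with (Im (g t)); auto.
        apply Ropp_le_cancel.
        apply (derive_nonneg_le (fun u => - Im (g u))); [lra| |].
        - intros u. apply cont_neg, gc.
        - intros u hu. destruct (gd u) as [_ h2]; [lra|].
          eexists; split; [apply derive_neg; exact h2|]. rewrite Im_real_div.
          pose proof (im_frac_pos (trunc c (g u - driving T lam u))).
          pose proof (trunc_im c (g u - driving T lam u)). lra. }
      destruct Pt as [_ [Pf [_ Pp]]].
      exists (fun s => g (t - s)). split; [now apply fwd_rev|].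
      rewrite Rminus_0_r, Rminus_diag. split; auto. apply Pp; lra. }
  assert (Psub : forall r g r', P r g -> 0 <= r' <= r -> P r' g).
  { intros r g r' [a1 [a2 [a3 a4]]] h. split; [lra|]. split; [apply (fwd_sub _ _ r); auto; lra|].
    split; auto. intros; apply a4; lra. }
  assert (uniq : forall r1 g1 r2 g2, P r1 g1 -> P r2 g2 ->
     forall s, 0 <= s <= r1 -> s <= r2 -> g1 s = g2 s).
  { intros r1 g1 r2 g2 [_ [f1 [i1 _]]] [_ [f2 [i2 _]]] s hs1 hs2.
    apply (fwd_unique T lam s); [| |congruence|lra].
    - apply (fwd_sub _ _ r1); auto; lra.
    - apply (fwd_sub _ _ r2); auto; lra. }
  destruct (completeness (fun r => exists g, P r g)) as [R0 [hR1 hR2]].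
  { exists t. intros r [g [hr _]]. lra. }
  { destruct (exits (Im z)) as [r [g [Hp _]]]; [lra|]. eauto. }
  assert (below : forall r, 0 <= r < R0 -> exists r' g, P r' g /\ r < r').
  { intros r hr. apply NNPP. intros hcon.
    assert (R0 <= r); [|lra]. apply hR2. intros r' [g hg].
    destruct (Rle_or_lt r' r); auto. exfalso. apply hcon. eauto. }
  (* Every lower height is attained later, and strictly before R0, because the height c / 2 is
     attained later still. *)
  assert (height : forall r g c, P r g -> 0 < c < Im (g r) -> exists r' g', P r' g' /\ r < r' < R0 /\ Im (g' r') = c).
  { intros r g c Hp hc.
    assert (hcz : Im (g r) <= Im z).
    { destruct Hp as [hr [f [i _]]]. rewrite <- i. apply (fwd_anti T lam r g); auto; lra. }
    destruct (exits c) as [r1 [g1 [P1 E1]]]; [lra|].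
    destruct (exits (c / 2)) as [r2 [g2 [P2 E2]]]; [lra|].
    assert (gt : forall ra ga rb gb, P ra ga -> P rb gb -> Im (gb rb) < Im (ga ra) -> ra < rb).
    { intros ra ga rb gb Pa Pb hlt. destruct (Rlt_or_le ra rb); auto. exfalso.
      assert (hb : 0 <= rb) by apply Pb.
      rewrite <- (uniq ra ga rb gb Pa Pb rb) in hlt by lra.
      pose proof (fwd_anti T lam ra ga rb ra (proj1 (proj2 Pa)) ltac:(lra) ltac:(lra) ltac:(lra)). lra. }
    exists r1, g1. split; auto. split; auto. split.
    - apply (gt r g r1 g1); auto. lra.
    - apply Rlt_le_trans with r2; [apply (gt r1 g1 r2 g2); auto; lra|]. apply hR1; eauto. }
  assert (hR0t : R0 <= t) by (apply hR2; intros r [g [hr _]]; lra).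
  assert (hR0 : 0 < R0).
  { destruct (exits (Im z)) as [r [g [Hp E]]]; [lra|].
    destruct (height r g (Im z / 2) Hp) as [r' [g' [P' [h' _]]]]; [lra|]. destruct Hp. lra. }
  assert (chs : forall r, exists w, 0 <= r < R0 -> forall r' g, P r' g -> r <= r' -> w = g r).
  { intros r. destruct (classic (0 <= r < R0)) as [hr|hr]; [|exists 0%C; tauto].
    destruct (below r hr) as [r1 [g1 [P1 h1]]]. exists (g1 r). intros _ r2 g2 P2 h2.
    apply (uniq r1 g1 r2 g2); auto; lra. }
  destruct (fun_choice _ chs) as [phi hphi]. clear chs.
  assert (lim0 : forall eps, 0 < eps -> exists d, 0 < d /\ forall r, 0 <= r < R0 -> R0 - d < r ->
     Cmod (phi r - driving T lam r)%C < eps).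
  { intros eps he.
    destruct (proj2 hn R0 ltac:(lra)) as [rho [M [Lam [Lam' hl]]]].
    assert (hrho : 0 < rho) by apply hl. assert (hM : 0 <= M) by apply hl.
    (* For r' - r <= d, [tip_size] run back from r' to r gives eps^2 <= 3 |X(r')|^2 + 24 d <= 3
       |X(r')|^2 + eps^2 / 2, hence eta = eps^2 / 6. The bound 1 / (M^2 + 1) keeps the exponential
       below 3. *)
    set (d := Rmin rho (Rmin (/ (M * M + 1)) (eps * eps / 48))).
    assert (hd : 0 < d).
    { repeat apply Rmin_pos; auto; [apply Rinv_0_lt_compat; nra|]. nra. }
    exists d. split; auto. intros r hr hrd.
    destruct (Rlt_or_le (Cmod (phi r - driving T lam r)%C) eps) as [|hge]; auto. exfalso.
    assert (hd1 : d <= rho) by apply Rmin_l.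
    assert (hd2 : d <= Rmin (/ (M * M + 1)) (eps * eps / 48)) by apply Rmin_r.
    pose_Rmin (/ (M * M + 1)) (eps * eps / 48).
    set (eta := eps * eps / 6). assert (heta : 0 < eta) by (unfold eta; nra).
    (* backwards in time, from r' to r, the modulus can only grow moderately *)
    assert (low : forall r' g, P r' g -> r <= r' -> r' < R0 ->
       eta <= Cmod (g r' - driving T lam r')%C * Cmod (g r' - driving T lam r')%C).
    { intros r' g Hp hrr' hr'.
      assert (hder : forall s, 0 < s < r' - r -> exists m, cderive (rdriving T lam r') s m /\ Cmod m <= M).
      { intros s hs. apply (rdriving_cderive T lam R0 r' rho M Lam Lam'); auto; try lra.
        rewrite Rabs_left; lra. }
      pose proof (fwd_rev _ _ _ _ (proj1 (proj2 Hp))) as hrev.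
      pose proof (sol_tipsol T lam r' M (r' - r) _ hn hder ltac:(lra) hrev) as hts.
      pose proof (tip_size (RtoC 1) _ M (r' - r) _ hM ltac:(lra) (zeta_ok_mod _ zeta_ok_1) hts) as H1.
      cbv beta in H1. unfold rdriving in H1. rewrite Rminus_0_r in H1.
      replace (r' - (r' - r)) with r in H1 by ring.
      rewrite <- (hphi r hr r' g Hp hrr') in H1.
      assert (He : exp (M * M * (r' - r)) <= 3).
      { apply exp_le_3_of_le_1.
        assert ((M * M + 1) * (r' - r) <= 1).
        { apply mul_le_one; [nra|lra]. }
        nra. }
      set (a := Cmod (phi r - driving T lam r)%C) in *.
      set (b := Cmod (g r' - driving T lam r')%C) in *.
      assert (eps * eps <= a * a) by nra.
      assert (0 <= b * b) by nra. unfold eta.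
      pose proof (exp_pos (M * M * (r' - r))). nra. }
    destruct (below r hr) as [r1 [g1 [P1 h1]]].
    assert (Pr : P r g1).
    { apply (Psub r1); auto; lra. }
    set (y := Im (g1 r)). assert (hy : 0 < y) by (apply (proj2 (proj2 (proj2 Pr))); lra).
    (* With |X|^2 >= eta the height can shrink at most by the factor K between r and R0, yet
       [height] provides a time at which it is y / (2 K). *)
    set (K := exp (2 / eta * R0)). assert (hK : 1 <= K).
    { unfold K. rewrite <- exp_0. apply Rlt_le, exp_increasing.
      apply Rmult_lt_0_compat; auto. apply Rdiv_lt_0_compat; lra. }
    destruct (height r g1 (y / (2 * K)) Pr) as [r2 [g2 [P2 [h2 E2]]]].
    { fold y. split; [apply Rdiv_lt_0_compat; lra|].
      apply Rmult_lt_reg_r with (2 * K); [lra|].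
      replace (y / (2 * K) * (2 * K)) with y by (field; lra). nra. }
    pose proof (fwd_rev _ _ _ _ (proj1 (proj2 P2))) as [hs2 _].
    pose proof (im_growth (-2) eta (rdriving T lam r2) 0 (r2 - r) _ ltac:(lra) heta (fun _ => eq_refl)
       (sol_sub _ _ 0 r2 0 (r2 - r) _ ltac:(lra) ltac:(lra) hs2)) as G.
    cbv beta in G. replace (r2 - 0) with r2 in G by ring.
    replace (r2 - (r2 - r)) with r in G by ring.
    rewrite E2, (Rabs_right (y / (2 * K))) in G
      by (apply Rle_ge, Rlt_le, Rdiv_lt_0_compat; lra).
    rewrite <- (uniq r1 g1 r2 g2 P1 P2 r) in G by lra. fold y in G.
    rewrite (Rabs_right y), (Rabs_left (-2)) in G by lra.
    assert (G' : y <= exp (- -2 / eta * (r2 - r - 0)) * (y / (2 * K))).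
    { apply G. intros s hs. unfold rdriving.
      assert (Ps : P (r2 - s) g2).
      { apply (Psub r2); auto; lra. }
      apply low; auto; lra. }
    assert (exp (- -2 / eta * (r2 - r - 0)) <= K).
    { unfold K. replace (- -2) with 2 by ring. apply Rlt_le, exp_increasing.
      apply Rmult_lt_compat_l; [apply Rdiv_lt_0_compat; lra|lra]. }
    assert (0 < y / (2 * K)) by (apply Rdiv_lt_0_compat; lra).
    assert (K * (y / (2 * K)) = y / 2) by (field; lra). nra. }
  (* The reversed maximal trajectory, continued by the constants lam R0 for s <= 0 and z for s >=
     R0. *)
  set (h := fun s => if Rle_dec s 0 then RtoC (lam R0) else phi (R0 - Rmin s R0)).
  assert (heq : forall s, 0 < s -> h s = phi (R0 - Rmin s R0)).
  { intros s hs. unfold h. destruct Rle_dec; [lra|auto]. }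
  assert (hz0 : forall s, s <= 0 -> h s = RtoC (lam R0)).
  { intros s hs. unfold h. destruct Rle_dec; [auto|lra]. }
  assert (hloc : forall s, 0 < s -> exists r' g, P r' g /\
     forall u, s / 2 < u -> R0 - Rmin u R0 <= r' /\ h u = g (R0 - Rmin u R0)).
  { intros s hs.
    destruct (below (Rmax 0 (R0 - s / 2))) as [r' [g [Hp h']]].
    { split; [apply Rmax_l|apply Rmax_lub_lt; lra]. }
    pose proof (Rmax_l 0 (R0 - s / 2)). pose proof (Rmax_r 0 (R0 - s / 2)).
    exists r', g. split; auto. intros u hu.
    assert (0 < Rmin u R0) by (apply Rmin_pos; lra). pose proof (Rmin_r u R0).
    assert (R0 - Rmin u R0 <= r').
    { unfold Rmin in *. destruct Rle_dec; lra. }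
    split; auto. rewrite heq by lra. apply (hphi (R0 - Rmin u R0)) with (r' := r'); auto. lra. }
  assert (hcont : ccont h).
  { apply ccont_iff_eps. intros s eps he.
    destruct (Rtotal_order s 0) as [hs|[hs|hs]].
    - exists (- s). split; [lra|]. intros u hu. apply Rabs_lt_between in hu.
      rewrite !hz0 by lra. rewrite Cminus_diag, Cmod_0. auto.
    - subst s. destruct (lim0 (eps / 2)) as [d1 [hd1 k1]]; [lra|].
      destruct (proj1 (ccont_iff_eps _) (rdriving_cont T lam R0 hn) 0 (eps / 2)) as [d2 [hd2 k2]]; [lra|].
      exists (Rmin R0 (Rmin d1 d2)). split; [repeat apply Rmin_pos; lra|]. intros u hu.
      pose_Rmin R0 (Rmin d1 d2).
      pose_Rmin d1 d2.
      specialize (k2 u ltac:(lra)). rewrite Rminus_0_r in hu. apply Rabs_lt_between in hu.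
      rewrite (hz0 0) by lra. destruct (Rle_or_lt u 0) as [hu0|hu0].
      + rewrite hz0 by lra. rewrite Cminus_diag, Cmod_0. auto.
      + rewrite heq by lra. rewrite Rmin_left by lra.
        specialize (k1 (R0 - u) ltac:(lra) ltac:(lra)).
        unfold rdriving in k2. rewrite Rminus_0_r, (driving_eq T lam R0) in k2 by lra.
        eapply Rle_lt_trans; [apply (Cmod_tri3 _ (driving T lam (R0 - u)))|]. lra.
    - destruct (hloc s hs) as [r' [g [Hp hg]]].
      assert (gc : ccont (fun u => g (R0 - Rmin u R0))).
      { apply (ccont_comp g (fun u => R0 - Rmin u R0)); [apply Hp|].
        intros a b. unfold Rmin, Rabs. repeat destruct Rle_dec; repeat destruct Rcase_abs; lra. }
      destruct (proj1 (ccont_iff_eps _) gc s eps he) as [d [hd hd']].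
      exists (Rmin d (s / 2)). split; [apply Rmin_pos; lra|]. intros u hu.
      pose_Rmin d (s / 2).
      pose proof (hd' u ltac:(lra)) as hd''. apply Rabs_lt_between in hu.
      rewrite (proj2 (hg u ltac:(lra))), (proj2 (hg s ltac:(lra))). exact hd''. }
  exists R0, h. split; [lra|]. split; [split; [split; [split; [auto|]|]|]|].
  - intros s hs. destruct (hloc s ltac:(lra)) as [r' [g [Hp hg]]].
    destruct (hg s ltac:(lra)) as [e1 e2]. rewrite Rmin_left in e1, e2 by lra.
    destruct (below (R0 - s)) as [r2 [g2 [P2 h2]]]; [lra|].
    assert (Es : h s = g2 (R0 - s)).
    { rewrite heq, Rmin_left by lra. apply (hphi (R0 - s)) with (r' := r2); auto; lra. }
    rewrite Es.
    destruct P2 as [a1 [[[a2 a3] a4] [a5 a6]]].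
    apply (cderive_ext_loc (fun u => g2 (R0 - u)) h s _ (Rmin s (Rmin (R0 - s) (r2 - (R0 - s))))).
    + repeat apply Rmin_pos; lra.
    + intros u hu.
      pose_Rmin s (Rmin (R0 - s) (r2 - (R0 - s))).
      pose_Rmin (R0 - s) (r2 - (R0 - s)).
      apply Rabs_lt_between in hu. rewrite heq, Rmin_left by lra. symmetry.
      apply (hphi (R0 - u) ltac:(lra) r2 g2); [|lra].
      split; [lra|]. split; [split; [split; auto|auto]|auto].
    + replace (RtoC (-2) / (g2 (R0 - s)%R - rdriving T lam R0 s))%C
        with (- (RtoC 2 / (g2 (R0 - s)%R - driving T lam (R0 - s))))%C.
      * apply cderive_rev. apply a3. lra.
      * unfold rdriving, Cdiv. replace (-2) with (- (2)) by ring. rewrite RtoC_opp. ring.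
  - intros s hs. destruct (hloc s ltac:(lra)) as [r' [g [Hp hg]]].
    destruct (hg s ltac:(lra)) as [e1 e2]. rewrite e2. apply (proj2 (proj2 (proj2 Hp))).
    rewrite Rmin_left in * by lra. lra.
  - apply hz0; lra.
  - destruct (hloc R0 hR0) as [r' [g [Hp hg]]].
    destruct (hg R0 ltac:(lra)) as [e1 e2]. rewrite e2, Rmin_left, Rminus_diag by lra. apply Hp.
Qed.

(** * The generated curve and its uniqueness *)

Definition tip_curve (T : R) (lam : R -> R) (gam : R -> C) : Prop :=
  gam 0 = RtoC (lam 0) /\
  forall t, 0 < t <= T -> exists h, tip_traj T lam t h /\ h t = gam t.

Lemma tip_curve_exists T lam : extendable T lam -> exists gam, tip_curve T lam gam.
Proof.
  intros hn.
  assert (H : forall t, exists z, (t = 0 -> z = RtoC (lam 0)) /\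
     (0 < t <= T -> exists h, tip_traj T lam t h /\ h t = z)).
  { intros t. destruct (classic (0 < t <= T)) as [ht|ht].
    - destruct (tip_exists T lam t hn ht) as [h [h1 _]]. exists (h t). split; [lra|eauto].
    - exists (RtoC (lam 0)). split; [auto|tauto]. }
  destruct (fun_choice _ H) as [gam hg]. exists gam. split; [now apply hg|].
  intros t ht. now apply hg.
Qed.

Lemma tip_end T lam gam t h : extendable T lam -> tip_curve T lam gam -> 0 < t <= T ->
  tip_traj T lam t h -> h t = gam t.
Proof.
  intros hn hg ht hh. destruct (proj2 hg t ht) as [h' [h1 <-]].
  apply (tip_unique T lam t); auto. lra.
Qed.

Lemma tip_curve_inH T lam gam t : tip_curve T lam gam -> 0 < t <= T -> inH (gam t).
Proof.
  intros hg ht. destruct (proj2 hg t ht) as [h [[[_ h1] _] <-]]. apply (h1 t). lra.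
Qed.

Lemma outside_hull_iff T lam t z : extendable T lam -> 0 <= t <= T ->
  (inH z /\ ~ in_hull lam t z) <-> exists k, rev_traj T lam t k /\ 0 < Im (k 0) /\ k t = z.
Proof.
  intros hn ht. split.
  - intros [h1 h2]. apply (solution_rev T lam t z); auto.
    apply NNPP. intros h3. apply h2. split; auto.
  - intros [k [h1 [h2 h3]]]. split.
    + rewrite <- h3. pose proof (rev_mono T lam t k 0 t h1 ltac:(lra) ltac:(lra) ltac:(lra)).
      change (0 < Im (k t)). lra.
    + intros [_ h4]. apply h4. now apply (rev_solution T lam t z k).
Qed.

(** A point gamma(s) with s <= t cannot lie outside K_t: a reverse trajectory from the half-plane
    ending there would share its past with the tip trajectory of s, hence sit at the real point lam
    s at time t - s. *)
Lemma hull_iff T lam gam t z : extendable T lam -> tip_curve T lam gam -> 0 <= t <= T -> inH z ->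
  in_hull lam t z <-> exists s, 0 < s <= t /\ gam s = z.
Proof.
  intros hn hg ht hz. split.
  - intros h. destruct (Rle_lt_or_eq_dec 0 t (proj1 ht)) as [ht0|<-].
    + destruct (rev_or_tip T lam t z hn ltac:(lra) hz) as [h1|[s [k [hs [hk e]]]]].
      * exfalso. apply (outside_hull_iff T lam t z hn ht) in h1. tauto.
      * exists s. split; auto. rewrite <- e. symmetry. apply (tip_end T lam); auto. lra.
    + exfalso. destruct (rev_exists T lam 0 z hn ltac:(lra) hz) as [k [h1 [h2 _]]].
      destruct (proj2 (outside_hull_iff T lam 0 z hn ht)) as [_ h3]; [|tauto].
      exists k. rewrite h2. auto.
  - intros [s [hs e]]. apply NNPP. intros h.
    destruct (proj1 (outside_hull_iff T lam t z hn ht) (conj hz h)) as [k [k1 [k2 k3]]].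
    destruct (proj2 hg s ltac:(lra)) as [h' [[t1 t2] t3]].
    pose proof (rev_unique T lam s t h' k ltac:(lra) t1 k1 ltac:(congruence) s ltac:(lra)) as E.
    rewrite Rminus_diag, t2 in E.
    pose proof (rev_mono T lam t k 0 (t - s) k1 ltac:(lra) ltac:(lra) ltac:(lra)) as I.
    rewrite <- E in I. simpl in I. unfold Im in *. lra.
Qed.

Lemma tip_curve_simple T lam gam s t : extendable T lam -> tip_curve T lam gam ->
  0 < s < t -> t <= T -> gam s <> gam t.
Proof.
  intros hn hg hs ht E.
  destruct (proj2 hg s ltac:(lra)) as [h1 [[r1 i1] e1]].
  destruct (proj2 hg t ltac:(lra)) as [h2 [[r2 i2] e2]].
  pose proof (rev_unique T lam s t h1 h2 ltac:(lra) r1 r2 ltac:(congruence) s ltac:(lra)) as Q.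
  rewrite Rminus_diag, i1 in Q. pose proof (proj2 r2 (t - s) ltac:(lra)) as I.
  rewrite <- Q in I. simpl in I. lra.
Qed.

(* The path joining k t to infinity is the image of the vertical half-line above k 0. *)
Lemma outside_hull_path T lam t k M : extendable T lam -> 0 <= t <= T ->
  rev_traj T lam t k -> 0 < Im (k 0) ->
  exists w, M < Cnorm w /\
    path_connected_in (fun v => exists k', rev_traj T lam t k' /\ 0 < Im (k' 0) /\ k' t = v) (k t) w.
Proof.
  intros hn ht hk hk0.
  (* Heights do not decrease under the reversed flow, so starting |M| + 1 higher forces a final
     modulus above M. *)
  set (c := Im (k 0)) in *. set (L := Rabs M + 1).
  assert (hL : 0 < L) by (unfold L; pose proof (Rabs_pos M); lra).
  set (W := fun u => (Re (k 0), c + u * L) : C).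
  assert (ex : forall u, exists k', 0 <= u -> rev_traj T lam t k' /\ k' 0 = W u).
  { intros u. destruct (Rle_dec 0 u) as [hu|hu]; [|exists k; tauto].
    destruct (rev_exists T lam t (W u) hn ltac:(lra)) as [k' [h1 [h2 _]]].
    - unfold W; simpl. nra.
    - exists k'. auto. }
  destruct (fun_choice _ ex) as [K hK]. clear ex.
  set (E := exp (2 * / (c * c) * (t - 0))). assert (hE : 0 < E) by apply exp_pos.
  assert (cmp : forall k1 k2, rev_traj T lam t k1 -> rev_traj T lam t k2 -> c <= Im (k1 0) -> c <= Im (k2 0) ->
     Cmod (k1 t - k2 t)%C <= E * Cmod (k1 0%R - k2 0%R)%C).
  { intros k1 k2 r1 r2 i1 i2. apply (rev_compare T lam t c); auto; lra. }
  assert (imW : forall u, 0 <= u -> c <= Im (W u)) by (intros u hu; unfold W; simpl; nra).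
  exists (K 1 t). split.
  - destruct (hK 1 ltac:(lra)) as [h1 h2].
    pose proof (rev_mono T lam t _ 0 t h1 ltac:(lra) ltac:(lra) ltac:(lra)) as I.
    rewrite h2 in I. simpl in I. pose proof (im_le_mod (K 1 t)).
    change (M < Cmod (K 1 t)). pose proof (Rle_abs M). unfold L, Im in *. lra.
  - exists (fun u => K u t). split; [|split; [|split]].
    + intros s hs eps he. exists (eps / (E * L + 1)). split.
      { apply Rdiv_lt_0_compat; nra. }
      intros u hu hus. change (Cmod (K u t - K s t)%C < eps).
      destruct (hK u ltac:(lra)) as [u1 u2]. destruct (hK s ltac:(lra)) as [s1 s2].
      eapply Rle_lt_trans; [apply cmp; auto; rewrite ?u2, ?s2; apply imW; lra|].
      rewrite u2, s2. replace (W u - W s)%C with (0, (u - s) * L).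
      2:{ unfold W, Cminus, Cplus, Copp; simpl. f_equal; ring. }
      replace (Cmod (0, (u - s) * L)) with (Rabs (u - s) * L).
      2:{ unfold Cmod; simpl. replace (_ + _) with (Rsqr ((u - s) * L)) by (unfold Rsqr; ring).
          rewrite sqrt_Rsqr_abs, Rabs_mult, (Rabs_right L) by lra. auto. }
      assert ((E * L + 1) * Rabs (u - s) < eps).
      { apply mul_lt_of_lt_div; auto. nra. }
      pose proof (Rabs_pos (u - s)). nra.
    + destruct (hK 0 ltac:(lra)) as [h1 h2]. apply Cmod_small_eq. intros eps he.
      eapply Rle_trans; [apply cmp; auto; rewrite ?h2; [apply imW; lra|unfold c; lra]|].
      rewrite h2. replace (W 0) with (k 0).
      * rewrite Cminus_diag, Cmod_0. lra.
      * unfold W, c. rewrite Rmult_0_l, Rplus_0_r. now destruct (k 0).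
    + reflexivity.
    + intros u hu. exists (K u). destruct (hK u ltac:(lra)) as [h1 h2]. split; auto.
      split; auto. rewrite h2. specialize (imW u ltac:(lra)). lra.
Qed.

(** The complement of gamma(0, t] in the half-plane is the image of the half-plane under the
    reversed flow. Each of its points is joined to infinity, so the complement has no bounded
    component. *)
Lemma tip_curve_generates T lam gam : extendable T lam -> tip_curve T lam gam ->
  Ccont_on 0 T gam -> loewner_generates T lam gam.
Proof.
  intros hn hg hc. split; [auto|split].
  - intros t ht. destruct (Rle_lt_or_eq_dec 0 t (proj1 ht)) as [h|<-].
    + apply Rlt_le. apply (tip_curve_inH T lam gam t); auto. lra.
    + rewrite (proj1 hg). simpl. lra.
  - intros t ht z.
    assert (HU : forall v, (inH v /\ ~ (exists s, 0 < s <= t /\ gam s = v)) <->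
       exists k', rev_traj T lam t k' /\ 0 < Im (k' 0) /\ k' t = v).
    { intros v. rewrite <- (outside_hull_iff T lam t v hn ht). split; intros [h1 h2]; split; auto;
        now rewrite (hull_iff T lam gam t v hn hg ht h1) in *. }
    split.
    + intros h. apply (outside_hull_iff T lam t z hn ht) in h.
      split; [now apply HU|]. intros M.
      destruct h as [k [k1 [k2 k3]]].
      destruct (outside_hull_path T lam t k M hn ht k1 k2) as [w [w1 [p [p1 [p2 [p3 p4]]]]]].
      exists w. split; auto. exists p. rewrite <- k3. split; [auto|split; [auto|split; auto]].
      intros u hu. apply HU. auto.
    + intros [h _]. apply (outside_hull_iff T lam t z hn ht). now apply HU.
Qed.

Lemma clamp_cont a b (f : R -> R) (s : R) : continuous f s -> continuous (fun u => clamp a b (f u)) s.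
Proof.
  intros h. apply (cont_comp f (clamp a b)); auto. apply cont_iff_eps.
  intros eps he. exists eps. split; auto. intros u hu.
  eapply Rle_lt_trans; [apply clamp_lip|auto].
Qed.

Lemma path_extend (U : C -> Prop) (z z' w : C) :
  path_connected_in U z' w ->
  (forall u, 0 <= u <= 1 -> U (z + RtoC u * (z' - z))%C) -> path_connected_in U z w.
Proof.
  intros [p [pc [p0 [p1 pU]]]] hseg.
  set (q := (fun v => p (clamp 0 1 v)) : R -> C).
  assert (qc : ccont q) by (apply ccont_clamp; auto; lra).
  (* A single formula for segment and path: [q] is frozen at z' on the first half, and the clamped
     coefficient vanishes on the second. *)
  exists (fun u : R => q (2 * u - 1)%R - RtoC (1 - clamp 0 1 (2 * u)) * (z' - z))%C.
  assert (q0 : forall v, v <= 0 -> q v = z').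
  { intros v hv. unfold q. rewrite <- p0. f_equal. unfold clamp, Rmax, Rmin.
    repeat destruct Rle_dec; lra. }
  assert (c1 : forall v, 1 <= v -> clamp 0 1 v = 1).
  { intros v hv. unfold clamp, Rmax, Rmin. repeat destruct Rle_dec; lra. }
  split; [|split; [|split]].
  - apply ccont_Ccont_on. apply ccont_sub.
    + split; intros s.
      * apply (cont_comp (fun u => 2 * u - 1) (fun v => Re (q v))); [prove_cont|apply qc].
      * apply (cont_comp (fun u => 2 * u - 1) (fun v => Im (q v))); [prove_cont|apply qc].
    + assert (cc : forall s, continuous (fun u => clamp 0 1 (2 * u)) s).
      { intros s. apply (clamp_cont 0 1 (fun u => 2 * u)). prove_cont. }
      split; intros s.
      * apply (continuous_ext (fun u => (1 - clamp 0 1 (2 * u)) * Re (z' - z)%C)).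
        { intros u. unfold Re; simpl. ring. }
        specialize (cc s). prove_cont.
      * apply (continuous_ext (fun u => (1 - clamp 0 1 (2 * u)) * Im (z' - z)%C)).
        { intros u. unfold Im; simpl. ring. }
        specialize (cc s). prove_cont.
  - rewrite q0 by lra. rewrite clamp_id by lra.
    replace (1 - 2 * 0) with 1 by ring.
    change ((z' - RtoC 1 * (z' - z))%C = z :> C). ring.
  - rewrite c1 by lra. replace (2 * 1 - 1) with 1 by ring. rewrite Rminus_diag.
    unfold q. rewrite clamp_id by lra. rewrite p1.
    change ((w - RtoC 0 * (z' - z))%C = w :> C). ring.
  - intros u hu. destruct (Rle_or_lt u (1 / 2)).
    + rewrite q0 by lra. rewrite clamp_id by lra.
      replace (z' - RtoC (1 - 2 * u) * (z' - z))%C with (z + RtoC (2 * u) * (z' - z))%C.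
      * apply hseg. lra.
      * rewrite RtoC_minus. ring.
    + rewrite c1 by lra. rewrite Rminus_diag.
      replace (q (2 * u - 1)%R - 0 * (z' - z))%C with (q (2 * u - 1)%R) by ring.
      unfold q. rewrite clamp_id by lra. apply pU. lra.
Qed.

(** If gam' missed z = gamma(t) on [0, t], it would keep a positive distance from z. Points outside
    K_t lie arbitrarily near z, at the ends of trajectories started just above lam t, and a short
    segment would put z in their component, although z is in K_t. If gam' met z at some s < t, then
    z would be in K_s = gamma(0, s], against simplicity. *)
Lemma generated_unique T lam gam gam' : extendable T lam -> tip_curve T lam gam ->
  Ccont_on 0 T gam -> loewner_generates T lam gam' ->
  forall t, 0 < t <= T -> gam' t = gam t.
Proof.
  intros hn hg hc [gc [gim gcomp]] t ht.
  assert (hT : 0 < T) by apply hn.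
  assert (inhull : forall s, 0 < s <= T -> inH (gam' s) -> in_hull lam s (gam' s)).
  { intros s hs hH. apply NNPP. intros h.
    destruct (proj1 (gcomp s ltac:(lra) (gam' s)) (conj hH h)) as [[_ U] _].
    apply U. exists s. split; auto. lra. }
  set (z := gam t). assert (hz : inH z) by (apply (tip_curve_inH T lam gam); auto).
  assert (hit : exists s, 0 < s <= t /\ gam' s = z).
  { apply NNPP. intros hno.
    assert (hne : forall s, 0 <= s <= t -> gam' s <> z).
    { intros s hs E. destruct (Rle_lt_or_eq_dec 0 s (proj1 hs)) as [h|<-].
      - apply hno. exists s. split; auto. lra.
      (* The case gam' 0 = z: for small s the point gam' s is near z, in the half-plane and in K_s,
         so it equals some gamma(s') with s' <= s, which is near the real point lam 0. *)
      - change (0 < Im z) in hz.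
        destruct (gc 0 ltac:(lra) (Im z / 2) ltac:(lra)) as [d1 [hd1 k1]].
        destruct (hc 0 ltac:(lra) (Im z / 2) ltac:(lra)) as [d2 [hd2 k2]].
        set (s := Rmin T (Rmin (d1 / 2) (d2 / 2))).
        assert (hs0 : 0 < s) by (repeat apply Rmin_pos; lra).
        assert (hs1 : s <= T) by apply Rmin_l.
        assert (hs2 : s <= Rmin (d1 / 2) (d2 / 2)) by apply Rmin_r.
        pose_Rmin (d1 / 2) (d2 / 2).
        specialize (k1 s ltac:(lra)). rewrite Rminus_0_r, Rabs_right in k1 by lra.
        specialize (k1 ltac:(lra)). change (Cmod (gam' s - gam' 0%R)%C < Im z / 2) in k1.
        rewrite E, Cmod_minus_sym in k1.
        pose proof (im_le_mod (z - gam' s)%C) as I1. rewrite Im_minus in I1.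
        assert (hH : inH (gam' s)) by (change (0 < Im (gam' s)); lra).
        pose proof (inhull s ltac:(lra) hH) as ih.
        apply (hull_iff T lam gam s) in ih; auto; [|lra].
        destruct ih as [s' [hs' E']].
        specialize (k2 s' ltac:(lra)). rewrite Rminus_0_r, Rabs_right in k2 by lra.
        specialize (k2 ltac:(lra)). change (Cmod (gam s' - gam 0%R)%C < Im z / 2) in k2.
        rewrite E', (proj1 hg) in k2.
        pose proof (im_le_mod (gam' s - RtoC (lam 0))%C) as I2. rewrite Im_minus in I2.
        change (Im (RtoC (lam 0))) with 0 in I2. lra. }
    assert (dist : exists d, 0 < d /\ forall s, 0 <= s <= t -> d <= Cmod (gam' s - z)%C).
    { assert (hc' : Ccont_on 0 t gam').
      { intros s hs eps he. destruct (gc s ltac:(lra) eps he) as [d [hd hd']].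
        exists d. split; auto. intros u hu. apply hd'. lra. }
      pose proof (ccont_sub _ _ (ccont_clamp gam' 0 t ltac:(lra) hc') (ccont_const z)) as Xc.
      set (X := fun s => (gam' (clamp 0 t s) - z)%C) in *.
      destruct (continuity_ab_min (fun s => Re (X s) * Re (X s) + Im (X s) * Im (X s))
        0 t ltac:(lra)) as [m [hm1 hm2]].
      { intros c _. apply continuity_pt_filterlim. apply (normsq_cont X c Xc). }
      assert (pm : 0 < Cmod (X m)).
      { apply Cmod_gt_0. intros E. apply (hne m hm2). unfold X in E. rewrite clamp_id in E by lra.
        apply (Cmod_small_eq (gam' m) z). intros eps he. rewrite E, Cmod_0. lra. }
      exists (Cmod (X m)). split; auto. intros s hs. specialize (hm1 s hs). cbv beta in hm1.
      replace (gam' s - z)%C with (X s) by (unfold X; now rewrite clamp_id).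
      rewrite <- (Rmult_1_l (Cmod (X s))). apply Cmod_le_sq; lra. }
    destruct dist as [d [hd hdist]].
    destruct (tip_exists T lam t hn ht) as [h [hh happ]].
    assert (E : h t = z) by (apply (tip_end T lam); auto).
    change (0 < Im z) in hz.
    destruct (happ (Rmin d (Im z))) as [k [k1 [k2 k3]]]; [apply Rmin_pos; auto|].
    rewrite E in k3. pose_Rmin d (Im z).
    assert (out : inH (k t) /\ ~ in_hull lam t (k t)).
    { apply (outside_hull_iff T lam t); eauto. lra. }
    apply (gcomp t ltac:(lra)) in out. destruct out as [_ unb].
    assert (seg : forall u, 0 <= u <= 1 ->
       inH (z + RtoC u * (k t - z))%C /\
       ~ (exists s, 0 < s <= t /\ gam' s = (z + RtoC u * (k t - z))%C)).
    { intros u hu.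
      assert (B : Cmod (RtoC u * (k t - z))%C < Rmin d (Im z)).
      { rewrite Cmod_mult, Cmod_R, Rabs_right by lra. pose proof (Cmod_ge_0 (k t - z)%C). nra. }
      split.
      - change (0 < Im (z + RtoC u * (k t - z))%C).
        pose proof (im_le_mod (- (RtoC u * (k t - z)))%C) as I. rewrite Cmod_opp in I.
        change (Im (z + RtoC u * (k t - z))%C) with (Im z + Im (RtoC u * (k t - z))%C).
        change (Im (- (RtoC u * (k t - z)))%C) with (- Im (RtoC u * (k t - z))%C) in I. lra.
      - intros [s [hs Es]]. specialize (hdist s ltac:(lra)). rewrite Es in hdist.
        replace (z + RtoC u * (k t - z) - z)%C with (RtoC u * (k t - z))%C in hdist by ring. lra. }
    assert (comp : in_unbounded_component
       (fun w => inH w /\ ~ (exists s, 0 < s <= t /\ gam' s = w)) z).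
    { split.
      - replace z with (z + RtoC 0 * (k t - z))%C by ring. apply seg. lra.
      - intros M. destruct (unb M) as [w [w1 w2]]. exists w. split; auto.
        apply (path_extend _ z (k t)); auto. }
    apply (gcomp t ltac:(lra)) in comp. destruct comp as [c1 c2]. apply c2.
    apply (hull_iff T lam gam); auto; [lra|]. exists t. split; auto. lra. }
  destruct hit as [s [hs E]].
  destruct (Rle_lt_or_eq_dec s t (proj2 hs)) as [h|<-]; auto. exfalso.
  pose proof (inhull s ltac:(lra)) as ih. rewrite E in ih. specialize (ih hz).
  apply (hull_iff T lam gam s) in ih; auto; [|lra].
  destruct ih as [s' [hs' E']]. apply (tip_curve_simple T lam gam s' t hn hg); auto; lra.
Qed.

(** * Analytic dependence on parameters *)

Lemma cderive_line c s : cderive (fun u => RtoC u * c)%C s c.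
Proof.
  assert (G : forall r, is_derive (fun u => u * r) s r).
  { intros r. eapply derive_eq; [apply derive_mul; [apply derive_id|apply derive_const]|]. cbv beta; ring. }
  split.
  - apply (is_derive_ext (fun u => u * Re c)); [|apply G]. intros; unfold Re; simpl; ring.
  - apply (is_derive_ext (fun u => u * Im c)); [|apply G]. intros; unfold Im; simpl; ring.
Qed.

(* Explicit Euler steps h + (S/N) kappa / (h - l) stay in the algebra of uniform limits of
   polynomials, and they converge to the solution uniformly in the parameter. *)
Lemma euler_approx rho (kap : C -> C) (l h : R -> C -> C) (S c Z : R) :
  0 < S -> 0 < c -> 0 <= Z ->
  approx rho kap -> (forall x, Cmod x <= rho -> Cmod (kap x) <= Z) ->
  (forall s, 0 <= s <= S -> approx rho (l s)) ->
  (forall eta, 0 < eta -> exists d, 0 < d /\ forall s u x, 0 <= s <= S -> 0 <= u <= S ->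
     Rabs (s - u) <= d -> Cmod x <= rho -> Cmod (l s x - l u x)%C <= eta) ->
  approx rho (h 0) ->
  (forall x, Cmod x <= rho -> sol (kap x) (fun s => l s x) 0 S (fun s => h s x)) ->
  (forall x s, Cmod x <= rho -> 0 <= s <= S -> c <= Im (h s x - l s x)%C) ->
  approx rho (h S).
Proof.
  intros hS hc hZ akap hkap al hmod ah0 hsol him.
  apply approx_lim. intros eps he.
  set (K1 := Z * / (c * c)). set (K2 := Z * / (c / 2 * (c / 2))).
  assert (hcc : 0 < / (c * c)) by (apply Rinv_0_lt_compat; nra).
  assert (hcc2 : 0 < / (c / 2 * (c / 2))) by (apply Rinv_0_lt_compat; nra).
  assert (hK1 : 0 <= K1) by (unfold K1; nra). assert (hK2 : 0 <= K2) by (unfold K2; nra).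
  (* An error of at most c / 2 keeps the Euler iterates at height c / 2 over the driving function,
     where they can be inverted; this is why [K2] is computed with c / 2. *)
  set (tau := Rmin (c / 2) eps). assert (htau : 0 < tau) by (apply Rmin_pos; lra).
  assert (htc : tau <= c / 2) by apply Rmin_l. assert (hte : tau <= eps) by apply Rmin_r.
  set (A := 2 * K1 * S * exp (K2 * S)).
  assert (hA : 0 <= A).
  { unfold A. apply Rmult_le_pos; [|apply Rlt_le, exp_pos]. apply Rmult_le_pos; lra. }
  set (eta := tau / (A + 1)). assert (heta : 0 < eta) by (apply Rdiv_lt_0_compat; lra).
  assert (hAe : A * eta <= tau).
  { assert ((A + 1) * eta = tau) by (unfold eta; field; lra). nra. }
  destruct (hmod eta heta) as [d [hd hld]].
  set (V := Z / c). assert (hV : 0 <= V).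
  { unfold V. apply Rmult_le_pos; [auto|]. apply Rlt_le, Rinv_0_lt_compat; auto. }
  set (d' := Rmin d (eta / (V + 1))).
  assert (hd' : 0 < d') by (apply Rmin_pos; auto; apply Rdiv_lt_0_compat; lra).
  destruct (archimed_cor1 (d' / (S + 1))) as [N [hN1 hN2]]; [apply Rdiv_lt_0_compat; lra|].
  assert (hN : 0 < INR N) by (apply lt_0_INR; auto).
  set (D := S / INR N). assert (hD : 0 < D) by (apply Rdiv_lt_0_compat; auto).
  assert (hDd' : D <= d').
  { unfold D, Rdiv. apply Rmult_lt_compat_l with (r := S + 1) in hN1; [|lra].
    replace ((S + 1) * (d' / (S + 1))) with d' in hN1 by (field; lra).
    assert (0 < / INR N) by (apply Rinv_0_lt_compat; auto). nra. }
  assert (hDd : D <= d) by (eapply Rle_trans; [exact hDd'|apply Rmin_l]).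
  assert (hVD : V * D <= eta).
  { assert (D <= eta / (V + 1)) by (eapply Rle_trans; [exact hDd'|apply Rmin_r]).
    apply Rmult_le_compat_l with (r := V + 1) in H; [|lra].
    replace ((V + 1) * (eta / (V + 1))) with eta in H by (field; lra). lra. }
  assert (hDS : INR N * D = S) by (unfold D; field; lra).
  set (F := fun s x => (kap x / (h s x - l s x))%C).
  (* Within one step X moves by at most eta through the velocity of h and eta through the driving
     function; K1 converts this into a defect of the field. *)
  set (e1 := K1 * (2 * eta)). assert (he1 : 0 <= e1) by (unfold e1; nra).
  assert (hX : forall x s, Cmod x <= rho -> 0 <= s <= S -> c <= Cmod (h s x - l s x)%C).
  { intros x s hx hs. eapply Rle_trans; [apply (him x s hx hs)|apply im_le_mod]. }
  assert (hvel : forall x s u, Cmod x <= rho -> 0 <= s <= u -> u <= S ->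
     Cmod (h u x - h s x)%C <= V * (u - s)).
  { intros x s u hx hs hu. destruct (hsol x hx) as [sc sd].
    replace (V * (u - s)) with (V * u - V * s) by ring.
    apply (mean_value_ineq (fun s => h s x) (fun s => V * s)); auto; [lra|intros; prove_cont|].
    intros v hv. exists (F v x), V. split; [apply sd; lra|]. split.
    - eapply derive_eq; [apply derive_mul; [apply derive_const|apply derive_id]|]. cbv beta; ring.
    - specialize (hX x v hx ltac:(lra)). unfold F.
      rewrite Cmod_div by (apply Cmod_gt_0; lra). unfold V, Rdiv.
      apply Rmult_le_compat; [apply Cmod_ge_0|apply Rlt_le, Rinv_0_lt_compat; lra|auto|].
      apply Rinv_le_contravar; auto. }
  assert (hstep : forall x s, Cmod x <= rho -> 0 <= s -> s + D <= S ->
     Cmod (h (s + D)%R x - h s x - RtoC D * F s x)%C <= e1 * D).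
  { intros x s hx hs hsD. destruct (hsol x hx) as [sc sd].
    replace (h (s + D)%R x - h s x - RtoC D * F s x)%C
      with ((h (s + D)%R x - RtoC (s + D) * F s x) - (h s x - RtoC s * F s x))%C
      by (rewrite RtoC_plus; ring).
    replace (e1 * D) with (e1 * (s + D) - e1 * s) by ring.
    apply (mean_value_ineq (fun u => (h u x - RtoC u * F s x)%C) (fun u => e1 * u)); [lra| | |].
    - apply ccont_sub; [exact sc|]. apply cderive_ccont. intros u. exists (F s x).
      apply cderive_line.
    - intros; prove_cont.
    - intros u hu. exists (F u x - F s x)%C, e1. split; [|split].
      + apply cderive_sub; [apply sd; lra|apply cderive_line].
      + eapply derive_eq; [apply derive_mul; [apply derive_const|apply derive_id]|]. cbv beta; ring.
      + replace (F u x - F s x)%C with (kap x * (/ (h u x - l u x) - / (h s x - l s x)))%C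
          by (unfold F, Cdiv; ring).
        rewrite Cmod_mult. unfold e1, K1. rewrite Rmult_assoc.
        apply Rmult_le_compat; try apply Cmod_ge_0; auto.
        eapply Rle_trans; [apply (inv_lip c); auto; apply him; auto; lra|].
        apply Rmult_le_compat_l; [lra|].
        replace (h u x - l u x - (h s x - l s x))%C
          with ((h u x - h s x) - (l u x - l s x))%C by ring.
        eapply Rle_trans; [apply Cmod_triangle|]. rewrite Cmod_opp.
        pose proof (hvel x s u hx ltac:(lra) ltac:(lra)).
        pose proof (hld u s x ltac:(lra) ltac:(lra) ltac:(rewrite Rabs_right; lra) hx).
        assert (V * (u - s) <= V * D) by (apply Rmult_le_compat_l; lra). lra. }
  (* Each step multiplies the old error by at most 1 + K2 D <= exp (K2 D) and adds at most e1 D. *)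
  assert (main : forall k, (k <= N)%nat -> exists e, approx rho e /\ forall x, Cmod x <= rho ->
     Cmod (e x - h (INR k * D)%R x)%C <= e1 * (INR k * D) * exp (K2 * (INR k * D))).
  { induction k; intros hk.
    - exists (h 0). split; auto. intros x hx. simpl INR. rewrite Rmult_0_l.
      rewrite Cminus_diag, Cmod_0. lra.
    - destruct (IHk ltac:(lia)) as [e [ae he']].
      set (t := INR k * D) in *.
      assert (ht : 0 <= t) by (unfold t; pose proof (pos_INR k); nra).
      assert (htD : t + D <= S).
      { apply le_INR in hk. rewrite S_INR in hk. unfold t. nra. }
      assert (tS : INR (Datatypes.S k) * D = t + D) by (rewrite S_INR; unfold t; ring).
      rewrite tS.
      assert (small : forall x, Cmod x <= rho -> Cmod (e x - h t x)%C <= c / 2).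
      { intros x hx. eapply Rle_trans; [apply he'; auto|]. eapply Rle_trans; [|exact htc].
        eapply Rle_trans; [|exact hAe]. unfold A, e1.
        assert (exp (K2 * t) <= exp (K2 * S)).
        { apply exp_le_compat, Rmult_le_compat_l; lra. }
        replace (2 * K1 * S * exp (K2 * S) * eta) with (K1 * (2 * eta) * S * exp (K2 * S)) by ring.
        pose proof (exp_pos (K2 * t)).
        assert (0 <= K1 * (2 * eta)) by (apply Rmult_le_pos; lra).
        apply Rmult_le_compat; try lra; [apply Rmult_le_pos; lra|].
        apply Rmult_le_compat_l; lra. }
      assert (him' : forall x, Cmod x <= rho -> c / 2 <= Im (e x - l t x)%C).
      { intros x hx. specialize (small x hx). specialize (him x t hx ltac:(lra)).
        pose proof (im_le_mod (h t x - e x)%C) as I. rewrite Cmod_minus_sym in I.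
        rewrite Im_minus in *. lra. }
      exists (fun x => e x + RtoC D * (kap x * / (e x - l t x)))%C. split.
      + apply approx_plus; auto. apply approx_mult; [apply approx_const|].
        apply approx_mult; auto. apply (approx_inv rho (c / 2)); auto; [lra|].
        apply approx_minus; auto. apply al; lra.
      + intros x hx. specialize (he' x hx). specialize (small x hx).
        replace (e x + RtoC D * (kap x * / (e x - l t x)) - h (t + D)%R x)%C
          with ((e x - h t x) + (RtoC D * (kap x * (/ (e x - l t x) - / (h t x - l t x)))
             - (h (t + D)%R x - h t x - RtoC D * F t x)))%C by (unfold F, Cdiv; ring).
        eapply Rle_trans; [apply Cmod_triangle|].
        assert (T1 : Cmod (RtoC D * (kap x * (/ (e x - l t x) - / (h t x - l t x))))%C <=
                 D * (K2 * Cmod (e x - h t x)%C)).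
        { rewrite !Cmod_mult, Cmod_R, Rabs_right by lra.
          apply Rmult_le_compat_l; [lra|]. unfold K2. rewrite Rmult_assoc.
          apply Rmult_le_compat; try apply Cmod_ge_0; auto.
          eapply Rle_trans; [apply (inv_lip (c / 2)); auto; [lra|]|].
          - specialize (him x t hx ltac:(lra)). lra.
          - right. f_equal. f_equal. ring. }
        pose proof (hstep x t hx ht htD) as T2.
        match goal with |- _ + Cmod (?p - ?q)%C <= _ =>
          pose proof (Cmod_triangle p (- q)) as T3; rewrite Cmod_opp in T3;
          change (p + - q)%C with (p - q)%C in T3 end.
        set (E := Cmod (e x - h t x)%C) in *. assert (0 <= E) by apply Cmod_ge_0.
        assert (ex1 : exp (K2 * (t + D)) = exp (K2 * t) * exp (K2 * D))
          by (rewrite <- exp_plus; f_equal; ring).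
        pose proof (exp_ineq1_le (K2 * D)) as ex2.
        assert (ex3 : 1 <= exp (K2 * (t + D))).
        { pose proof (exp_ineq1_le (K2 * (t + D))). nra. }
        assert (S1 : E * (1 + K2 * D) <= e1 * t * exp (K2 * (t + D))).
        { rewrite ex1. rewrite <- Rmult_assoc. apply Rmult_le_compat; auto.
          assert (0 <= K2 * D) by nra. lra. }
        assert (S2 : e1 * D <= e1 * D * exp (K2 * (t + D))).
        { rewrite <- (Rmult_1_r (e1 * D)) at 1. apply Rmult_le_compat_l; nra. }
        nra. }
  destruct (main N (le_n N)) as [e [ae he']]. exists e. split; auto.
  intros x hx. specialize (he' x hx). rewrite hDS in he'. rewrite Cmod_minus_sym.
  eapply Rle_trans; [exact he'|]. eapply Rle_trans; [|exact hte].
  eapply Rle_trans; [|exact hAe]. unfold e1, A. right; ring.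
Qed.

(** * Analyticity of the tip *)

Lemma cderive_affine (F : R -> C) a z s m :
  cderive F (a + z * s) m -> cderive (fun u => F (a + z * u)) s (RtoC z * m)%C.
Proof.
  assert (G : forall (p : R -> R) (q : R), is_derive p (a + z * s) q ->
     is_derive (fun u => p (a + z * u)) s (z * q)).
  { intros p q hp. eapply derive_eq.
    - apply (is_derive_comp p (fun u => a + z * u)); [exact hp|].
      apply derive_add; [apply derive_const|apply derive_mul; [apply derive_const|apply derive_id]].
    - unfold scal; simpl; unfold mult; simpl. ring. }
  intros [h1 h2]. split.
  - replace (Re (RtoC z * m)%C) with (z * Re m) by (unfold Re; simpl; ring).
    apply (G (fun u => Re (F u))); auto.
  - replace (Im (RtoC z * m)%C) with (z * Im m) by (unfold Im; simpl; ring).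
    apply (G (fun u => Im (F u))); auto.
Qed.

Lemma ccont_affine (F : R -> C) a z : ccont F -> ccont (fun u => F (a + z * u)).
Proof.
  intros [h1 h2]. split; intros s.
  - apply (cont_comp (fun u => a + z * u) (fun v => Re (F v))); [prove_cont|auto].
  - apply (cont_comp (fun u => a + z * u) (fun v => Im (F v))); [prove_cont|auto].
Qed.

(** With complex zeta and l the height is no longer monotone, so a bootstrap replaces monotonicity:
    as long as Im X >= y / 2 the truncation is not felt, and [tip_cone] then gives Im X >= y, so the
    level y / 2 is never reached. *)
Lemma complex_tip_exists (zeta : C) (l : R -> C) M S y : zeta_ok zeta -> ccont l ->
  0 <= M -> 0 <= S -> 0 < y -> 192 * (M * M) * (y * y + 8 * S) <= 1 ->
  (forall s, 0 < s < S -> exists m, cderive l s m /\ Cmod m <= M) ->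
  exists h, sol (- (RtoC 2 * zeta))%C l 0 S h /\ tipsol zeta l M S h /\
    (h 0 - l 0)%C = (0, y) /\ forall s, 0 <= s <= S -> y <= Im (h s - l s)%C.
Proof.
  intros hz lc hM hS hy hsm hl.
  destruct (trunc_flow (- (RtoC 2 * zeta))%C l (y / 2) 0 S (l 0 + (0, y))%C hS ltac:(lra) lc)
    as [h [hc [h0 hd]]].
  set (f := fun s => Im (h s - l s)%C).
  assert (fc : forall s, continuous f s) by apply (proj2 (ccont_sub _ _ hc lc)).
  assert (i0 : (h 0 - l 0)%C = (0, y)) by (rewrite h0; ring).
  assert (f0 : f 0 = y) by (unfold f; rewrite i0; reflexivity).
  assert (tip : forall r, 0 <= r <= S -> (forall s, 0 <= s <= r -> y / 2 <= f s) ->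
     tipsol zeta l M r h).
  { intros r hr hf. split; auto. split; auto. intros s hs. split; [|split].
    - rewrite <- (trunc_id (y / 2) (h s - l s)%C); [apply hd; lra|]. apply (hf s). lra.
    - apply hl; lra.
    - specialize (hf s ltac:(lra)). unfold f in hf. lra. }
  assert (low : forall r, 0 <= r <= S -> tipsol zeta l M r h -> y * y <= f r * f r).
  { intros r hr ht. destruct (tip_cone zeta l M r h y) as [H _]; auto; try lra.
    - assert (0 <= M * M) by nra. nra.
    - fold (f r) in H. set (x := Re (h r - l r)%C) in *. nra. }
  assert (half : forall s, 0 <= s <= S -> y / 2 <= f s).
  { intros s hs. destruct (Rlt_or_le (f s) (y / 2)) as [h1|h1]; auto. exfalso.
    destruct (first_exit f 0 s (y / 2)) as [r [hr [E hr']]]; auto; try lra.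
    pose proof (low r ltac:(lra) (tip r ltac:(lra) hr')) as Q. rewrite E in Q. nra. }
  exists h. split; [|split; [|split]]; auto.
  - split; auto. intros s hs. rewrite <- (trunc_id (y / 2) (h s - l s)%C); [apply hd; lra|].
    apply (half s). lra.
  - apply tip; [lra|]. auto.
  - intros s hs.
    assert (Q := low s hs (tip s hs (fun u hu => half u ltac:(lra)))).
    specialize (half s hs). fold (f s). nra.
Qed.

Lemma rev_shift T lam t t' g : 0 <= t' <= t -> rev_traj T lam t g -> rev_traj T lam t' (fun s => g (t - t' + s)).
Proof.
  intros ht [[gc gd] gp]. split.
  - assert (E : forall s, t - t' + s = t - t' + 1 * s) by (intros; ring).
    split.
    + pose proof (ccont_affine g (t - t') 1 gc) as Q.
      split; intros s.
      * apply (continuous_ext (fun u => Re (g (t - t' + 1 * u)))); [|apply Q].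
        intros u. now rewrite Rmult_1_l.
      * apply (continuous_ext (fun u => Im (g (t - t' + 1 * u)))); [|apply Q].
        intros u. now rewrite Rmult_1_l.
    + intros s hs.
      apply (cderive_ext_loc (fun u => g (t - t' + 1 * u)) _ s _ 1); [lra| |].
      * intros u _. now rewrite Rmult_1_l.
      * replace (RtoC (-2) / (g (t - t' + s)%R - rdriving T lam t' s))%C
          with (RtoC 1 * (RtoC (-2) / (g (t - t' + s)%R - rdriving T lam t (t - t' + s))))%C.
        { rewrite Rplus_comm, Rplus_comm at 1. rewrite (E s).
          apply cderive_affine. apply gd. lra. }
        { unfold rdriving at 1. replace (t - (t - t' + s)) with (t' - s) by ring. fold (rdriving T lam t' s).
          ring. }
  - intros s hs. apply gp. lra.
Qed.

Definition disc_analytic_at (T : R) (gam : R -> C) (t0 : R) : Prop :=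
  exists rho Gam, 0 < rho /\ approx rho Gam /\
    forall t, 0 < t <= T -> Rabs (t - t0) <= rho -> Gam (RtoC (t - t0)) = gam t.

Lemma half_seq_le Y : 0 < Y -> forall n m : nat, (n <= m)%nat -> 0 < Y * (/ 2) ^ m <= Y * (/ 2) ^ n.
Proof.
  intros hY n m hnm. assert (0 < (/ 2) ^ m) by (apply pow_lt; lra). split; [nra|].
  apply Rmult_le_compat_l; [lra|]. replace m with (n + (m - n))%nat by lia. rewrite pow_add.
  assert (0 < (/ 2) ^ n) by (apply pow_lt; lra).
  assert ((/ 2) ^ (m - n) <= 1) by (rewrite <- (pow1 (m - n)); apply pow_incr; lra). nra.
Qed.

(* For t = t0 + x the reverse flow runs from the tip at time t to the fixed time tb = t0 - e;
   rescaled to [0, e] it has the complex parameter zeta = 1 + x / e. *)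
Lemma tip_part T lam gam t0 : extendable T lam -> tip_curve T lam gam -> 0 < t0 <= T ->
  exists rho e W c, 0 < rho /\ 0 < c /\ 8 * rho = e /\ 2 * e <= t0 /\ approx rho W /\
    (forall x, Cmod x <= rho -> c <= Im (W x)) /\
    (forall t g, 0 < t <= T -> Rabs (t - t0) <= rho -> tip_traj T lam t g ->
       W (RtoC (t - t0)) = g (t - (t0 - e))).
Proof.
  intros hn hg ht0. destruct (proj2 hn t0 ltac:(lra)) as [r [M0 [Lam [Lam' hl]]]].
  assert (hr : 0 < r) by apply hl. assert (hM0 : 0 <= M0) by apply hl.
  (* The rescaled driving function has derivative -zeta Lam', and |zeta| <= 3/2. *)
  set (M := 2 * M0). assert (hM : 0 <= M) by (unfold M; lra).
  (* The bound t0 / 2 leaves a positive time t0 - e. The bound r / 2 keeps |x - zeta s| <= (1/8 +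
     9/8) e inside the disc of the extension. The last bound is the smallness condition of the cone
     for y^2 <= e. *)
  set (e := Rmin (t0 / 2) (Rmin (r / 2) (/ (1728 * (M * M + 1))))).
  assert (hq : 0 < 1728 * (M * M + 1)) by nra.
  assert (he : 0 < e).
  { repeat apply Rmin_pos; try lra. apply Rinv_0_lt_compat; auto. }
  assert (he1 : e <= t0 / 2) by apply Rmin_l.
  assert (he' : e <= Rmin (r / 2) (/ (1728 * (M * M + 1)))) by apply Rmin_r.
  pose proof (Rmin_l (r / 2) (/ (1728 * (M * M + 1)))) as he2.
  pose proof (Rmin_r (r / 2) (/ (1728 * (M * M + 1)))) as he3.
  assert (hsm : 192 * (M * M) * (e + 8 * e) <= 1).
  { assert (1728 * (M * M + 1) * e <= 1); [|nra].
    apply mul_le_one; lra. }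
  set (rho := e / 8). assert (hrho : 0 < rho) by (unfold rho; lra).
  set (zeta := fun x : C => (1 + RtoC (/ e) * x)%C).
  assert (hxe : forall x, Cmod x <= rho -> Cmod (RtoC (/ e) * x)%C <= 1 / 8).
  { intros x hx. rewrite Cmod_mult, Cmod_R, Rabs_right.
    - apply Rmult_le_reg_l with e; auto. rewrite <- Rmult_assoc, Rinv_r by lra.
      unfold rho in hx. lra.
    - apply Rle_ge, Rlt_le, Rinv_0_lt_compat; auto. }
  assert (hzeta : forall x, Cmod x <= rho -> zeta_ok (zeta x)).
  { intros x hx. specialize (hxe x hx).
    pose proof (re_le_Cmod (RtoC (/ e) * x)%C) as a1. pose proof (im_le_Cmod (RtoC (/ e) * x)%C) as a2.
    unfold zeta, zeta_ok.
    change (Re (1 + RtoC (/ e) * x)%C) with (1 + Re (RtoC (/ e) * x)%C).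
    change (Im (1 + RtoC (/ e) * x)%C) with (0 + Im (RtoC (/ e) * x)%C).
    rewrite Rplus_0_l. pose proof (Rle_trans _ _ _ a1 hxe) as b1. apply Rabs_le_between in b1.
    split; lra. }
  assert (hzm : forall x, Cmod x <= rho -> Cmod (zeta x) <= 3 / 2).
  { intros x hx. apply zeta_ok_mod; auto. }
  assert (hzm' : forall x, Cmod x <= rho -> Cmod (zeta x) <= 9 / 8).
  { intros x hx. unfold zeta. eapply Rle_trans; [apply Cmod_triangle|]. rewrite Cmod_1.
    specialize (hxe x hx). lra. }
  set (pt := fun (x : C) (s : R) => (RtoC t0 + x - zeta x * RtoC s)%C).
  assert (hpt : forall x s, Cmod x <= rho -> 0 <= s <= e -> Cmod (pt x s - RtoC t0)%C < r).
  { intros x s hx hs. replace (pt x s - RtoC t0)%C with (x - zeta x * RtoC s)%C by (unfold pt; ring).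
    eapply Rle_lt_trans; [apply Cmod_triangle|]. rewrite Cmod_opp, Cmod_mult, Cmod_R, Rabs_right by lra.
    specialize (hzm' x hx). assert (Cmod (zeta x) * s <= 9 / 8 * e).
    { apply Rmult_le_compat; auto using Cmod_ge_0; lra. }
    unfold rho in hx. lra. }
  set (l := fun (s : R) (x : C) => Lam (pt x (clamp 0 e s))).
  assert (hcl : forall s, 0 <= clamp 0 e s <= e) by (intros; apply clamp_in; lra).
  set (K := M0 * (1 + 2 * r) * (3 / 2)).
  assert (hK : 0 <= K).
  { unfold K. apply Rmult_le_pos; [|lra]. apply Rmult_le_pos; lra. }
  assert (llip : forall s u x, Cmod x <= rho -> Cmod (l s x - l u x)%C <= K * Rabs (s - u)).
  { intros s u x hx. unfold l.
    pose proof (local_ext_lip T lam t0 r M0 Lam Lam' (pt x (clamp 0 e s)) (pt x (clamp 0 e u)) hl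
      (Rlt_le _ _ (hpt x _ hx (hcl s))) (Rlt_le _ _ (hpt x _ hx (hcl u)))) as H.
    eapply Rle_trans; [exact H|].
    replace (pt x (clamp 0 e s) - pt x (clamp 0 e u))%C
      with (- (zeta x * RtoC (clamp 0 e s - clamp 0 e u)))%C
      by (unfold pt; rewrite RtoC_minus; ring).
    rewrite Cmod_opp, Cmod_mult, Cmod_R. unfold K. rewrite (Rmult_assoc (M0 * _)).
    apply Rmult_le_compat_l; [apply Rmult_le_pos; lra|].
    apply Rmult_le_compat; auto using Cmod_ge_0, Rabs_pos. apply clamp_lip. }
  assert (lcont : forall x, Cmod x <= rho -> ccont (fun s => l s x)).
  { intros x hx. apply ccont_iff_eps. intros s eps hep. exists (eps / (K + 1)).
    split; [apply Rdiv_lt_0_compat; lra|]. intros u hu.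
    eapply Rle_lt_trans; [apply llip; auto|].
    assert ((K + 1) * Rabs (u - s) < eps).
    { apply mul_lt_of_lt_div; lra. }
    pose proof (Rabs_pos (u - s)). lra. }
  assert (lder : forall x, Cmod x <= rho -> forall s, 0 < s < e ->
     exists m, cderive (fun s => l s x) s m /\ Cmod m <= M).
  { intros x hx s hs. exists (- (zeta x * Lam' (pt x s)))%C. split.
    - apply (cderive_ext_loc (fun u => Lam (pt x u)) _ s _ (Rmin s (e - s))).
      + apply Rmin_pos; lra.
      + intros u hu. unfold l. pose_Rmin s (e - s).
        apply Rabs_lt_between in hu. rewrite clamp_id by lra. reflexivity.
      + apply (local_ext_cderive T lam t0 r M0); auto. apply (hpt x s); auto; lra.
    - rewrite Cmod_opp, Cmod_mult. unfold M.
      assert (Cmod (Lam' (pt x s)) <= M0).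
      { apply hl. apply Rlt_le, hpt; auto; lra. }
      specialize (hzm x hx). pose proof (Cmod_ge_0 (zeta x)). pose proof (Cmod_ge_0 (Lam' (pt x s))).
      nra. }
  assert (azeta : approx rho zeta).
  { apply approx_plus; [apply approx_const|]. apply approx_mult; [apply approx_const|apply approx_id]. }
  assert (al : forall s, approx rho (l s)).
  { intros s. apply approx_lim. intros eps hep.
    destruct (proj2 (proj2 (proj2 (proj2 (proj2 hl)))) eps hep) as [p hp].
    exists (fun x => peval p (pt x (clamp 0 e s) - RtoC t0)%C). split.
    - apply approx_peval. apply approx_minus; [|apply approx_const].
      apply approx_minus; [apply approx_plus; [apply approx_const|apply approx_id]|].
      apply approx_mult; [auto|apply approx_const].
    - intros x hx. apply hp. apply Rlt_le, hpt; auto. }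
  set (Y := Rmin 1 e). assert (hY : 0 < Y) by (apply Rmin_pos; lra).
  assert (hYe : Y <= e) by apply Rmin_r. assert (hY1 : Y <= 1) by apply Rmin_l.
  set (y := fun n : nat => Y * (/ 2) ^ n).
  assert (hyn : forall n m, (n <= m)%nat -> 0 < y m <= y n) by (apply half_seq_le; auto).
  assert (hy0 : forall n, 0 < y n <= Y).
  { intros n. pose proof (hyn 0%nat n ltac:(lia)). unfold y in H at 3. simpl in H. lra. }
  assert (hsmn : forall n, 192 * (M * M) * (y n * y n + 8 * e) <= 1).
  { intros n. specialize (hy0 n). assert (0 <= M * M) by nra. assert (y n * y n <= e) by nra. nra. }
  assert (ex : forall n x, exists h, Cmod x <= rho ->
     sol (- (RtoC 2 * zeta x))%C (fun s => l s x) 0 e h /\ tipsol (zeta x) (fun s => l s x) M e h /\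
     (h 0 - l 0 x)%C = (0, y n) /\ forall s, 0 <= s <= e -> y n <= Im (h s - l s x)%C).
  { intros n x. destruct (Rle_dec (Cmod x) rho) as [hx|hx]; [|exists (fun _ => 0%C); tauto].
    destruct (complex_tip_exists (zeta x) (fun s => l s x) M e (y n)) as [h hh]; auto; try lra.
    - apply hy0.
    - exists h. auto. }
  assert (exn : forall n, exists H : C -> R -> C, forall x, Cmod x <= rho ->
     sol (- (RtoC 2 * zeta x))%C (fun s => l s x) 0 e (H x) /\
     tipsol (zeta x) (fun s => l s x) M e (H x) /\
     (H x 0%R - l 0 x)%C = (0, y n) /\ forall s, 0 <= s <= e -> y n <= Im (H x s - l s x)%C).
  { intros n. apply (fun_choice _ (ex n)). }
  destruct (fun_choice _ exn) as [H hH]. clear ex exn.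
  assert (aW : forall n, approx rho (fun x => H n x e)).
  { intros n. apply (euler_approx rho (fun x => - (RtoC 2 * zeta x))%C l (fun s x => H n x s) e (y n) 3);
      auto; try lra.
    - apply hy0.
    - apply (approx_ext _ (fun x => RtoC (-2) * zeta x)%C).
      + intros x _. replace (-2) with (- (2)) by ring. rewrite RtoC_opp. ring.
      + apply approx_mult; [apply approx_const|auto].
    - intros x hx. rewrite Cmod_opp, Cmod_mult, Cmod_R, Rabs_right by lra. specialize (hzm x hx). lra.
    - intros eta heta. exists (eta / (K + 1)). split; [apply Rdiv_lt_0_compat; lra|].
      intros s u x _ _ hsu hx. eapply Rle_trans; [apply llip; auto|].
      assert ((K + 1) * Rabs (s - u) <= eta).
      { apply mul_le_of_le_div; lra. }
      pose proof (Rabs_pos (s - u)). lra.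
    - apply (approx_ext _ (fun x => l 0 x + (0, y n))%C).
      + intros x hx. rewrite <- (proj1 (proj2 (proj2 (hH n x hx)))). ring.
      + apply approx_plus; [auto|apply approx_const].
    - intros x hx. apply hH; auto.
    - intros x s hx hs. apply hH; auto. }
  assert (cau : forall n m x, Cmod x <= rho -> (n <= m)%nat -> Cmod (H m x e - H n x e)%C <= y n).
  { intros n m x hx hnm. pose proof (hyn n m hnm).
    apply Rle_trans with (Rabs (y m - y n)); [|rewrite Rabs_left1; lra].
    destruct (hH n x hx) as [_ [n1 [n2 _]]]. destruct (hH m x hx) as [_ [m1 [m2 _]]].
    apply (tip_contract (zeta x) (fun s => l s x) M e); auto; try lra; apply Rlt_le, hy0. }
  assert (lim : forall x, exists w, Cmod x <= rho -> forall n, Cmod (H n x e - w)%C <= y n).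
  { intros x. destruct (Rle_dec (Cmod x) rho) as [hx|hx]; [|exists 0%C; tauto].
    destruct (C_complete (fun n => H n x e) y) as [w hw].
    - intros k m hkm. now apply cau.
    - intros eps hep. destruct (pow_half_lt Y eps hep) as [k hk]. eauto.
    - exists w. auto. }
  destruct (fun_choice _ lim) as [W hW]. clear lim.
  assert (small : forall eps, 0 < eps -> exists n, y n < eps).
  { intros eps hep. destruct (pow_half_lt Y eps hep) as [k hk]. eauto. }
  assert (le : forall x, Cmod x <= rho -> l e x = RtoC (lam (t0 - e))).
  { intros x hx. unfold l. rewrite clamp_id by lra.
    replace (pt x e) with (RtoC (t0 - e)).
    - apply (proj1 (proj2 (proj2 hl))); [lra|]. rewrite Rabs_left; lra.
    - replace (pt x e) with (RtoC t0 - RtoC e + x * (1 - RtoC (/ e) * RtoC e))%C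
        by (unfold pt, zeta; ring).
      rewrite <- RtoC_mult, Rinv_l, RtoC_minus by lra. ring. }
  (* The height sqrt e comes from (Im X)^2 >= y^2 + (5/2) e at s = e, uniformly in n and x; there l
     is real, so Im X is the height of the solution itself. *)
  exists rho, e, W, (sqrt e). split; auto. split; [now apply sqrt_lt_R0|].
  split; [unfold rho; field|]. split; [lra|]. split; [|split].
  - apply approx_lim. intros eps hep. destruct (small eps hep) as [n hn'].
    exists (fun x => H n x e). split; auto. intros x hx. rewrite Cmod_minus_sym.
    specialize (hW x hx n). lra.
  - intros x hx. apply le_epsilon. intros eps hep. destruct (small eps hep) as [n hn'].
    destruct (hH n x hx) as [_ [h1 [h2 h3]]].
    destruct (tip_cone (zeta x) (fun s => l s x) M e (H n x) (y n)) as [c1 _]; auto; try lra.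
    { apply Rlt_le, hy0. }
    specialize (h3 e ltac:(lra)). cbv beta in c1. rewrite le in c1, h3 by auto.
    rewrite Im_minus in c1, h3. change (Im (RtoC (lam (t0 - e)))) with 0 in c1, h3.
    rewrite Rminus_0_r in c1, h3. pose proof (hy0 n) as hyn0.
    assert (sqrt e <= Im (H n x e)).
    { apply sqrt_le_of_sq; [lra|]. set (xx := Re (H n x e - _)%C) in *. nra. }
    specialize (hW x hx n). pose proof (im_le_mod (H n x e - W x)%C) as I. rewrite Im_minus in I. lra.
  - intros t g ht htr [rg ig].
    set (x := RtoC (t - t0)). assert (hx : Cmod x <= rho) by (unfold x; rewrite Cmod_R; auto).
    set (zr := 1 + / e * (t - t0)).
    assert (ze : zeta x = RtoC zr).
    { unfold zeta, x, zr. rewrite RtoC_plus, RtoC_mult. reflexivity. }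
    assert (zre : zr * e = t - (t0 - e)) by (unfold zr; field; lra).
    assert (hzr : 7 / 8 <= zr <= 9 / 8).
    { apply Rabs_le_between in htr. unfold rho in htr.
      split; apply Rmult_le_reg_r with e; auto; rewrite zre; lra. }
    (* For real x the factor zeta is the real number zr, and the rescaled tip trajectory solves the
       same equation with starting height 0; contraction against height y n identifies its end with
       W x. *)
    set (k := fun s => g (0 + zr * s)).
    assert (kc : ccont k) by (apply ccont_affine; apply rg).
    assert (lk : forall s, 0 <= s <= e -> l s x = rdriving T lam t (0 + zr * s)).
    { intros s hs. unfold l. rewrite clamp_id by auto.
      assert (zs : 0 <= zr * s <= zr * e).
      { split; [apply Rmult_le_pos; lra|apply Rmult_le_compat_l; lra]. }
      replace (pt x s) with (RtoC (t - (0 + zr * s))).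
      - unfold rdriving. rewrite driving_eq by (rewrite zre in zs; lra).
        apply (proj1 (proj2 (proj2 hl))); [rewrite zre in zs; lra|].
        rewrite <- Cmod_R. replace (RtoC (t - (0 + zr * s) - t0)) with (pt x s - RtoC t0)%C.
        + apply Rlt_le, hpt; auto.
        + unfold pt. rewrite ze. unfold x. rewrite !RtoC_minus, RtoC_plus, RtoC_mult. ring.
      - unfold pt. rewrite ze. unfold x. rewrite !RtoC_minus, RtoC_plus, RtoC_mult. ring. }
    assert (tk : tipsol (zeta x) (fun s => l s x) M e k).
    { split; auto. split; [now apply lcont|]. intros s hs.
      assert (zs : 0 < zr * s < zr * e).
      { split; [apply Rmult_lt_0_compat; lra|apply Rmult_lt_compat_l; lra]. }
      split; [|split].
      - rewrite lk by lra. unfold k at 2.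
        replace (- (RtoC 2 * zeta x) / (g (0 + zr * s)%R - rdriving T lam t (0 + zr * s)))%C
          with (RtoC zr * (RtoC (-2) / (g (0 + zr * s)%R - rdriving T lam t (0 + zr * s))))%C.
        + apply cderive_affine. apply rg. rewrite zre in zs. lra.
        + rewrite ze. replace (-2) with (- (2)) by ring. rewrite RtoC_opp. unfold Cdiv. ring.
      - apply lder; auto.
      - rewrite lk by lra. rewrite Im_minus, rdriving_im. unfold k. rewrite Rminus_0_r.
        apply rg. rewrite zre in zs. lra. }
    assert (k0 : (k 0 - l 0 x)%C = (0, 0)).
    { rewrite lk by lra. unfold k. replace (0 + zr * 0) with 0 by ring. rewrite ig.
      unfold rdriving. rewrite Rminus_0_r, driving_eq by lra. unfold Cminus. now rewrite Cplus_opp_r. }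
    transitivity (k e).
    + apply Cmod_small_eq. intros eps hep. destruct (small (eps / 2)) as [n hn']; [lra|].
      destruct (hH n x hx) as [_ [h1 [h2 _]]].
      assert (Q : Cmod (H n x e - k e)%C <= Rabs (y n - 0)).
      { apply (tip_contract (zeta x) (fun s => l s x) M e); auto; try lra.
        apply Rlt_le, hy0. }
      pose proof (hy0 n). rewrite Rminus_0_r, Rabs_right in Q by lra.
      pose proof (Cmod_tri3 (W x) (H n x e) (k e)) as T1. rewrite (Cmod_minus_sym (W x) (H n x e)) in T1.
      specialize (hW x hx n). lra.
    + unfold k. f_equal. rewrite Rplus_0_l. exact zre.
Qed.

(** The remaining flow from time t0 - e down to 0 starts at height at least c, so it is regular, and
    x enters only through the initial value W x. *)
Lemma tip_curve_disc_analytic T lam gam t0 : extendable T lam -> tip_curve T lam gam -> 0 < t0 <= T ->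
  disc_analytic_at T gam t0.
Proof.
  intros hn hg ht0.
  destruct (tip_part T lam gam t0 hn hg ht0) as [rho [e [W [c [hrho [hc [he1 [he2 [aW [hWc hW]]]]]]]]]].
  set (tb := t0 - e). assert (htb : 0 < tb) by (unfold tb; lra).
  assert (ex : forall x, exists k, Cmod x <= rho -> rev_traj T lam tb k /\ k 0 = W x /\
     forall s, 0 <= s <= tb -> Im (W x) <= Im (k s)).
  { intros x. destruct (Rle_dec (Cmod x) rho) as [hx|hx]; [|exists (fun _ => 0%C); tauto].
    destruct (rev_exists T lam tb (W x) hn ltac:(lra)) as [k hk]; [specialize (hWc x hx); lra|eauto]. }
  destruct (fun_choice _ ex) as [k hk]. clear ex.
  exists rho, (fun x => k x tb). split; auto. split.
  - apply (euler_approx rho (fun _ => RtoC (-2)) (fun s _ => rdriving T lam tb s) (fun s x => k x s) tb c 2);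
      auto; try lra.
    + apply approx_const.
    + intros. rewrite Cmod_R, Rabs_left; lra.
    + intros. apply approx_const.
    + intros eta heta.
      destruct (Heine_cor2 (f := fun s => Re (rdriving T lam tb s)) (a := 0) (b := tb)) with
        (eps := mkposreal eta heta) as [d hd].
      { intros s _. apply continuity_pt_filterlim. apply (proj1 (rdriving_cont T lam tb hn) s). }
      exists (d / 2). split; [pose proof (cond_pos d); lra|].
      intros s u _ hs hu hsu _. unfold rdriving, driving. rewrite <- RtoC_minus, Cmod_R.
      apply Rlt_le. apply (hd s u); auto. pose proof (cond_pos d). lra.
    + apply (approx_ext _ W); auto. intros x hx. symmetry. now apply hk.
    + intros x hx. apply (hk x hx).
    + intros x s hx hs. rewrite Im_minus, rdriving_im. destruct (hk x hx) as [_ [_ h3]].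
      specialize (h3 s hs). specialize (hWc x hx). lra.
  - intros t ht htr. destruct (proj2 hg t ht) as [g [tg eg]].
    set (x := RtoC (t - t0)). assert (hx : Cmod x <= rho) by (unfold x; rewrite Cmod_R; auto).
    destruct (hk x hx) as [h1 [h2 _]]. specialize (hWc x hx).
    assert (E : W x = g (t - tb)) by (apply hW; auto).
    apply Rabs_le_between in htr.
    assert (r2 : rev_traj T lam tb (fun s => g (t - tb + s))).
    { apply rev_shift; [unfold tb in *; lra|apply tg]. }
    rewrite <- eg. replace (g t) with (g (t - tb + tb)) by (f_equal; ring).
    apply Cmod_small_eq. intros eps hep.
    pose proof (rev_compare T lam tb c 0 tb (k x) _ ltac:(lra) ltac:(lra) ltac:(lra) hc h1 r2) as Q.
    cbv beta in Q. rewrite Rplus_0_r, h2, <- E in Q. specialize (Q hWc hWc).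
    rewrite Cminus_diag, Cmod_0, Rmult_0_r in Q. lra.
Qed.

Lemma peval_lip0 rho p : exists K, 0 <= K /\
  forall x, Cmod x <= rho -> Cmod (peval p x - peval p 0)%C <= K * Cmod x.
Proof.
  destruct p as [|c q].
  - exists 0. split; [lra|]. intros x _. simpl. rewrite Cminus_diag, Cmod_0. lra.
  - destruct (peval_bounded rho q) as [B [hB HB]]. exists B. split; auto.
    intros x hx. simpl. replace (c + x * peval q x - (c + 0 * peval q 0))%C with (x * peval q x)%C by ring.
    rewrite Cmod_mult, Rmult_comm. apply Rmult_le_compat_r; auto. apply Cmod_ge_0.
Qed.

(** At t0 > 0 continuity comes from polynomial approximation on a disc. At 0 the curve is compared
    with lam 0 through the size of its tip trajectory. *)
Lemma tip_curve_cont T lam gam : extendable T lam -> tip_curve T lam gam -> Ccont_on 0 T gam.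
Proof.
  intros hn hg t0 ht0 eps he. assert (hT : 0 < T) by apply hn.
  destruct (Rle_lt_or_eq_dec 0 t0 (proj1 ht0)) as [h|<-].
  - destruct (tip_curve_disc_analytic T lam gam t0 hn hg ltac:(lra)) as [rho [Gam [hrho [aG hG]]]].
    destruct (aG (eps / 4) ltac:(lra)) as [p hp].
    destruct (peval_lip0 rho p) as [K [hK HK]].
    exists (Rmin t0 (Rmin rho (eps / 4 / (K + 1)))). split.
    { repeat apply Rmin_pos; auto. apply Rdiv_lt_0_compat; lra. }
    intros t ht htt. change (Cmod (gam t - gam t0)%C < eps).
    pose_Rmin t0 (Rmin rho (eps / 4 / (K + 1))).
    pose_Rmin rho (eps / 4 / (K + 1)).
    assert (t1 : 0 < t) by (apply Rabs_lt_between in htt; lra).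
    assert (Q : (K + 1) * Rabs (t - t0) < eps / 4).
    { apply mul_lt_of_lt_div; lra. }
    rewrite <- (hG t) by lra.
    rewrite <- (hG t0) by (try lra; rewrite Rminus_diag, Rabs_R0; lra).
    rewrite Rminus_diag. set (x := RtoC (t - t0)).
    assert (hx : Cmod x = Rabs (t - t0)) by apply Cmod_R.
    pose proof (hp x ltac:(lra)) as p1. pose proof (hp 0%C ltac:(rewrite Cmod_0; lra)) as p2.
    specialize (HK x ltac:(lra)). rewrite hx in HK. rewrite Cmod_minus_sym in p2.
    pose proof (Cmod_tri3 (Gam x) (peval p x) (Gam 0%C)) as T1.
    pose proof (Cmod_tri3 (peval p x) (peval p 0%C) (Gam 0%C)) as T2.
    pose proof (Rabs_pos (t - t0)). lra.
  - destruct (proj2 hn 0 ltac:(lra)) as [r [M [Lam [Lam' hl]]]].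
    assert (hr : 0 < r) by apply hl. assert (hM : 0 <= M) by apply hl.
    (* From X = 0 at the start, [tip_size] gives |gamma(t) - lam 0|^2 <= 3 * 8 t, which is below
       eps^2 / 2 for t < eps^2 / 48. *)
    exists (Rmin r (Rmin (/ (M * M + 1)) (eps * eps / 48))). split.
    { repeat apply Rmin_pos; auto; [apply Rinv_0_lt_compat; nra|nra]. }
    intros t ht htt. change (Cmod (gam t - gam 0%R)%C < eps).
    pose_Rmin r (Rmin (/ (M * M + 1)) (eps * eps / 48)).
    pose_Rmin (/ (M * M + 1)) (eps * eps / 48).
    rewrite Rminus_0_r, Rabs_right in htt by lra.
    destruct (Rle_lt_or_eq_dec 0 t (proj1 ht)) as [h|<-].
    2:{ rewrite Cminus_diag, Cmod_0. auto. }
    destruct (proj2 hg t ltac:(lra)) as [g [[tg ig] eg]].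
    assert (hts : tipsol (RtoC 1) (rdriving T lam t) M t g).
    { apply sol_tipsol; auto; [|lra]. intros s hs.
      apply (rdriving_cderive T lam 0 t r M Lam Lam'); auto; [lra|]. rewrite Rabs_right; lra. }
    pose proof (tip_size (RtoC 1) _ M t g hM ltac:(lra) (zeta_ok_mod _ zeta_ok_1) hts) as Q.
    unfold rdriving in Q. rewrite Rminus_diag, Rminus_0_r, !driving_eq in Q by lra.
    rewrite ig, eg, <- (proj1 hg) in Q. rewrite Cminus_diag, Cmod_0 in Q.
    assert (E : exp (M * M * t) <= 3).
    { apply exp_le_3_of_le_1. assert ((M * M + 1) * t <= 1); [|nra].
      apply mul_le_one; [nra|lra]. }
    pose proof (exp_pos (M * M * t)). set (n := Cmod (gam t - gam 0%R)%C) in *.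
    assert (hn0 : 0 <= n) by apply Cmod_ge_0.
    assert (n * n <= 24 * t) by nra. nra.
Qed.

Lemma psum_re (a : nat -> C) x N :
  Re (psum (fun n => a n * RtoC x ^ n)%C (S N)) = sum_f_R0 (fun n => Re (a n) * x ^ n) N /\
  Im (psum (fun n => a n * RtoC x ^ n)%C (S N)) = sum_f_R0 (fun n => Im (a n) * x ^ n) N.
Proof.
  assert (T : forall n, Re (a n * RtoC x ^ n)%C = Re (a n) * x ^ n /\
                        Im (a n * RtoC x ^ n)%C = Im (a n) * x ^ n).
  { intros n. rewrite <- RtoC_pow. unfold Re, Im; simpl. split; ring. }
  induction N as [|N [IH1 IH2]].
  - destruct (T 0%nat) as [T1 T2]. simpl psum. rewrite Cplus_0_l. simpl sum_f_R0. auto.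
  - destruct (T (S N)) as [T1 T2]. rewrite !tech5. rewrite <- IH1, <- IH2, <- T1, <- T2. auto.
Qed.

(** At real x, the real and imaginary parts of the complex series are the series of the real and
    imaginary parts of its coefficients; [p] stands for either part. *)
Lemma disc_analytic_real_analytic T gam :
  (forall t0, 0 < t0 <= T -> disc_analytic_at T gam t0) ->
  real_analytic_on (fun t => 0 < t <= T) (fun t => Re (gam t)) /\
  real_analytic_on (fun t => 0 < t <= T) (fun t => Im (gam t)).
Proof.
  intros H.
  assert (K : forall p : C -> R, (forall z w, Rabs (p z - p w) <= Cmod (z - w)%C) ->
    (forall a x N, p (psum (fun n => a n * RtoC x ^ n)%C (S N)) =
       sum_f_R0 (fun n => p (a n) * x ^ n) N) ->
    real_analytic_on (fun t => 0 < t <= T) (fun t => p (gam t))).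
  { intros p hp hs t0 ht0. destruct (H t0 ht0) as [rho [Gam [hrho [aG hG]]]].
    destruct (approx_power_series rho Gam hrho aG) as [a ha].
    exists rho. split; auto. exists (fun n => p (a n)). intros t ht htr eps he.
    destruct (ha (RtoC (t - t0)) ltac:(rewrite Cmod_R; auto) eps he) as [N0 hN].
    exists N0. intros N hN'. unfold Rdist. rewrite <- hs.
    eapply Rle_lt_trans; [apply hp|]. rewrite <- (hG t ht) by lra. apply hN. lia. }
  split; apply K.
  - intros z w. apply (re_le_Cmod (z - w)%C).
  - intros. apply psum_re.
  - intros z w. apply (im_le_Cmod (z - w)%C).
  - intros. apply psum_re.
Qed.

Lemma real_analytic_ext (D : R -> Prop) f g : (forall t, D t -> f t = g t) ->
  real_analytic_on D f -> real_analytic_on D g.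
Proof.
  intros E H t0 ht0. destruct (H t0 ht0) as [r [hr [a ha]]]. exists r. split; auto.
  exists a. intros t ht htr. rewrite <- E by auto. now apply ha.
Qed.

Theorem theorem1p2 (T : R) (lam : R -> R) (hT : 0 < T)
  (hlam : real_analytic_on (fun t => 0 <= t <= T) lam) :
  (exists gam : R -> Cpx, loewner_generates T lam gam) /\
  (forall gam : R -> Cpx, loewner_generates T lam gam ->
     real_analytic_on (fun t => 0 < t <= T) (fun t => Cre (gam t)) /\
     real_analytic_on (fun t => 0 < t <= T) (fun t => Cim (gam t))).
Proof.
  assert (hn : extendable T lam) by (split; auto; now apply analytic_local_ext).
  destruct (tip_curve_exists T lam hn) as [gam hg].
  pose proof (tip_curve_cont T lam gam hn hg) as hc.
  split.
  - exists gam. now apply tip_curve_generates.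
  - intros gam' hgen.
    pose proof (generated_unique T lam gam gam' hn hg hc hgen) as E.
    destruct (disc_analytic_real_analytic T gam) as [h1 h2].
    { intros t0 ht0. now apply (tip_curve_disc_analytic T lam). }
    split.
    + apply (real_analytic_ext _ (fun t => Re (gam t))); auto.
      intros t ht. now rewrite <- E.
    + apply (real_analytic_ext _ (fun t => Im (gam t))); auto.
      intros t ht. now rewrite <- E.
Qed.
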